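(* Let $d\ge 1$, $s\in(0,1)$, $R>0$, and $\mathcal L\subset\mathbb N=\{0,1,2,\dots\}$ (possibly infinite). Then there exists $\varepsilon>0$ such that the following holds. Let $\phi:\mathbb R^d\to\mathbb R$ be a Lipschitz function bounded on $\mathbb R^d\setminus B(0,R)$ and let $c_l:B(0,R)\to\mathbb R$, $l\in\mathcal L$, be bounded continuous functions, such that $$|\phi|_{L^\infty(\mathbb R^d\setminus B(0,R))}\le\varepsilon\quad\text{and}\quad \sum_{l\in\mathcal L}|c_l|_{L^\infty(B(0,R))}\le\varepsilon .$$ Then the nonlinear problem $$\Delta_s u(x)+\sum_{l\in\mathcal L}c_l(x)u^l(x)=u(x),\quad x\in B(0,R),\qquad u(x)=\phi(x),\quad x\in\mathbb R^d\setminus B(0,R),$$ admits a continuous viscosity solution.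
   Context: $B(x,r)$ denotes the open ball of radius $r$ centered at $x\in\mathbb R^d$. Fractional Laplacian: $\Delta_s u(x)=-(-\Delta)^s u(x)=\frac{4^s\Gamma(s+d/2)}{\pi^{d/2}|\Gamma(-s)|}\lim_{r\to0^+}\int_{\mathbb R^d\setminus B(0,r)}\frac{u(x+z)-u(x)}{|z|^{d+2s}}\,dz$. Write $f(x,y)=\sum_{l\in\mathcal L}c_l(x)y^l$, with $y^0=1$. Continuous viscosity solution: a function $u:\mathbb R^d\to\mathbb R$, continuous on $\overline B(0,R)$, with $u=\phi$ on $\mathbb R^d\setminus B(0,R)$, which is both a viscosity subsolution and supersolution. Subsolution: for every $x_0\in B(0,R)$, every open neighborhood $U$ of $x_0$ with $\overline U\subset B(0,R)$ and every $\xi\in\mathcal C^2(\overline U)$ with $\xi(x_0)=u(x_0)$ and $\xi\ge u$ on $U$, the function $w$ equal to $\xi$ on $U$ and to $u$ on $\mathbb R^d\setminus U$ satisfies $\Delta_s w(x_0)+f(x_0,u(x_0))-u(x_0)\ge0$. Supersolution: the same with $\xi\le u$ on $U$ and the reverse inequality $\le 0$. *)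

(* Defs.v *)
From HB Require Import structures.
From mathcomp Require Import all_boot all_order all_algebra.
From mathcomp Require Import all_classical all_reals all_analysis.

Set Implicit Arguments.
Unset Strict Implicit.
Unset Printing Implicit Defensive.

Import Order.TTheory GRing.Theory Num.Theory.
Import numFieldNormedType.Exports.
Local Open Scope classical_set_scope.
Local Open Scope ring_scope.

Section lebesgue_tuple.
Local Open Scope ereal_scope.
Context {R : realType}.
Local Notation RT := (measurableTypeR R).

Definition tuple_cons n (p : RT * n.-tuple RT) : n.+1.-tuple RT :=
  [the n.+1.-tuple RT of p.1 :: p.2].

Lemma measurable_tuple_cons n : measurable_fun [set: RT * n.-tuple RT] (@tuple_cons n).
Proof. exact: measurable_cons. Qed.

Section step.
Context n (m : {sigma_finite_measure set (n.-tuple RT) -> \bar R}).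

Definition lebesgue_cons : set (n.+1.-tuple RT) -> \bar R :=
  pushforward ((@lebesgue_measure R) \x m) (@tuple_cons n).

Let lebesgue_cons0 : lebesgue_cons set0 = 0.
Proof. by rewrite /lebesgue_cons /pushforward preimage_set0 measure0. Qed.

Let lebesgue_cons_ge0 A : 0 <= lebesgue_cons A.
Proof. by rewrite /lebesgue_cons /pushforward measure_ge0. Qed.

Let lebesgue_cons_sigma_additive : semi_sigma_additive lebesgue_cons.
Proof.
move=> F mF tF mUF; rewrite /lebesgue_cons /pushforward preimage_bigcup.
have mt := @measurable_tuple_cons n.
apply: measure_semi_sigma_additive.
- by move=> i; rewrite -[X in measurable X]setTI; exact: mt.
- apply/trivIsetP => /= i j _ _ ij; rewrite -preimage_setI.
  by move/trivIsetP : tF => /(_ _ _ _ _ ij) ->//; rewrite preimage_set0.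
- by rewrite -preimage_bigcup -[X in measurable X]setTI; exact: mt.
Qed.

HB.instance Definition _ := isMeasure.Build _ _ _ lebesgue_cons
  lebesgue_cons0 lebesgue_cons_ge0 lebesgue_cons_sigma_additive.

Let lebesgue_cons_sigma_finite : sigma_finite setT lebesgue_cons.
Proof.
pose lam : {sigma_finite_measure set RT -> \bar R} := @lebesgue_measure R.
have /sigma_finiteP[F [TF ndF Foo]] := sigma_finiteT lam.
have /sigma_finiteP[G [TG ndG Goo]] := sigma_finiteT m.
pose tail (t : n.+1.-tuple RT) : n.-tuple RT := [tuple of behead t].
exists (fun k => [set t | F k (thead t) /\ G k (tail t)]).
  apply/esym/seteqP; split => // t _.
  have [i _ Fi] : (\bigcup_k F k) (thead t) by rewrite -TF.
  have [j _ Gj] : (\bigcup_k G k) (tail t) by rewrite -TG.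
  exists (maxn i j) => //; split.
    by move: Fi; exact/subsetPset/ndF/leq_maxl.
  by move: Gj; exact/subsetPset/ndG/leq_maxr.
move=> k; have [mF Fk] := Foo k; have [mG Gk] := Goo k; split.
  apply: measurableI; rewrite -[X in measurable X]setTI.
    exact: (@measurable_tnth _ RT n.+1 ord0).
  exact: (@measurable_behead _ RT n).
rewrite /lebesgue_cons /pushforward (_ : _ @^-1` _ = F k `*` G k).
  by rewrite (@product_measure1E _ _ _ _ _ lam m)// lte_mul_pinfty// ge0_fin_numE.
have tE p : tail (tuple_cons p) = p.2 by apply: val_inj.
by apply/seteqP; split => p /=; rewrite tE.
Qed.

HB.instance Definition _ := @Measure_isSigmaFinite.Build _ _ _ lebesgue_cons
  lebesgue_cons_sigma_finite.

End step.

(* Lebesgue measure on R^n, with n-tuples as points: the n-fold product of the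
   Lebesgue measure on R. *)
Fixpoint lebesgue_tuple n : {sigma_finite_measure set (n.-tuple RT) -> \bar R} :=
  match n with
  | 0 => \d_ ([tuple] : 0.-tuple RT)
  | k.+1 => lebesgue_cons (lebesgue_tuple k)
  end.

Lemma lebesgue_tuple_box n (A : 'I_n -> set RT) : (forall i, measurable (A i)) ->
  lebesgue_tuple n [set t | forall i, A i (tnth t i)] =
  \prod_(i < n) lebesgue_measure (A i).
Proof.
elim: n A => [|n IH] A mA /=.
  by rewrite big_ord0 diracE mem_set// => -[].
rewrite big_ord_recl -IH//= /lebesgue_cons /pushforward -product_measure1E//; last first.
  rewrite [X in measurable X](_ : _ = \bigcap_(i in [set: 'I_n])
      (@tnth n RT ^~ i) @^-1` A (lift ord0 i)).
    apply: fin_bigcap_measurable => // i _.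
    by rewrite -[X in measurable X]setTI; exact: measurable_tnth.
  by apply/seteqP; split => t /= h i; [move=> _; exact: h|exact: h].
congr product_measure1; apply/seteqP; split => -[a t] /=.
  move=> h; split; first by have := h ord0.
  by move=> i; have := h (lift ord0 i); rewrite tnthS.
move=> [h0 h] i; have [j ->|->//] := unliftP ord0 i.
by rewrite tnthS; exact: h.
Qed.

End lebesgue_tuple.

Section defs.
Context {R : realType}.

Definition row_of_tuple d (t : d.-tuple (measurableTypeR R)) : 'rV[R]_d :=
  \row_i tnth t i.

(* The library norm on 'rV[R]_d is the sup norm (same topology). *)
Definition enorm d (x : 'rV[R]_d) : R := Num.sqrt (\sum_i x 0 i ^+ 2).

Definition eball d (x : 'rV[R]_d) (r : R) : set 'rV[R]_d :=
  [set y | enorm (y - x) < r].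

Definition Linfty_norm d (D : set 'rV[R]_d) (f : 'rV[R]_d -> R) : \bar R :=
  Lnorm (lebesgue_tuple d) +oo%E (fun t => ((f \_ D) (row_of_tuple t))%:E).

(* Euler's integral for x > 0, continued to x <= 0 by Gamma (x + 1) = x Gamma x
   (junk at the poles). *)
Definition Gamma (x : R) : R :=
  let n := if 0 < x then 0%N else (Num.truncn (- x)).+1 in
  (\int[lebesgue_measure]_(t in `]0%R, +oo[) (t `^ (x + n%:R - 1) * expR (- t)))
  / \prod_(k < n) (x + k%:R).

Section frac_laplacian.
Context (d : nat) (s : R) (u : 'rV[R]_d -> R) (x : 'rV[R]_d).

Definition frac_laplacian_integrand (t : d.-tuple (measurableTypeR R)) : R :=
  let z := row_of_tuple t in (u (x + z) - u x) / enorm z `^ (d%:R + 2 * s).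

Definition frac_laplacian_domain (r : R) : set (d.-tuple (measurableTypeR R)) :=
  [set t | ~ eball 0 r (row_of_tuple t)].

Definition frac_laplacian_truncated (r : R) : R :=
  \int[lebesgue_tuple d]_(t in frac_laplacian_domain r) frac_laplacian_integrand t.

Definition frac_laplacian_const : R :=
  4 `^ s * Gamma (s + d%:R / 2) / (pi `^ (d%:R / 2) * `|Gamma (- s)|).

Definition frac_laplacian : R :=
  frac_laplacian_const * lim (frac_laplacian_truncated r @[r --> 0^'+]).

(* Integrals and limits are total operators: this says that the ones in
   frac_laplacian are meaningful. *)
Definition frac_laplacian_defined : Prop :=
  (forall r, 0 < r -> (lebesgue_tuple d).-integrable (frac_laplacian_domain r)
     (EFin \o frac_laplacian_integrand)) /\
  cvg (frac_laplacian_truncated r @[r --> 0^'+]).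

End frac_laplacian.

Section C2.
Context (d : nat) (U : set 'rV[R]_d).

Definition partial (i : 'I_d) (f : 'rV[R]_d -> R) : 'rV[R]_d -> R :=
  'D_(delta_mx 0 i) f.

Definition partial_derivable (i : 'I_d) (f : 'rV[R]_d -> R) : Prop :=
  forall x, U x -> derivable f x (delta_mx 0 i).

Definition extends_to_closure (f : 'rV[R]_d -> R) : Prop :=
  exists2 g : 'rV[R]_d -> R,
    {within closure U, continuous g} & forall x, U x -> f x = g x.

(* The derivatives up to order 2 on the open set U exist and extend
   continuously to the closure of U. *)
Definition C2_closure (f : 'rV[R]_d -> R) : Prop :=
  [/\ {within closure U, continuous f},
      forall i, partial_derivable i f /\ extends_to_closure (partial i f)
    & forall i j, partial_derivable j (partial i f) /\
                  extends_to_closure (partial j (partial i f))].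

End C2.

Section viscosity.
Context (d : nat) (s rho : R) (f : 'rV[R]_d -> R -> R).

Definition test_function (u : 'rV[R]_d -> R) (x0 : 'rV[R]_d)
    (U : set 'rV[R]_d) (xi : 'rV[R]_d -> R) : Prop :=
  [/\ open U, U x0, closure U `<=` eball 0 rho, C2_closure U xi & xi x0 = u x0].

(* patch u U xi is equal to xi on U and to u outside U. *)
Definition viscosity_subsolution (u : 'rV[R]_d -> R) : Prop :=
  forall x0 U xi, eball 0 rho x0 -> test_function u x0 U xi ->
    (forall x, U x -> u x <= xi x) ->
    frac_laplacian_defined s (patch u U xi) x0 /\
    frac_laplacian s (patch u U xi) x0 + f x0 (u x0) - u x0 >= 0.

Definition viscosity_supersolution (u : 'rV[R]_d -> R) : Prop :=
  forall x0 U xi, eball 0 rho x0 -> test_function u x0 U xi ->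
    (forall x, U x -> xi x <= u x) ->
    frac_laplacian_defined s (patch u U xi) x0 /\
    frac_laplacian s (patch u U xi) x0 + f x0 (u x0) - u x0 <= 0.

Definition continuous_viscosity_solution
    (phi u : 'rV[R]_d -> R) : Prop :=
  [/\ {within closure (eball 0 rho), continuous u},
      forall x, ~ eball 0 rho x -> u x = phi x,
      viscosity_subsolution u
    & viscosity_supersolution u].

End viscosity.

Definition nonlinearity_series d (L : set nat) (c : nat -> 'rV[R]_d -> R)
    (x : 'rV[R]_d) (y : R) : R^nat :=
  series (fun l => if l \in L then c l x * y ^+ l else 0).

Definition nonlinearity d (L : set nat) (c : nat -> 'rV[R]_d -> R)
    (x : 'rV[R]_d) (y : R) : R :=
  limn (nonlinearity_series L c x y).

End defs.

(* Main.v *)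
Require Import Defs.
From HB Require Import structures.
From mathcomp Require Import all_boot all_order all_algebra.
From mathcomp Require Import all_classical all_reals all_analysis.
From mathcomp Require Import measurable_realfun ess_sup_inf ring lra.
Import Order.TTheory GRing.Theory Num.Theory.
Import numFieldNormedType.Exports.
Local Open Scope classical_set_scope.
Local Open Scope ring_scope.
Set Implicit Arguments.
Unset Strict Implicit.
Unset Printing Implicit Defensive.

(** The kernel is truncated to [|z| >= r].  For the truncated operator, with a
cutoff that imposes [u = phi] near the sphere, the equation is solved
approximately by iterating a contraction, because on [-1/4, 1/4] the
nonlinearity is small and 1/4-Lipschitz when [eps = 1/4]; the a priori bound
[|u| <= 1/4] makes clamping the nonlinearity harmless.

Two estimates are uniform in [r].  Near the sphere, a small power of the
distance to a supporting hyperplane, capped at 1, is a strict supersolution: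
at distance [t], the zero values beyond the hyperplane contribute a term of
order [- t ^ (a - 2 s)], and by concavity the remaining part is at most a small
multiple of this when [a] is small.  Inside, doubling the variables with the
penalization [N |x - y|^2] compares solutions for two truncation radii at once;
the operator is nonlocal of order [2 s < 2] and the penalization is a
paraboloid, so no Ishii lemma is needed.  With equal radii this gives a common
modulus of continuity, with different radii the Cauchy property, hence a
uniform limit [u].

A test function touching [u] from above at [x0] lies, by Taylor, below a
paraboloid near [x0].  Perturbing this paraboloid yields a near-contact point
of the approximate solutions, where the truncated equation passes to the
limit. *)

(** * Euclidean norm *)

(** The term - u is the engine: [G] is Lipschitz with constant 1/2 in its last argument, so
    subtracting two equations leaves half of u(x) - v(y), and all errors are measured against this
    half.

    Suprema over the whole space need not be attained, so functions touch only up to an error [c],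
    which costs [c] times the mass [Lam] of the truncated kernel. That mass is finite for each
    radius but blows up as the radius tends to 0; hence [c] is chosen after the radii, and the
    constants of the estimates before them. What stays bounded uniformly is the second moment of the
    kernel over a ball of radius D, of order D^(2 - 2 s) ([near_constant]).

    Truncation makes the operator bounded, so that it fits into a fixed-point map, and finitely many
    iterations give a residual at most [r]: no complete function space is needed. The cutoff stops
    the equation at distance [r] from the sphere for two reasons: the coefficients are controlled
    only on smaller balls, and the barrier estimate holds only at distance at least [r] from the
    hyperplane. *)

Section euclidean.
Context {R : realType}.
Implicit Type d : nat.

Definition edot d (x y : 'rV[R]_d) : R := \sum_i x 0 i * y 0 i.

Lemma edotDr d (x y z : 'rV[R]_d) : edot x (y + z) = edot x y + edot x z.
Proof. by rewrite -big_split; apply: eq_bigr => i _; rewrite mxE mulrDr. Qed.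

Lemma edotZr d (x y : 'rV[R]_d) a : edot x (a *: y) = a * edot x y.
Proof. by rewrite mulr_sumr; apply: eq_bigr => i _; rewrite mxE mulrCA. Qed.

Lemma edotC d (x y : 'rV[R]_d) : edot x y = edot y x.
Proof. by apply: eq_bigr => i _; rewrite mulrC. Qed.

Lemma edotZl d (x y : 'rV[R]_d) a : edot (a *: x) y = a * edot x y.
Proof. by rewrite edotC edotZr edotC. Qed.

Lemma edotNr d (x y : 'rV[R]_d) : edot x (- y) = - edot x y.
Proof. by rewrite -scaleN1r edotZr mulN1r. Qed.

Lemma edotxx_ge0 d (x : 'rV[R]_d) : 0 <= edot x x.
Proof. by apply: sumr_ge0 => i _; rewrite -expr2 sqr_ge0. Qed.

Lemma enormE d (x : 'rV[R]_d) : enorm x = Num.sqrt (edot x x).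
Proof. by rewrite /enorm; congr Num.sqrt; apply: eq_bigr => i _; rewrite expr2. Qed.

Lemma enorm_ge0 d (x : 'rV[R]_d) : 0 <= enorm x.
Proof. exact: sqrtr_ge0. Qed.

Lemma enorm_sqr d (x : 'rV[R]_d) : enorm x ^+ 2 = edot x x.
Proof. by rewrite enormE sqr_sqrtr// edotxx_ge0. Qed.

Lemma enormZ d a (x : 'rV[R]_d) : enorm (a *: x) = `|a| * enorm x.
Proof.
rewrite !enormE edotZr edotC edotZr mulrA -expr2 sqrtrM ?sqr_ge0//.
by rewrite sqrtr_sqr.
Qed.

Lemma enormN d (x : 'rV[R]_d) : enorm (- x) = enorm x.
Proof. by rewrite -scaleN1r enormZ normrN1 mul1r. Qed.

Lemma enorm0 d : enorm (0 : 'rV[R]_d) = 0.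
Proof. by rewrite -(scale0r 0) enormZ normr0 mul0r. Qed.

Lemma coord_le_enorm d (x : 'rV[R]_d) i : `|x 0 i| <= enorm x.
Proof.
rewrite -sqrtr_sqr ler_wsqrtr// (bigD1 i)//= lerDl.
by apply: sumr_ge0 => j _; exact: sqr_ge0.
Qed.

Lemma enorm_eq0 d (x : 'rV[R]_d) : enorm x = 0 -> x = 0.
Proof.
move=> x0; apply/rowP => i; rewrite mxE; apply/eqP.
by rewrite -normr_le0 -x0 coord_le_enorm.
Qed.

Lemma enormBC d (x y : 'rV[R]_d) : enorm (x - y) = enorm (y - x).
Proof. by rewrite -enormN opprB. Qed.

Lemma enormD_sqr d (x y : 'rV[R]_d) :
  enorm (x + y) ^+ 2 = enorm x ^+ 2 + 2 * edot x y + enorm y ^+ 2.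
Proof.
rewrite !enorm_sqr edotDr edotC edotDr [edot (x + y) y]edotC edotDr (edotC y x).
by rewrite mulr_natl mulr2n !addrA.
Qed.

Lemma edot0r d (x : 'rV[R]_d) : edot x 0 = 0.
Proof. by rewrite -(scale0r 0) edotZr mul0r. Qed.

Lemma edot_le d (x y : 'rV[R]_d) : edot x y <= enorm x * enorm y.
Proof.
have [/enorm_eq0 ->|y0] := eqVneq (enorm y) 0.
  by rewrite enorm0 mulr0 edot0r.
have [/enorm_eq0 ->|x0] := eqVneq (enorm x) 0.
  by rewrite enorm0 mul0r edotC edot0r.
have y_gt0 : 0 < enorm y by rewrite lt_def y0 enorm_ge0.
have x_gt0 : 0 < enorm x by rewrite lt_def x0 enorm_ge0.
have := sqr_ge0 (enorm (enorm y *: x + - enorm x *: y)).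
rewrite enormD_sqr edotZr edotC edotZr (edotC y x) !enormZ normrN.
rewrite !ger0_norm ?enorm_ge0//.
have xy : 0 < enorm x * enorm y by rewrite mulr_gt0.
move=> h; rewrite -(ler_pM2l xy); nra.
Qed.

Lemma normr_edot_le d (x y : 'rV[R]_d) : `|edot x y| <= enorm x * enorm y.
Proof.
rewrite ler_norml edot_le andbT lerNl -edotNr -(enormN y).
exact: edot_le.
Qed.

Lemma enormD d (x y : 'rV[R]_d) : enorm (x + y) <= enorm x + enorm y.
Proof.
rewrite -ler_sqr ?nnegrE ?addr_ge0 ?enorm_ge0// enormD_sqr sqrrD.
have := edot_le x y; lra.
Qed.

Lemma enormB_le d (x y z : 'rV[R]_d) :
  enorm (x - z) <= enorm (x - y) + enorm (y - z).
Proof. by have := enormD (x - y) (y - z); rewrite addrA subrK. Qed.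

Lemma enorm_sub d (x y : 'rV[R]_d) : `|enorm x - enorm y| <= enorm (x - y).
Proof.
have h (a b : 'rV[R]_d) : enorm a - enorm b <= enorm (a - b).
  by rewrite lerBlDr -{1}(subrK b a) enormD.
by rewrite ler_norml h andbT lerNl opprB enormBC h.
Qed.

Lemma enorm_le_coord d (x : 'rV[R]_d) e : (forall i, `|x 0 i| <= e) ->
  0 <= e -> enorm x <= d%:R * e.
Proof.
move=> xe e0; rewrite -ler_sqr ?nnegrE ?enorm_ge0 ?mulr_ge0// enorm_sqr.
apply: (@le_trans _ _ (\sum_(i < d) e ^+ 2)).
  apply: ler_sum => i _; rewrite -expr2 -real_normK ?num_real//.
  by rewrite ler_sqr ?nnegrE.
rewrite sumr_const card_ord -[leLHS]mulr_natl exprMn ler_wpM2r ?sqr_ge0//.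
by rewrite -natrX ler_nat; case: (d) => // n; rewrite leq_pmulr.
Qed.

(** The ambient topology is that of the sup norm. Each coordinate is bounded by [enorm], and [enorm]
    by d times the sup norm, so Euclidean balls generate the same neighbourhoods. Dividing by [d.+1]
    keeps the inequality strict and covers d = 0. *)
Lemma nbhs_enormP d (x : 'rV[R]_d) (A : set 'rV[R]_d) :
  nbhs x A <-> exists2 e, 0 < e & forall y, enorm (y - x) < e -> A y.
Proof.
split=> [/nbhs_ballP[e /= e0 xA]|[e e0 xA]].
  exists e => // y yx; apply: xA; split => // i j; rewrite ord1 /ball/=.
  by rewrite distrC (le_lt_trans _ yx)//; have := coord_le_enorm (y - x) j; rewrite !mxE.
apply/nbhs_ballP; exists (e / d.+1%:R) => /=; first by rewrite divr_gt0.
move=> y [_ xy]; apply: xA.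
have h i : `|(y - x) 0 i| <= e / d.+1%:R.
  by rewrite !mxE distrC ltW//; exact: xy.
apply: (le_lt_trans (enorm_le_coord h _)); first by rewrite divr_ge0// ltW.
by rewrite mulrA ltr_pdivrMr// mulrC ltr_pM2l// ltr_nat.
Qed.

Lemma eball_open d (x : 'rV[R]_d) r : open (eball x r).
Proof.
rewrite openE => y /= yx; apply/nbhs_enormP; exists (r - enorm (y - x)).
  by rewrite subr_gt0.
move=> z zy; rewrite /eball/=.
by apply: (le_lt_trans (enormB_le z y x)); rewrite -ltrBrDr.
Qed.

Lemma enorm_continuous d : continuous (@enorm R d).
Proof.
move=> x A /nbhs_ballP[e /= e0 xA]; apply/nbhs_enormP; exists e => // y yx.
by apply: xA; rewrite /ball/= distrC (le_lt_trans (enorm_sub _ _)).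
Qed.

Lemma compact_cball d r : compact [set x : 'rV[R]_d | enorm x <= r].
Proof.
apply: bounded_closed_compact; last first.
  by apply: (@closed_comp _ _ _ [set y : R | y <= r]) => [x _|];
    [exact: enorm_continuous|exact: closed_le].
exists r; split=> [|M rM x /= xr]; first exact: num_real.
apply: (le_trans _ (ltW rM)); apply: (le_trans _ xr).
rewrite [leLHS]mx_normrE; apply/bigmax_leP; split; first exact: enorm_ge0.
by move=> [i j] _/=; rewrite ord1 coord_le_enorm.
Qed.

End euclidean.

(** * Lebesgue measure on tuples *)

Section measure_on_tuples.
Context {R : realType}.
Implicit Type d : nat.
Local Notation RT := (measurableTypeR R).

Lemma measurable_box d (A : 'I_d -> set RT) : (forall i, measurable (A i)) ->
  measurable [set t : d.-tuple RT | forall i, A i (tnth t i)].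
Proof.
move=> mA; rewrite [X in measurable X](_ : _ = \bigcap_(i in [set: 'I_d])
    (@tnth d RT ^~ i) @^-1` A i); last first.
  by apply/seteqP; split => t /= h i; [move=> _; exact: h|exact: h].
apply: fin_bigcap_measurable => // i _.
by rewrite -[X in measurable X]setTI; exact: measurable_tnth.
Qed.

(** Continuity lives on row vectors, measurability on tuples with the product sigma-algebra. An open
    set is the countable union of the boxes with rational centres and half-widths 1/(k + 1) that it
    contains. *)
Lemma measurable_row_open d (A : set 'rV[R]_d) : open A ->
  measurable (@row_of_tuple R d @^-1` A).
Proof.
move=> oA; pose e k : R := k.+1%:R^-1.
pose box (p : {ffun 'I_d -> rat} * nat) : set (d.-tuple RT) :=
  [set t | forall i, ball (ratr (p.1 i) : R) (e p.2) (tnth t i)].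
pose F n := if unpickle n is Some p then
  [set t | box p t /\ box p `<=` @row_of_tuple R d @^-1` A] else set0.
rewrite (_ : _ @^-1` _ = \bigcup_n F n).
  apply: bigcupT_measurable => n; rewrite /F; case: unpickle => // p.
  have [pA|pA] := pselect (box p `<=` @row_of_tuple R d @^-1` A); last first.
    by rewrite [X in measurable X](_ : _ = set0)//; apply/seteqP; split => // t [].
  rewrite [X in measurable X](_ : _ = box p); last first.
    by apply/seteqP; split => [t []|t].
  apply: (@measurable_box _ (fun i => ball (ratr (p.1 i) : R) (e p.2))) => i.
  by rewrite ball_itv; exact: measurable_itv.
apply/seteqP; split => [t /= At|t [n _]]; last first.
  by rewrite /F; case: unpickle => // p [pt]; exact.
have /nbhs_ballP[r /= r0 rA] : nbhs (row_of_tuple t) A by exact: open_nbhs_nbhs.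
pose k := Num.truncn (r / 2)^-1.
have ek : e k < r / 2.
  rewrite /e invf_plt ?posrE ?divr_gt0//.
  by rewrite truncnS_gt.
have e0 : 0 < e k by rewrite invr_gt0.
have qP i : exists q : rat, ball (ratr q : R) (e k) (tnth t i).
  have : tnth t i - e k < tnth t i + e k by lra.
  by move=> /rat_in_itvoo[q]; rewrite in_itv/= => /andP[? ?]; exists q;
    rewrite /ball/= ltr_norml; lra.
pose q := [ffun i => projT1 (cid (qP i))].
exists (pickle (q, k)) => //; rewrite /F pickleK; split => [i|t' t'q].
  by rewrite ffunE; exact: projT2 (cid (qP i)).
apply: rA; split => // i j; rewrite !mxE /ball/=.
have := t'q j; rewrite ffunE /ball/=; case: (cid (qP j)) => /= x; rewrite /ball/=.
rewrite !ltr_norml; lra.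
Qed.

Lemma measurable_fun_row d (D : set 'rV[R]_d) (f : 'rV[R]_d -> R) : open D ->
  (forall x, D x -> {for x, continuous f}) ->
  measurable_fun (@row_of_tuple R d @^-1` D) (f \o @row_of_tuple R d : _ -> RT).
Proof.
move=> oD cf mD; apply: (measurability _ (RGenOpens.measurableE R)) => //.
move=> _ [_ [a [b ->] <-]].
rewrite (_ : _ `&` _ = @row_of_tuple R d @^-1` (D `&` f @^-1` `]a, b[%classic)).
  apply: measurable_row_open; rewrite openE => x [Dx fx].
  apply: filterI; first exact: open_nbhs_nbhs.
  by apply: (cf x Dx); exact: open_nbhs_nbhs.
by apply/seteqP; split.
Qed.

Lemma measurable_fun_rowT d (f : 'rV[R]_d -> R) : continuous f ->
  measurable_fun setT (f \o @row_of_tuple R d : _ -> RT).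
Proof.
move=> cf; rewrite (_ : setT = @row_of_tuple R d @^-1` setT)//.
by apply: measurable_fun_row; [exact: openT|move=> x _; exact: cf].
Qed.

Definition opp_tuple d (t : d.-tuple RT) : d.-tuple RT := [tuple - tnth t i | i < d].

Lemma row_opp_tuple d (t : d.-tuple RT) : row_of_tuple (opp_tuple t) = - row_of_tuple t.
Proof. by apply/rowP => i; rewrite !mxE tnth_mktuple. Qed.

Lemma measurable_opp_tuple d : measurable_fun setT (@opp_tuple d).
Proof.
apply/measurable_fun_tnthP => i; rewrite (_ : _ \o _ = -%R \o (@tnth d RT)^~ i).
  by apply: measurableT_comp => //; exact: measurable_tnth.
by apply/funext => t /=; rewrite tnth_mktuple.
Qed.

Lemma lebesgue_measure_opp (A : set RT) : measurable A ->
  lebesgue_measure (-%R @^-1` A) = lebesgue_measure A.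
Proof.
move=> mA; have mo : measurable_fun setT (-%R : RT -> RT) by exact: oppr_measurable.
apply/esym; apply: (@lebesgue_measure_unique R (pushforward lebesgue_measure (-%R : RT -> RT)))
  => //.
move=> _ [[a b] _ <-]; rewrite /= /pushforward (_ : _ @^-1` _ = `[- b, - a[%classic).
  rewrite !lebesgue_measure_itv/= !lte_fin ltrN2; case: ifP => // _.
  by rewrite -!EFinD opprK addrC.
by apply/seteqP; split => x /=; rewrite !in_itv/=; lra.
Qed.

Lemma ge0_integral_opp (h : RT -> \bar R) : measurable_fun setT h ->
  (forall x, 0 <= h x)%E ->
  (\int[lebesgue_measure]_x h (- x)%R = \int[lebesgue_measure]_x h x)%E.
Proof.
move=> mh h0; have mo : measurable_fun setT (-%R : RT -> RT) by exact: oppr_measurable.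
rewrite -[LHS](@ge0_integral_pushforward _ _ _ _ R _ mo lebesgue_measure setT h)//.
by apply: eq_measure_integral => // A mA _; exact: lebesgue_measure_opp.
Qed.

(** Induction on [d] through the product structure: sections of the reflected set are reflected
    sections, and the outer integral is invariant under the reflection of the line. This symmetry is
    what cancels linear terms in the operator. *)
Lemma lebesgue_tuple_opp d (A : set (d.-tuple RT)) : measurable A ->
  lebesgue_tuple d (@opp_tuple d @^-1` A) = lebesgue_tuple d A.
Proof.
elim: d A => [|d IH] A mA.
  congr (lebesgue_tuple _ _); apply/seteqP; split => t /=;
    by rewrite (_ : opp_tuple t = t)//; apply: eq_from_tnth => -[].
rewrite /= /lebesgue_cons /pushforward /product_measure1.
have mC : measurable (@tuple_cons R d @^-1` A).
  by rewrite -[X in measurable X]setTI; exact: measurable_tuple_cons.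
rewrite -[RHS](@ge0_integral_opp (lebesgue_tuple d \o xsection (@tuple_cons R d @^-1` A))) //.
  apply: eq_integral => x _ /=; rewrite -[RHS]IH; last exact: measurable_xsection.
  have E (t : d.-tuple RT) : opp_tuple (tuple_cons (x, t)) = tuple_cons (- x, opp_tuple t).
    apply: eq_from_tnth => i; rewrite tnth_mktuple.
    by have [j ->|->] := unliftP ord0 i; rewrite ?tnthS ?tnth0 ?tnth_mktuple.
  by congr (lebesgue_tuple _ _); apply/seteqP; split => t; rewrite /xsection/= !inE/= E.
exact: measurable_fun_xsection.
Qed.

Lemma Rintegral_opp_tuple d (D : set (d.-tuple RT)) (f : d.-tuple RT -> R) :
  measurable D -> measurable_fun setT f ->
  @opp_tuple d @^-1` D = D ->
  (lebesgue_tuple d).-integrable D (EFin \o f) ->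
  (lebesgue_tuple d).-integrable D (EFin \o (f \o @opp_tuple d)) /\
  \int[lebesgue_tuple d]_(t in D) f (opp_tuple t) = \int[lebesgue_tuple d]_(t in D) f t.
Proof.
move=> mD mf oD intf.
have mo := @measurable_opp_tuple d.
have mef : measurable_fun setT (EFin \o f) by exact/measurable_EFinP.
have eqm A : measurable A -> A `<=` D ->
    pushforward (lebesgue_tuple d) (@opp_tuple d) A = lebesgue_tuple d A.
  by move=> mA _; exact: lebesgue_tuple_opp.
have intf' : (lebesgue_tuple d).-integrable D (EFin \o (f \o @opp_tuple d)).
  apply/integrableP; split.
    apply: measurable_funTS; apply/measurable_EFinP.
    exact: measurableT_comp.
  move/integrableP : intf => [_]; apply: le_lt_trans.
  rewrite -[leRHS](eq_measure_integral _ eqm).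
  rewrite [leRHS](ge0_integral_pushforward mo)//.
    by rewrite oD.
  by apply: measurable_funTS; exact: measurableT_comp.
split=> //; rewrite /Rintegral; congr fine.
rewrite -[RHS](eq_measure_integral _ eqm).
by rewrite (integral_pushforward mo)// oD.
Qed.

End measure_on_tuples.

(** * Integrals of the kernel *)

Lemma dyadic_bounds {R : realType} (x : R) : 1 <= x ->
  exists k : nat, 2 ^+ k <= x <= 2 ^+ k.+1.
Proof.
move=> x1; have n0 : (0 < Num.truncn x)%N by rewrite truncn_gt0.
have /andP[l u] := @trunc_log_bounds 2 (Num.truncn x) isT n0.
exists (trunc_log 2 (Num.truncn x)); rewrite -!natrX; apply/andP; split.
  by rewrite (@le_trans _ _ (Num.truncn x)%:R) ?ler_nat// truncn_le// (le_trans _ x1).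
rewrite (@le_trans _ _ (Num.truncn x).+1%:R) ?ler_nat//.
exact/ltW/truncnS_gt.
Qed.

Lemma geometric_sum_le {R : realType} (x : R) n : 0 <= x < 1 ->
  \sum_(0 <= k < n) x ^+ k <= (1 - x)^-1.
Proof.
move=> /andP[x0 x1]; have x10 : 0 < 1 - x by rewrite subr_gt0.
have -> : \sum_(0 <= k < n) x ^+ k = (1 - x ^+ n) / (1 - x).
  apply/(canRL (mulfK _)); first by rewrite gt_eqF.
  by rewrite mulrC big_mkord -[1 - x ^+ n]opprB subrX1 -mulNr opprB.
by rewrite ler_pdivrMr// mulVf ?gt_eqF// gerBl exprn_ge0.
Qed.

(* Dominating [f] on the piece [E k] by the constant [a k] bounds its integral
   by the series of the [a k * mu (E k)], here by a geometric one. *)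
Lemma integral_le_geometric {R : realType} dd (T : measurableType dd)
    (mu : {measure set T -> \bar R}) (D : set T) (f : T -> R)
    (E : nat -> set T) (a V : nat -> R) (M x : R) :
  measurable D -> measurable_fun D f -> (forall t, D t -> 0 <= f t) ->
  (forall k, measurable (E k)) -> (forall k, 0 <= a k) ->
  (forall k, (mu (E k) <= (V k)%:E)%E) ->
  (forall t, D t -> exists2 k, E k t & f t <= a k) ->
  0 <= x < 1 -> 0 <= M -> (forall k, a k * V k <= M * x ^+ k) ->
  (\int[mu]_(t in D) (f t)%:E <= (M / (1 - x))%:E)%E.
Proof.
move=> mD mf f0 mE a0 EV fE x01 M0 aV.
apply: (@le_trans _ _ (\int[mu]_(t in D) (\sum_(k <oo) (a k * \1_(E k) t)%:E))%E).
  apply: ge0_le_integral => //.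
  - exact/measurable_EFinP.
  - apply: ge0_emeasurable_sum => //.
      by move=> k t _ _; rewrite lee_fin mulr_ge0.
    by move=> k _; apply/measurable_EFinP; exact: measurable_funM.
  move=> t Dt; have [k Ek fk] := fE _ Dt.
  apply: (@le_trans _ _ (\sum_(0 <= i < k.+1) (a i * \1_(E i) t)%:E)%E).
    rewrite big_nat_recr//= indicE mem_set// mulr1 -[leLHS]add0e leeD ?lee_fin//.
    by rewrite sumEFin lee_fin sumr_ge0// => i _; rewrite mulr_ge0.
  by apply: nneseries_lim_ge => i _ _; rewrite lee_fin mulr_ge0.
rewrite integral_nneseries//; last 2 first.
- by move=> k; apply/measurable_EFinP; exact: measurable_funM.
- by move=> k t _; rewrite lee_fin mulr_ge0.
apply: lime_le.
  by apply: is_cvg_nneseries => k _ _; apply: integral_ge0 => t _; rewrite lee_fin mulr_ge0.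
apply: nearW => n.
apply: (@le_trans _ _ (\sum_(0 <= k < n) (M * x ^+ k)%:E)%E); last first.
  rewrite sumEFin lee_fin -mulr_sumr ler_wpM2l//; exact: geometric_sum_le.
apply: lee_sum => k _.
under eq_integral do rewrite EFinM.
rewrite ge0_integralZl//; last by rewrite lee_fin.
  rewrite integral_indic//.
  apply: (@le_trans _ _ ((a k)%:E * (V k)%:E)%E).
    apply: lee_wpmul2l; first by rewrite lee_fin.
    by apply: (le_trans _ (EV k)); apply: le_measure; rewrite ?inE//; exact: measurableI.
  by rewrite -EFinM lee_fin.
exact/measurable_EFinP.
Qed.

Section kernel_integrals.
Context {R : realType} (d : nat).
Local Notation RT := (measurableTypeR R).
Local Notation mu := (lebesgue_tuple d).
Local Notation row := (@row_of_tuple R d).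

Lemma measurable_enorm_row : measurable_fun setT (fun t => enorm (row t) : RT).
Proof. by apply: measurable_fun_rowT; exact: enorm_continuous. Qed.

Lemma measurable_cball (r : R) : measurable [set t | enorm (row t) <= r].
Proof.
rewrite [X in measurable X](_ : _ = setT `&` (fun t => enorm (row t) : RT) @^-1` `]-oo, r]%classic).
  by apply: measurable_enorm_row => //; exact: measurable_itv.
by apply/seteqP; split => t; rewrite /= in_itv/=; [split|case].
Qed.

Lemma measure_cball_le (r : R) : 0 <= r ->
  (mu [set t | (enorm (row t) <= r)%R] <= ((2 * r) ^+ d)%:E)%E.
Proof.
move=> r0.
have mI (i : 'I_d) : measurable (`[- r, r]%classic : set RT) by exact: measurable_itv.
apply: (@le_trans _ _ (mu [set t | forall i, `[- r, r]%classic (tnth t i)])).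
  apply: le_measure; rewrite ?inE; first exact: measurable_cball.
    exact: (@measurable_box R d (fun=> `[- r, r]%classic)).
  move=> t /= tr i; rewrite in_itv/= -ler_norml (le_trans _ tr)//.
  by have := coord_le_enorm (row t) i; rewrite mxE.
rewrite (lebesgue_tuple_box mI) (eq_bigr (fun=> (2 * r)%:E)).
  by rewrite prodEFin prodr_const card_ord.
move=> i _; rewrite lebesgue_measure_itv/= lte_fin; case: ltP => rr.
  by rewrite -EFinD; congr EFin; lra.
by congr EFin; lra.
Qed.

(** The exponent is left free: [q = 2 * s] gives the kernel of the operator, and [q = s] appears
    when a growth |z|^s is absorbed into it. For q > 0 the value at the origin is the default 0. *)
Definition kernel (q : R) (t : d.-tuple RT) : R := (enorm (row t) `^ (d%:R + q))^-1.

Lemma kernel_ge0 q t : 0 <= kernel q t.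
Proof. by rewrite invr_ge0 powR_ge0. Qed.

Lemma measurable_kernel q : measurable_fun setT (kernel q).
Proof.
rewrite (_ : kernel q = fun t => enorm (row t) `^ (- (d%:R + q))).
  apply: (@measurableT_comp _ _ _ _ _ _ (fun x : R => x `^ (- (d%:R + q)))).
    exact: measurable_powR.
  exact: measurable_enorm_row.
by apply/funext => t; rewrite powRN.
Qed.

Lemma outside_ballE (r : R) : @frac_laplacian_domain R d r = [set t | r <= enorm (row t)].
Proof.
apply/seteqP; split => t; rewrite /frac_laplacian_domain /eball/= subr0.
  by move/negP; rewrite -leNgt.
by rewrite leNgt => /negP.
Qed.

Definition far (r : R) := [set t | r <= enorm (row t)].

Lemma measurable_far (r : R) : measurable (far r).
Proof.
rewrite [X in measurable X](_ : _ = setT `&` (fun t => enorm (row t) : RT) @^-1` `[r, +oo[%classic).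
  by apply: measurable_enorm_row => //; exact: measurable_itv.
by apply/seteqP; split => t; rewrite /far/= in_itv/= andbT; [split|case].
Qed.

Lemma powR2_gt1 (q : R) : 0 < q -> 1 < 2 `^ q.
Proof.
move=> q0; have := @gt0_ltr_powR R q q0 1 2; rewrite powR1 !nnegrE.
by apply => //; rewrite ltr1n.
Qed.

Lemma powR2X (q : R) k : ((2 : R) ^+ k) `^ q = (2 `^ q) ^+ k.
Proof. by rewrite -!powR_mulrn ?powR_ge0// -!powRrM mulrC. Qed.

(** Dyadic shells r 2^k <= |z| <= r 2^(k + 1): kernel times volume decays like 2^(- q k). The factor
    4^d comes from the cube enclosing the ball of radius r 2^(k + 1). *)
Lemma kernel_far_bound (q : R) : 0 < q -> exists2 C : R, 0 < C & forall r, 0 < r ->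
  (\int[mu]_(t in far r) (kernel q t)%:E <= (C * (r `^ q)^-1)%:E)%E.
Proof.
move=> q0; pose x : R := (2 `^ q)^-1.
have q1 : 1 < 2 `^ q :> R by exact: powR2_gt1.
have x01 : 0 <= x < 1.
  by rewrite /x invr_ge0 powR_ge0/= invf_lt1// (lt_trans _ q1).
exists (4 ^+ d / (1 - x)) => [|r r0].
  by rewrite divr_gt0 ?exprn_gt0// subr_gt0; case/andP: x01.
rewrite mulrAC; pose u k : R := r * 2 ^+ k.
have u0 k : 0 < u k by rewrite mulr_gt0// exprn_gt0.
apply: (@integral_le_geometric _ _ _ _ _ _ (fun k => [set t | enorm (row t) <= u k.+1])
  (fun k => (u k `^ (d%:R + q))^-1) (fun k => (2 * u k.+1) ^+ d)) => //.
- exact: measurable_far.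
- by apply: measurable_funTS; exact: measurable_kernel.
- by move=> t _; exact: kernel_ge0.
- by move=> k; exact: measurable_cball.
- by move=> k; rewrite invr_ge0 powR_ge0.
- by move=> k; apply: measure_cball_le; exact: ltW.
- move=> t /= rt; have /dyadic_bounds[k /andP[l h]] : 1 <= enorm (row t) / r.
    by rewrite ler_pdivlMr// mul1r.
  exists k; first by rewrite /u/= -ler_pdivrMl// mulrC.
  rewrite /kernel lef_pV2 ?posrE ?powR_gt0//; last exact: (lt_le_trans r0).
  apply: ge0_ler_powR; rewrite ?nnegrE ?enorm_ge0 ?(ltW (u0 _))//.
    by rewrite addr_ge0// ltW.
  by rewrite /u -ler_pdivlMl// mulrC.
- by rewrite mulr_ge0 ?exprn_ge0// invr_ge0 powR_ge0.
move=> k; rewrite powRD; last by rewrite (gt_eqF (u0 _)) implybT.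
rewrite powR_mulrn ?(ltW (u0 _))//.
have -> : 2 * u k.+1 = 4 * u k by rewrite /u exprS; ring.
have -> : 4 ^+ d / r `^ q * x ^+ k = 4 ^+ d / u k `^ q.
  rewrite /u powRM ?exprn_ge0 ?(ltW r0)// powR2X invfM -exprVn -/x.
  by rewrite mulrA.
have ud : u k ^+ d != 0 by rewrite expf_neq0// gt_eqF.
have uq : u k `^ q != 0 by rewrite gt_eqF// powR_gt0.
rewrite [(4 * _) ^+ d]exprMn; move: ud uq; move: (u k ^+ d) (4 ^+ d) (u k `^ q) => a b c a0 c0.
by rewrite le_eqVlt; apply/orP; left; apply/eqP; field; rewrite a0 c0.
Qed.

Definition annulus r D := far r `&` ~` far D.

Lemma measurable_annulus r D : measurable (annulus r D).
Proof. by apply: measurableI; [|apply: measurableC]; exact: measurable_far. Qed.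

(** The bound does not involve [r]: a paraboloid contributes little near the origin, whatever the
    truncation. It is stated as a predicate so that later arguments can share one [cn]. *)
Definition near_constant (s cn : R) := forall r D, 0 < r -> 0 < D ->
  (\int[mu]_(t in annulus r D) (enorm (row t) ^+ 2 * kernel (2 * s) t)%:E
    <= (cn * D `^ (2 - 2 * s))%:E)%E.

(** Dyadic shells shrinking from [D] to the origin; the ratio 2^(2 s - 2) of the geometric series is
    below 1 because s < 1. *)
Lemma near_constant_exists (s : R) : 0 < s < 1 -> exists2 cn, 0 < cn & near_constant s cn.
Proof.
move=> s01; pose q := 2 * s; have q02 : 0 < q < 2 by rewrite /q; lra.
pose x : R := (2 `^ (2 - q))^-1.
have q1 : 1 < 2 `^ (2 - q) :> R by apply: powR2_gt1; lra.
have x01 : 0 <= x < 1.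
  by rewrite /x invr_ge0 powR_ge0/= invf_lt1// (lt_trans _ q1).
exists (2 ^+ d * 2 `^ (d%:R + q) / (1 - x)) => [|r D r0 D0].
  by rewrite divr_gt0 ?mulr_gt0 ?exprn_gt0 ?powR_gt0// subr_gt0; case/andP: x01.
rewrite mulrAC; pose u k : R := D / 2 ^+ k.
have u0 k : 0 < u k by rewrite divr_gt0// exprn_gt0.
have uS k : u k.+1 = u k / 2 by rewrite /u exprS invfM mulrA mulrAC.
apply: (@integral_le_geometric _ _ _ _ _ _ (fun k => [set t | enorm (row t) <= u k])
  (fun k => u k ^+ 2 * (u k.+1 `^ (d%:R + q))^-1) (fun k => (2 * u k) ^+ d)) => //.
- exact: measurable_annulus.
- apply: measurable_funTS; apply: measurable_funM; last exact: measurable_kernel.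
  by apply: measurable_funX; exact: measurable_enorm_row.
- by move=> t _; rewrite mulr_ge0 ?kernel_ge0// sqr_ge0.
- by move=> k; exact: measurable_cball.
- by move=> k; rewrite mulr_ge0 ?sqr_ge0// invr_ge0 powR_ge0.
- by move=> k; apply: measure_cball_le; exact: ltW.
- move=> t [/= rt /negP]; rewrite -ltNge => tD.
  have t0 := lt_le_trans r0 rt.
  have /dyadic_bounds[k /andP[l h]] : 1 <= D / enorm (row t).
    by rewrite ler_pdivlMr// mul1r ltW.
  have k0 j : 0 < 2 ^+ j :> R by rewrite exprn_gt0.
  have tu : enorm (row t) <= u k.
    by rewrite /u ler_pdivlMr// mulrC -ler_pdivlMr.
  exists k => //; apply: ler_pM; rewrite ?sqr_ge0 ?kernel_ge0//.
    by rewrite ler_sqr ?nnegrE ?enorm_ge0// (ltW (u0 _)).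
  rewrite /kernel lef_pV2 ?posrE ?powR_gt0//.
  apply: ge0_ler_powR; rewrite ?nnegrE ?enorm_ge0 ?(ltW (u0 _))//.
    by rewrite addr_ge0//; lra.
  by rewrite /u ler_pdivrMr// mulrC -ler_pdivrMr.
- by rewrite !mulr_ge0 ?exprn_ge0// powR_ge0.
move=> k.
have e1 : (u k.+1) `^ (d%:R + q) = u k ^+ d * u k `^ q / 2 `^ (d%:R + q).
  rewrite uS powRM ?invr_ge0 ?(ltW (u0 _))// -[2^-1]powR_inv1// powRAC powR_inv1 ?powR_ge0//.
  by rewrite powRD ?(gt_eqF (u0 _)) ?implybT// powR_mulrn ?(ltW (u0 _)).
have e2 : u k ^+ 2 = u k `^ (2 - q) * u k `^ q.
  by rewrite -powRD ?(gt_eqF (u0 _)) ?implybT// subrK powR_mulrn ?(ltW (u0 _)).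
rewrite mulrAC.
have -> : 2 ^+ d * 2 `^ (d%:R + q) * D `^ (2 - 2 * s) * x ^+ k =
    2 ^+ d * 2 `^ (d%:R + q) * u k `^ (2 - q).
  rewrite /u powRM ?invr_ge0 ?exprn_ge0 ?(ltW D0)// -mulrA; congr *%R; congr *%R.
  rewrite -[(2 ^+ k)^-1]powR_inv1 ?exprn_ge0// powRAC powR_inv1 ?powR_ge0// powR2X.
  by rewrite /x exprVn.
rewrite e1 e2 [(2 * _) ^+ d]exprMn.
have ud : u k ^+ d != 0 by rewrite expf_neq0// gt_eqF.
have uq : u k `^ q != 0 by rewrite gt_eqF// powR_gt0.
have u2 : 2 `^ (d%:R + q) != 0 :> R by rewrite gt_eqF// powR_gt0.
move: ud uq u2; move: (u k ^+ d) (2 ^+ d) (u k `^ q) (2 `^ (d%:R + q)) (u k `^ (2 - q)) =>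
  a b c e f a0 c0 e0.
by rewrite le_eqVlt; apply/orP; left; apply/eqP; field; rewrite a0 c0 e0.
Qed.

End kernel_integrals.

(** * Truncated operators *)

Section truncated_operator.
Context {R : realType} (d : nat) (s : R) (hs : 0 < s < 1).
Local Notation RT := (measurableTypeR R).
Local Notation mu := (lebesgue_tuple d).
Local Notation row := (@row_of_tuple R d).
Local Notation L := (frac_laplacian_truncated s).
Local Notation K := (kernel (2 * s)).

Lemma integrable_scaleR A c (f : d.-tuple RT -> R) : measurable A ->
  mu.-integrable A (EFin \o f) -> mu.-integrable A (EFin \o (fun t => c * f t)).
Proof.
by move=> mA /(integrableZl mA c); congr (_.-integrable _ _); apply/funext => t /=; rewrite EFinM.
Qed.

Lemma integrable_addR A (f g : d.-tuple RT -> R) : measurable A ->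
  mu.-integrable A (EFin \o f) -> mu.-integrable A (EFin \o g) ->
  mu.-integrable A (EFin \o (fun t => f t + g t)).
Proof.
by move=> mA fi /(integrableD mA fi); congr (_.-integrable _ _); apply/funext => t /=;
  rewrite EFinD.
Qed.

(** Just enough for all truncated integrals to converge. Continuity is not demanded, because a test
    function patched with [u] may jump across the boundary of its domain. *)
Definition admissible (u : 'rV[R]_d -> R) :=
  (exists M, forall x, `|u x| <= M) /\
  forall x, measurable_fun setT (fun t => u (x + row t) : RT).

Lemma admissibleN u : admissible u -> admissible (\- u).
Proof.
move=> [[M uM] mu']; split; first by exists M => x; rewrite normrN.
by move=> x; have := measurableT_comp (@oppr_measurable R setT) (mu' x).
Qed.

Lemma admissible_cont (u : 'rV[R]_d -> R) M :
  continuous u -> (forall x, `|u x| <= M) -> admissible u.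
Proof.
move=> cu uM; split; first by exists M.
move=> x; apply: (@measurable_fun_rowT R d (fun z => u (x + z))) => z.
apply: (@continuous_comp _ _ _ (fun z => x + z) u z); last exact: cu.
exact: (cvgD (cvg_cst _) cvg_id).
Qed.

Definition Lam (r : R) : R := \int[mu]_(t in far r) K t.

Lemma kernel_integrable (q r : R) : 0 < q -> 0 < r ->
  mu.-integrable (far r) (EFin \o kernel q).
Proof.
move=> q0 r0; have [C C0 /(_ _ r0) h] := @kernel_far_bound R d q q0.
apply/integrableP; split.
  by apply/measurable_EFinP; apply: measurable_funTS; exact: measurable_kernel.
rewrite (eq_integral (EFin \o kernel q)); last first.
  by move=> t _ /=; rewrite ger0_norm ?kernel_ge0.
exact: (le_lt_trans h (ltry _)).
Qed.

Lemma q_gt0 : 0 < 2 * s. Proof. by case/andP: hs => s0 _; rewrite mulr_gt0. Qed.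

Lemma bounded_kernel_integrable (q r M : R) (h : d.-tuple RT -> R) : 0 < q -> 0 < r ->
  measurable_fun setT h -> (forall t, `|h t| <= M) ->
  mu.-integrable (far r) (EFin \o (h \* kernel q)).
Proof.
move=> q0 r0 mh hM; have ik := kernel_integrable q0 r0.
have M0 : 0 <= M by apply: (le_trans _ (hM [tuple 0 | i < d])).
apply: (le_integrable (@measurable_far R d r) _ _ (integrable_scaleR M (@measurable_far R d r) ik)).
- apply/measurable_EFinP; apply: measurable_funTS; apply: measurable_funM => //.
  exact: measurable_kernel.
- move=> t _ /=; rewrite lee_fin !normrM ler_wpM2r//.
  by rewrite (ger0_norm M0).
Qed.

Lemma Lam_ge0 r : 0 <= Lam r.
Proof. by apply: Rintegral_ge0 => t _; exact: kernel_ge0. Qed.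

Lemma increment_bounded u : admissible u -> exists M, forall x t, `|u (x + row t) - u x| <= M.
Proof.
move=> [[M uM] _]; exists (M + M) => x t.
by rewrite (le_trans (ler_normB _ _))// lerD.
Qed.

Lemma measurable_increment u x : admissible u ->
  measurable_fun setT (fun t => u (x + row t) - u x : RT).
Proof. by move=> [_ mu']; exact: measurable_funB (mu' x) (measurable_cst _). Qed.

Lemma truncated_integrable u x r : admissible u -> 0 < r ->
  mu.-integrable (far r) (EFin \o ((fun t => u (x + row t) - u x) \* K)).
Proof.
move=> au r0; have [M uM] := increment_bounded au.
by apply: (bounded_kernel_integrable q_gt0 r0 _ (uM x)); exact: measurable_increment.
Qed.

Lemma truncatedE u x r : L u x r = \int[mu]_(t in far r) ((u (x + row t) - u x) * K t).
Proof. by rewrite /frac_laplacian_truncated outside_ballE. Qed.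

Lemma truncatedN u x r : admissible u -> 0 < r -> L (\- u) x r = - L u x r.
Proof.
move=> au r0; rewrite !truncatedE -[RHS]mulN1r -RintegralZl//.
- by apply: eq_Rintegral => t _; rewrite mulrA mulN1r opprB opprK addrC.
- exact: measurable_far.
- exact: truncated_integrable.
Qed.

(** The operator is monotone in the increments, and only these matter: the two base points may
    differ, as the doubling of variables requires. *)
Lemma truncated_le u v x y r c : admissible u -> admissible v -> 0 < r ->
  (forall t, far r t -> u (x + row t) - u x <= v (y + row t) - v y + c) ->
  L u x r <= L v y r + c * Lam r.
Proof.
move=> au av r0 uv; rewrite !truncatedE /Lam.
have ik := kernel_integrable q_gt0 r0.
have mr := @measurable_far R d r.
have iv := truncated_integrable y av r0.
have ick : mu.-integrable (far r) (EFin \o (fun t => c * K t)).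
  exact: (integrable_scaleR c mr ik).
rewrite -RintegralZl// -RintegralD//.
apply: le_Rintegral => //.
- exact: truncated_integrable.
- exact: (integrable_addR mr iv ick).
by move=> t rt; rewrite -mulrDl ler_wpM2r ?kernel_ge0// uv.
Qed.

Lemma far_opp r : @opp_tuple R d @^-1` (far r) = far r.
Proof. by apply/seteqP; split => t; rewrite /far/= row_opp_tuple enormN. Qed.

Lemma kernel_opp q t : kernel q (opp_tuple t) = @kernel R d q t.
Proof. by rewrite /kernel row_opp_tuple enormN. Qed.

Lemma truncated_affine u v x r a b c : admissible u -> admissible v -> 0 < r ->
  L (fun y => c + a * u y + b * v y) x r = a * L u x r + b * L v x r.
Proof.
move=> au av r0; rewrite !truncatedE.
have mr := @measurable_far R d r.
have iu := truncated_integrable x au r0; have iv := truncated_integrable x av r0.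
have ea := @RintegralZl _ _ _ mu (far r) _ a mr iu.
have eb := @RintegralZl _ _ _ mu (far r) _ b mr iv.
have eD := RintegralD mr (integrable_scaleR a mr iu) (integrable_scaleR b mr iv).
apply: (etrans _ (etrans eD (f_equal2 +%R ea eb))).
by apply: eq_Rintegral => t _ /=; ring.
Qed.

(* As the kernel is even, only the even part of the integrand matters. *)
Lemma symmetrized_integral_le (A : set (d.-tuple RT)) (h f : d.-tuple RT -> R) :
  measurable A -> @opp_tuple R d @^-1` A = A ->
  measurable_fun setT h ->
  mu.-integrable A (EFin \o (h \* K)) -> mu.-integrable A (EFin \o f) ->
  (forall t, A t -> (h t + h (opp_tuple t)) * K t <= 2 * f t) ->
  \int[mu]_(t in A) (h t * K t) <= \int[mu]_(t in A) f t.
Proof.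
have key (x y a b c : R) : a <= b -> a = x + y -> b = 2 * c -> y = x -> x <= c.
  by move=> ab ax bc yx; lra.
move=> mA oA mh ih ik hk.
have mhK : measurable_fun setT (h \* K).
  by apply: measurable_funM => //; exact: measurable_kernel.
have [ih' eh] := Rintegral_opp_tuple mA mhK oA ih.
have h2 := RintegralD mA ih ih'.
have k2 := @RintegralZl _ _ _ mu A f 2 mA ik.
have le2 : \int[mu]_(t in A) ((h \* K) t + ((h \* K) \o @opp_tuple R d) t) <=
    \int[mu]_(t in A) (2 * f t).
  apply: (le_Rintegral mA (integrable_addR mA ih ih') (integrable_scaleR 2 mA ik)).
  move=> t At; change (h t * K t + h (opp_tuple t) * K (opp_tuple t) <= 2 * f t).
  by have -> := kernel_opp (2 * s) t; rewrite -mulrDl; exact: hk.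
exact: key le2 h2 k2 eh.
Qed.

Lemma annulus_opp r D : @opp_tuple R d @^-1` (annulus r D) = annulus r D.
Proof. by apply/seteqP; split => t; rewrite /annulus /far/= row_opp_tuple enormN. Qed.

Lemma truncated_split u x r D : admissible u -> 0 < r -> r <= D ->
  L u x r = \int[mu]_(t in annulus r D) ((u (x + row t) - u x) * K t) + L u x D.
Proof.
move=> au r0 rD; rewrite !truncatedE.
have E : far r = annulus r D `|` far D :> set (d.-tuple RT).
  apply/seteqP; split => t.
    by move=> rt; have [tD|tD] := pselect (far D t); [right|left].
  by move=> [[]//|]; rewrite /far/=; exact: le_trans.
rewrite {1}E Rintegral_setU//.
- exact: measurable_annulus.
- exact: measurable_far.
- by rewrite -E; exact: truncated_integrable.
- by apply/disj_setPRL => t tD [].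
Qed.

Variable cn : R.
Hypothesis cnP : near_constant d s cn.

(* The linear part of the paraboloid does not contribute, by symmetry. *)
Lemma truncated_touched_above u x p M c r D : admissible u -> 0 < r -> r <= D ->
  0 <= M -> 0 <= c ->
  (forall z, enorm z < D -> u (x + z) - u x <= edot p z + M * enorm z ^+ 2 + c) ->
  L u x r <= L u x D + M * (cn * D `^ (2 - 2 * s)) + c * Lam r.
Proof.
move=> au r0 rD M0 c0 up; rewrite (truncated_split x au r0 rD) addrC -addrA lerD2l.
have D0 : 0 < D := lt_le_trans r0 rD.
have mA := @measurable_annulus R d r D.
have sA : annulus r D `<=` (far r : set (d.-tuple RT)) by move=> t [].
have isq : mu.-integrable (annulus r D) (EFin \o (fun t => enorm (row t) ^+ 2 * K t)).
  apply/integrableP; split.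
    apply/measurable_EFinP; apply: measurable_funTS; apply: measurable_funM.
      by apply: measurable_funX; exact: measurable_enorm_row.
    exact: measurable_kernel.
  rewrite (eq_integral (EFin \o (fun t => enorm (row t) ^+ 2 * K t))); last first.
    by move=> t _ /=; rewrite ger0_norm// mulr_ge0 ?sqr_ge0// kernel_ge0.
  exact: (le_lt_trans (cnP r0 D0) (ltry _)).
have iK : mu.-integrable (annulus r D) (EFin \o K).
  by apply: integrableS (kernel_integrable q_gt0 r0) => //; exact: measurable_far.
have iM : mu.-integrable (annulus r D) (EFin \o (fun t => M * (enorm (row t) ^+ 2 * K t))).
  exact: (integrable_scaleR M mA isq).
have ic : mu.-integrable (annulus r D) (EFin \o (fun t => c * K t)).
  exact: (integrable_scaleR c mA iK).
have iMc : mu.-integrable (annulus r D) (EFin \o ((fun t => M * enorm (row t) ^+ 2 + c) \* K)).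
  have := integrable_addR mA iM ic; congr (_.-integrable _ _).
  by apply/funext => t /=; rewrite [in RHS]mulrDl [in LHS]mulrA.
apply: (@le_trans _ _ (\int[mu]_(t in annulus r D) ((M * enorm (row t) ^+ 2 + c) * K t))).
  apply: symmetrized_integral_le => //.
  - exact: annulus_opp.
  - exact: measurable_increment.
  - by apply: integrableS (truncated_integrable x au r0) => //; exact: measurable_far.
  - move=> t [_ /negP]; rewrite -ltNge => tD; rewrite row_opp_tuple.
    have h1 := up (row t) tD; have h2 := up (- row t); rewrite enormN edotNr in h2.
    rewrite mulrA ler_wpM2r ?kernel_ge0//.
    by have := h2 tD; lra.
rewrite (_ : (fun t => _) = (fun t => M * (enorm (row t) ^+ 2 * K t) + c * K t)); last first.
  by apply/funext => t; rewrite [in LHS]mulrDl [in RHS]mulrA.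
rewrite RintegralD// !RintegralZl//; apply: lerD; apply: ler_wpM2l => //.
  rewrite -lee_fin fineK; first exact: (cnP r0 D0).
  exact: integrable_fin_num.
rewrite /Lam -lee_fin !fineK; [|exact: (integrable_fin_num (@measurable_far R d r)
  (kernel_integrable q_gt0 r0))|exact: (integrable_fin_num mA iK)].
apply: ge0_subset_integral => //.
- exact: measurable_far.
- by apply/measurable_EFinP; apply: measurable_funTS; exact: measurable_kernel.
- by move=> t _; rewrite lee_fin kernel_ge0.
Qed.

End truncated_operator.

(** * Approximate solutions *)

Section uniform_continuity.
Context {R : realType} (d : nat).
Implicit Types u v : 'rV[R]_d -> R.

Definition unif_cont u := forall k : R, 0 < k -> exists2 e : R, 0 < e &
  forall x y, enorm (x - y) < e -> `|u x - u y| <= k.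

Lemma unif_contP u : (forall k : R, 0 < k -> exists2 e : R, 0 < e &
  forall x y, enorm (x - y) < e -> u x - u y <= k) -> unif_cont u.
Proof.
move=> h k k0; have [e e0 he] := h k k0; exists e => // x y xy.
by rewrite ler_norml he// andbT lerNl opprB he// enormBC.
Qed.

Lemma unif_cont_continuous u : unif_cont u -> continuous u.
Proof.
move=> uu x A /nbhs_ballP[k /= k0 kA]; have k20 : 0 < k / 2 by lra.
have [e e0 he] := uu _ k20.
apply/nbhs_enormP; exists e => // y yx; apply: kA; rewrite /ball/= distrC.
by apply: (le_lt_trans (he _ _ yx)); lra.
Qed.

Lemma unif_cont_lipschitz u (l : R) : (forall x y, `|u x - u y| <= l * enorm (x - y)) ->
  unif_cont u.
Proof.
move=> ul k k0; exists (k / (`|l| + 1)) => [|x y xy].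
  by rewrite divr_gt0// ltr_wpDl.
apply: (le_trans (ul x y)); apply: (@le_trans _ _ ((`|l| + 1) * enorm (x - y))).
  by rewrite ler_wpM2r ?enorm_ge0//; have := ler_norm l; lra.
by rewrite mulrC -ler_pdivlMr ?ltW// ltr_wpDl.
Qed.

Lemma unif_contD u v : unif_cont u -> unif_cont v -> unif_cont (u \+ v).
Proof.
move=> uu uv k k0; have k20 : 0 < k / 2 by lra.
have [e e0 he] := uu _ k20; have [f f0 hf] := uv _ k20.
exists (Num.min e f) => [|x y]; first by rewrite lt_min e0.
rewrite lt_min => /andP[/he + /hf]; rewrite !ler_norml /=; lra.
Qed.

Lemma unif_contM u v (M : R) : (forall x, `|u x| <= M) -> (forall x, `|v x| <= M) ->
  unif_cont u -> unif_cont v -> unif_cont (u \* v).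
Proof.
move=> uM vM uu uv k k0; have M0 : 0 <= M by apply: (le_trans _ (uM 0)).
have M1 : 0 < M + 1 by lra.
have k20 : 0 < k / 2 / (M + 1) by rewrite !divr_gt0.
have [e e0 he] := uu _ k20; have [f f0 hf] := uv _ k20.
exists (Num.min e f) => [|x y]; first by rewrite lt_min e0.
rewrite lt_min => /andP[/he h1 /hf h2] /=.
rewrite (_ : _ - _ = (u x - u y) * v x + u y * (v x - v y)); last by ring.
rewrite (le_trans (ler_normD _ _))// !normrM.
have h : forall a b, 0 <= a -> 0 <= b -> a <= k / 2 / (M + 1) -> b <= M -> a * b <= k / 2.
  move=> a b a0 b0 ak bM; rewrite -[leRHS](@divfK _ (M + 1)) ?gt_eqF//.
  by apply: ler_pM => //; lra.
have := h _ _ (normr_ge0 _) (normr_ge0 _) h1 (vM x).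
have := h _ _ (normr_ge0 _) (normr_ge0 _) h2 (uM y).
by rewrite (mulrC `|v x - v y|); lra.
Qed.

Lemma unif_contZ u (c : R) (M : R) : (forall x, `|u x| <= M) -> unif_cont u ->
  unif_cont (fun x => c * u x).
Proof.
move=> uM uu; apply: (@unif_contM (fun=> c) u (Num.max M `|c|)) => //.
- by move=> x; rewrite le_max lexx orbT.
- by move=> x; rewrite le_max uM.
- by move=> k k0; exists 1 => // x y _; rewrite subrr normr0 ltW.
Qed.

Lemma unif_contN u : unif_cont u -> unif_cont (\- u).
Proof.
move=> uu k /uu[e e0 he]; exists e => // x y /he.
by rewrite /= -opprD normrN.
Qed.

Lemma convex_combination_lt (a b t c : R) : 0 <= c <= 1 -> a < b -> t < b ->
  c * a + (1 - c) * t < b.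
Proof.
move=> /andP[c0 c1] ab tb; have [c0'|c0'] := leP c 0.
  by rewrite (_ : c = 0) ?mul0r ?subr0 ?add0r ?mul1r//; lra.
have : c * a < c * b by rewrite ltr_pM2l.
have : (1 - c) * t <= (1 - c) * b by rewrite ler_wpM2l ?subr_ge0// ltW.
lra.
Qed.

Definition unit_clamp (a : R) := Num.max 0 (Num.min 1 a).

Lemma unit_clamp01 a : 0 <= unit_clamp a <= 1.
Proof. by rewrite /unit_clamp le_max lexx/= ge_max ge_min lexx ler01. Qed.

Lemma unit_clamp_lip a b : `|unit_clamp a - unit_clamp b| <= `|a - b|.
Proof.
have cases (x : R) : [\/ x <= 0 /\ unit_clamp x = 0, 0 <= x <= 1 /\ unit_clamp x = x |
    1 <= x /\ unit_clamp x = 1].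
  rewrite /unit_clamp; have [x1|x1] := leP 1 x.
    by apply: Or33; rewrite (max_r ler01).
  have [x0|x0] := leP x 0; first by apply: Or31.
  by apply: Or32; rewrite !ltW.
rewrite ler_norml; have := ler_norm (a - b); have := ler_norm (b - a); rewrite distrC.
case: (cases a) => -[ha ->]; case: (cases b) => -[hb ->]; move: `|a - b| => c h1 h2; lra.
Qed.

End uniform_continuity.

(** Uniform only on smaller concentric balls, since coefficients continuous on the open ball may
    oscillate near the sphere. Uniformity in [a] will come from clamping [a]. *)
Definition interior_unif_cont {R : realType} d (rho : R) (G : 'rV[R]_d -> R -> R) :=
  forall sg k : R, 0 < sg -> 0 < k -> exists2 e : R, 0 < e &
  forall x y, enorm x <= rho - sg -> enorm y <= rho - sg -> enorm (x - y) < e ->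
  forall a, `|G x a - G y a| <= k.

Section approximation.
Context {R : realType} (d : nat) (s C rho m : R).
Hypotheses (hs : 0 < s < 1) (C0 : 0 < C) (m0 : 0 < m).
Variables (phi : 'rV[R]_d -> R) (G : 'rV[R]_d -> R -> R).
Hypotheses (phim : forall x, `|phi x| <= m) (phiuc : unif_cont phi).
Hypothesis Gm : forall x a, enorm x < rho -> `|G x a| <= m.
Hypothesis Glip : forall x a b, enorm x < rho -> `|G x a - G x b| <= 2^-1 * `|a - b|.
Hypothesis Guc : interior_unif_cont rho G.
Local Notation L := (frac_laplacian_truncated s).
Local Notation row := (@row_of_tuple R d).

Implicit Types (u v : 'rV[R]_d -> R) (x y : 'rV[R]_d).

Definition residual (r : R) (u : 'rV[R]_d -> R) x := C * L u x r + G x (u x) - u x.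

(** The two alternatives describe the layer where the cutoff mixes the equation with the boundary
    condition: there one inequality of the two holds, which is all a comparison with a barrier
    needs. The full equation, up to [r], is available only at distance 2 r from the sphere. *)
Definition approx_solution (r : R) (u : 'rV[R]_d -> R) :=
  [/\ unif_cont u, forall x, `|u x| <= m,
    forall x, u x <= phi x + r \/ (enorm x < rho - r /\ - r <= residual r u x),
    forall x, phi x - r <= u x \/ (enorm x < rho - r /\ residual r u x <= r) &
    forall x, enorm x <= rho - 2 * r -> `|residual r u x| <= r].

Section scheme.
Variables (r : R) (r0 : 0 < r).
Let La := Lam d s r.
Let w := 1 + C * La.

Let La0 : 0 <= La. Proof. exact: Lam_ge0. Qed.

Let w1 : 1 <= w.
Proof. by rewrite /w lerDl mulr_ge0// ltW. Qed.

Let w0 : 0 < w. Proof. exact: lt_le_trans w1. Qed.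

(** This is the integral of u(x + z) against the truncated kernel: adding [u x * La] undoes the
    subtraction in the increment. The truncated equation becomes w u = C average(u) + G(x, u). *)
Let average u x := L u x r + u x * La.

Let average_le u v x y c : admissible u -> admissible v ->
  (forall z : 'rV[R]_d, u (x + z) <= v (y + z) + c) ->
  average u x <= average v y + c * La.
Proof.
move=> au av uv.
have := @truncated_le R d s hs u v x y r (c + v y - u x) au av r0.
have h t : u (x + row t) - u x <= v (y + row t) - v y + (c + v y - u x).
  by have := uv (row t); lra.
move=> /(_ (fun t _ => h t)); rewrite -/La /average; lra.
Qed.

Let average0 x : average (fun=> 0) x = 0.
Proof.
rewrite /average mul0r addr0 truncatedE; under eq_Rintegral do rewrite subr0 mul0r.
by rewrite /Rintegral integral0.
Qed.

Let adm u : unif_cont u -> (forall x, `|u x| <= m) -> admissible u.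
Proof. by move=> /unif_cont_continuous cu um; exact: (admissible_cont cu um). Qed.

Let adm0 : @admissible R d (fun=> 0).
Proof.
apply: (@admissible_cont R d (fun=> 0) 0); last by move=> x; rewrite normr0.
exact: cst_continuous.
Qed.

Let average_bound u x : unif_cont u -> (forall x, `|u x| <= m) -> `|average u x| <= m * La.
Proof.
move=> uu um; have au := adm uu um.
have h1 := @average_le u (fun=> 0) x x m au adm0.
have h2 := @average_le (fun=> 0) u x x m adm0 au.
move: h1 h2; rewrite !average0 => h1 h2; rewrite ler_norml.
have /h1 : forall z, u (x + z) <= 0 + m.
  by move=> z; have := um (x + z); rewrite ler_norml; lra.
have /h2 : forall z, 0 <= u (x + z) + m.
  by move=> z; have := um (x + z); rewrite ler_norml; lra.
lra.
Qed.

Let chi x := unit_clamp ((rho - r - enorm x) / r).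

Let chi01 x : 0 <= chi x <= 1. Proof. exact: unit_clamp01. Qed.

Let chi_norm x : `|chi x| <= 1.
Proof. by case/andP: (chi01 x) => c0 c1; rewrite ger0_norm. Qed.

Let chi_normC x : `|1 - chi x| <= 1.
Proof. by case/andP: (chi01 x) => c0 c1; rewrite ger0_norm ?subr_ge0// gerBl. Qed.

Let chi_eq0 x : rho - r <= enorm x -> chi x = 0.
Proof.
move=> h; rewrite /chi /unit_clamp max_l// ge_min; apply/orP; right.
by rewrite pmulr_lle0 ?invr_gt0// subr_le0.
Qed.

Let far_out x : rho <= enorm x -> rho - r <= enorm x.
Proof. by move=> xout; rewrite (le_trans _ xout)// gerBl ltW. Qed.

Let chi_eq1 x : enorm x <= rho - 2 * r -> chi x = 1.
Proof.
move=> h; rewrite /chi /unit_clamp min_l ?max_r//.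
by rewrite ler_pdivlMr// mul1r; lra.
Qed.

Let chi_uc : unif_cont chi.
Proof.
apply: (@unif_cont_lipschitz _ _ _ r^-1) => x y.
apply: (le_trans (unit_clamp_lip _ _)).
rewrite -mulrBl normrM mulrC gtr0_norm ?invr_gt0// ler_pM2l ?invr_gt0//.
rewrite (_ : rho - r - enorm x - (rho - r - enorm y) = enorm y - enorm x); last by ring.
by rewrite distrC enorm_sub.
Qed.

(** Since [chi] vanishes at distance at most [r] from the sphere, either both points are at distance
    at least r/2, where [G] is uniformly continuous, or both products vanish. *)
Let chiG_uc u : unif_cont u -> unif_cont (fun x => chi x * G x (u x)).
Proof.
move=> uu k k0.
have k1 : 0 < k / 4 by lra.
have km : 0 < k / 4 / m by rewrite divr_gt0.
have [e1 e10 h1] := chi_uc km.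
have [e2 e20 h2] := uu _ k1.
have [e3 e30 h3] := Guc (divr_gt0 r0 (ltr0Sn _ 1)) k1.
exists (Num.min (Num.min e1 e2) (Num.min e3 (r / 2))) => [|x y].
  by rewrite !lt_min e10 e20 e30/= divr_gt0.
rewrite !lt_min => /andP[/andP[/h1 c1 /h2 c2]] /andP[xy3 xyr].
have := enorm_sub x y; rewrite ler_norml => exy.
have [xin|xout] := ltP (enorm x) (rho - r); last first.
  have [yin|yout] := ltP (enorm y) (rho - r); last first.
    by rewrite (chi_eq0 xout) (chi_eq0 yout) !mul0r subrr normr0 ltW.
  have yB : enorm y < rho by lra.
  rewrite (chi_eq0 xout) mul0r sub0r normrN normrM.
  rewrite (chi_eq0 xout) sub0r normrN in c1.
  apply: (@le_trans _ _ (k / 4 / m * m)); first by rewrite ler_pM// Gm.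
  by rewrite divfK ?gt_eqF//; lra.
have [yin|yout] := leP (enorm y) (rho - r / 2); last lra.
have xB : enorm x < rho by lra.
have yB : enorm y < rho by lra.
have xin' : enorm x <= rho - r / 2 by lra.
rewrite (_ : _ - _ = (chi x - chi y) * G x (u x) +
  chi y * ((G x (u x) - G y (u x)) + (G y (u x) - G y (u y)))); last by ring.
rewrite (le_trans (ler_normD _ _))// !normrM.
have b1 : `|chi x - chi y| * `|G x (u x)| <= k / 4.
  apply: (@le_trans _ _ (k / 4 / m * m)); first by rewrite ler_pM// Gm.
  by rewrite divfK ?gt_eqF//; lra.
have b2 : `|G x (u x) - G y (u x) + (G y (u x) - G y (u y))| <= k / 2.
  rewrite (le_trans (ler_normD _ _))//.
  have := h3 _ _ xin' yin xy3 (u x); have := @Glip y (u x) (u y) yB; lra.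
have b3 : `|chi y| <= 1 by exact: chi_norm.
have : `|chi y| * `|G x (u x) - G y (u x) + (G y (u x) - G y (u y))| <= 1 * (k / 2).
  by rewrite ler_pM.
lra.
Qed.

(** A fixed point would solve the truncated equation where [chi] is 1 and equal [phi] where [chi] is
    0. Both terms averaged by [chi] stay in [-m, m], whence the a priori bound. *)
Let T u x := (1 - chi x) * phi x + chi x * ((C * average u x + G x (u x)) / w).

Let average_uc u : unif_cont u -> (forall x, `|u x| <= m) -> unif_cont (average u).
Proof.
move=> uu um; have au := adm uu um; apply: unif_contP => k k0.
have kL : 0 < k / (La + 1) by rewrite divr_gt0// ltr_wpDl.
have [e e0 he] := uu _ kL; exists e => // x y xy.
have /(average_le au au) : forall z, u (x + z) <= u (y + z) + k / (La + 1).
  move=> z; have := he (x + z) (y + z); rewrite opprD addrACA subrr addr0 => /(_ xy).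
  by rewrite ler_norml; lra.
suff : k / (La + 1) * La <= k by lra.
rewrite mulrAC ler_pdivrMr ?ltr_wpDl//; nra.
Qed.

Let T_bound u : unif_cont u -> (forall x, `|u x| <= m) -> forall x, `|T u x| <= m.
Proof.
move=> uu um x; have /andP[c0 c1] := chi01 x.
have [xin|xout] := ltP (enorm x) rho; last first.
  have -> : T u x = phi x by rewrite /T chi_eq0; [ring|exact: far_out].
  exact: phim.
have h : `|(C * average u x + G x (u x)) / w| <= m.
  rewrite normrM [`|w^-1|]gtr0_norm ?invr_gt0// ler_pdivrMr//.
  have a := average_bound x uu um; have g := @Gm x (u x) xin.
  rewrite (le_trans (ler_normD _ _))// normrM (gtr0_norm C0).
  have : C * `|average u x| <= C * (m * La) by rewrite ler_pM2l.
  by rewrite /w; lra.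
have := phim x; move: h; rewrite !ler_norml /T.
move: ((C * _ + _) / w) (phi x) (chi x) c0 c1 => a b c c0 c1 ha hb.
by apply/andP; split; nra.
Qed.

Let T_uc u : unif_cont u -> (forall x, `|u x| <= m) -> unif_cont (T u).
Proof.
move=> uu um.
have ab x : `|average u x| <= Num.max 1 (m * La) by rewrite le_max average_bound ?orbT.
have chib x : `|chi x| <= Num.max 1 (m * La).
  by rewrite le_max chi_norm.
have chib1 x : `|1 - chi x| <= Num.max 1 m.
  by rewrite le_max chi_normC.
have -> : T u = ((fun x => 1 - chi x) \* phi) \+
    ((fun x => (C / w) * (chi \* average u) x) \+ (fun x => w^-1 * (chi x * G x (u x)))).
  by apply/funext => x; rewrite /T/=; ring.
apply: unif_contD; [|apply: unif_contD].
- apply: (@unif_contM _ _ _ _ (Num.max 1 m)) => //.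
    by move=> x; rewrite le_max phim orbT.
  by move=> k /chi_uc[e e0 he]; exists e => // x y /he; rewrite distrC; congr (`|_| <= _); ring.
- apply: (@unif_contZ _ _ _ _ (m * La)).
    by move=> x /=; rewrite normrM -[leRHS]mul1r ler_pM ?average_bound// chi_norm.
  exact: unif_contM ab chi_uc (average_uc uu um).
- apply: (@unif_contZ _ _ _ _ m); last exact: chiG_uc.
  move=> x; have [xin|xout] := ltP (enorm x) rho; last first.
    by rewrite (chi_eq0 (far_out xout)) mul0r normr0 ltW.
  by rewrite normrM -[leRHS]mul1r ler_pM ?Gm// chi_norm.
Qed.

(** The contraction factor: below 1 because the Lipschitz constant 1/2 of [G] is beaten by the 1
    that - u contributes to [w]. It depends on [r] through [La], so the limit in [r] needs other
    estimates. *)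
Let q := (C * La + 2^-1) / w.

Let q01 : 0 <= q < 1.
Proof.
have CL : 0 <= C * La by rewrite mulr_ge0// ltW.
rewrite /q divr_ge0 ?ltW//=; last by rewrite ltr_wpDl.
by rewrite ltr_pdivrMr// mul1r /w; lra.
Qed.

Let T_contraction u v c : unif_cont u -> (forall x, `|u x| <= m) ->
  unif_cont v -> (forall x, `|v x| <= m) ->
  (forall x, `|u x - v x| <= c) -> forall x, `|T u x - T v x| <= q * c.
Proof.
move=> uu um uv vm uvc x; have /andP[c0 c1] := chi01 x.
have cc : 0 <= c by apply: le_trans (uvc 0).
have qc0 : 0 <= q * c by rewrite mulr_ge0//; case/andP: q01.
have [xin|xout] := ltP (enorm x) rho; last first.
  by rewrite /T !(chi_eq0 (far_out xout)) !mul0r !addr0 subrr normr0.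
have au := adm uu um; have av := adm uv vm.
have h1 : average u x <= average v x + c * La.
  by apply: average_le => // z; have := uvc (x + z); rewrite ler_norml; lra.
have h2 : average v x <= average u x + c * La.
  by apply: average_le => // z; have := uvc (x + z); rewrite ler_norml; lra.
have g : `|G x (u x) - G x (v x)| <= 2^-1 * c.
  by apply: (le_trans (Glip _ _ xin)); rewrite ler_pM2l.
rewrite (_ : T u x - T v x =
  chi x * ((C * (average u x - average v x) + (G x (u x) - G x (v x))) / w)); last first.
  by rewrite /T; ring.
rewrite normrM -[leRHS]mul1r; apply: ler_pM; rewrite ?normr_ge0 ?chi_norm//.
rewrite normrM [`|w^-1|]gtr0_norm ?invr_gt0// /q mulrAC ler_pM2r ?invr_gt0//.
rewrite (le_trans (ler_normD _ _))// normrM (gtr0_norm C0) mulrDl lerD//.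
by rewrite -mulrA ler_pM2l// ler_norml; lra.
Qed.

Lemma approx_solution_exists : exists u, approx_solution r u.
Proof.
pose U n := iter n T (fun=> 0).
have UP n : unif_cont (U n) /\ (forall x, `|U n x| <= m).
  elim: n => [|n [uu um]] /=.
    by split=> [k k0|x]; [exists 1 => // x y _; rewrite subrr normr0 ltW|rewrite normr0 ltW].
  by split; [exact: T_uc|exact: T_bound].
have Uq n x : `|U n.+1 x - U n x| <= q ^+ n * m.
  elim: n x => [|n IH] x; first by rewrite expr0 mul1r subr0; exact: (UP 1%N).2.
  have [u1 m1] := UP n; have [u2 m2] := UP n.+1.
  by rewrite exprS -mulrA; apply: T_contraction.
have rw : 0 < r / w by rewrite divr_gt0.
(* The target is [r / w] and not [r] because the defect T u - u is the residual divided by [w]. *)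
have [n qn] : exists n, q ^+ n * m <= r / w.
  have [q0 q1] := andP q01.
  have : (q ^+ n @[n --> \oo] --> 0) by apply: cvg_expr; rewrite ger0_norm.
  have e0 : 0 < r / w / m by rewrite divr_gt0.
  move=> /cvgrPdist_le/(_ _ e0)[N _ /(_ N (leqnn _))] /=.
  rewrite sub0r normrN ger0_norm ?exprn_ge0// ler_pdivlMr//.
  by exists N.
have [uu um] := UP n; exists (U n).
have h x : `|T (U n) x - U n x| <= r / w by exact: le_trans (Uq n x) qn.
have rwr : r / w <= r by rewrite ler_pdivrMr// ler_peMr// ltW.
(* The defect is a convex combination of the scaled residual and of the boundary error. If both lay
   beyond a threshold, so would the combination; this yields the alternatives in
   [approx_solution]. *)
have TE x : T (U n) x - U n x =
    chi x * (residual r (U n) x / w) + (1 - chi x) * (phi x - U n x).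
  rewrite /T /residual /average; have wn0 : w != 0 by rewrite gt_eqF.
  by rewrite /w in wn0 *; field.
split=> // x; have := h x; rewrite TE; have /andP[c0 c1] := chi01 x.
- move=> hx; have [|ux] := leP (U n x) (phi x + r); [by left|right].
  have [xin|xout] := ltP (enorm x) (rho - r); last first.
    by move: hx; rewrite (chi_eq0 xout) mul0r add0r subr0 mul1r ler_norml; lra.
  split=> //; rewrite leNgt; apply/negP => E.
  have Ew : residual r (U n) x / w < - (r / w).
    by rewrite -mulNr ltr_pM2r// invr_gt0.
  move: hx; rewrite ler_norml => /andP[+ _].
  have tl : phi x - U n x < - (r / w) by lra.
  by have := convex_combination_lt (chi01 x) Ew tl; lra.
- move=> hx; have [|ux] := leP (phi x - r) (U n x); [by left|right].
  have [xin|xout] := ltP (enorm x) (rho - r); last first.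
    by move: hx; rewrite (chi_eq0 xout) mul0r add0r subr0 mul1r ler_norml; lra.
  split=> //; rewrite leNgt; apply/negP => E.
  have Ew : r / w < residual r (U n) x / w.
    by rewrite ltr_pM2r// invr_gt0.
  move: hx; rewrite ler_norml => /andP[_ +].
  have Ew' : - (residual r (U n) x / w) < - (r / w) by rewrite ltrN2.
  have tl : - (phi x - U n x) < - (r / w) by lra.
  by have := convex_combination_lt (chi01 x) Ew' tl; lra.
- move=> hx xin; move: hx; rewrite (chi_eq1 xin) subrr mul0r addr0 mul1r.
  by rewrite normrM [`|w^-1|]gtr0_norm ?invr_gt0// ler_pM2r// invr_gt0.
Qed.

End scheme.
End approximation.

(** * Boundary barrier *)

Section powers.
Context {R : realType}.
Implicit Types a t x y : R.

(** The tangent at 1 of a concave power, read off from Young's inequality with exponents 1/a and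
    1/(1 - a). *)
Lemma powR_le_affine a y : 0 < a < 1 -> 0 <= y -> y `^ a <= a * y + (1 - a).
Proof.
move=> /andP[a0 a1] y0; have a10 : 0 < 1 - a by rewrite subr_gt0.
have := @conjugate_powR R (y `^ a) 1 a^-1 (1 - a)^-1 (powR_ge0 _ _) ler01.
rewrite !invr_gt0 !invrK => /(_ a0 a10); rewrite subrKC => /(_ erefl).
by rewrite mulr1 powR1 mul1r -powRrM mulfV ?gt_eqF// powRr1// mulrC.
Qed.

Lemma unit_clamp_ge0 a : 0 <= unit_clamp a.
Proof. by case/andP: (unit_clamp01 a). Qed.

Lemma unit_clamp_id a : 0 <= a <= 1 -> unit_clamp a = a.
Proof. by move=> /andP[a0 a1]; rewrite /unit_clamp min_r ?max_r. Qed.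

Lemma unit_clamp_le a : 0 <= a -> unit_clamp a <= a.
Proof. by move=> a0; rewrite /unit_clamp ge_max a0 ge_min lexx orbT. Qed.

Lemma unit_clamp_eq0 a : a <= 0 -> unit_clamp a = 0.
Proof. by move=> a0; rewrite /unit_clamp max_l// ge_min a0 orbT. Qed.

Lemma unit_clamp_eq1 a : 1 <= a -> unit_clamp a = 1.
Proof. by move=> a1; rewrite /unit_clamp min_l// max_r. Qed.

Definition ramp_power (a t : R) := unit_clamp t `^ a.

Lemma ramp_power_le a t : 0 < a -> 0 <= t -> ramp_power a t <= t `^ a.
Proof.
move=> a0 t0; apply: ge0_ler_powR; rewrite ?nnegrE ?unit_clamp_ge0 ?(ltW a0)//.
exact: unit_clamp_le.
Qed.

Lemma ramp_power_eq0 a t : 0 < a -> t <= 0 -> ramp_power a t = 0.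
Proof. by move=> a0 t0; rewrite /ramp_power unit_clamp_eq0// powR0// gt_eqF. Qed.

Lemma ramp_powerE a t : 0 <= t <= 1 -> ramp_power a t = t `^ a.
Proof. by move=> t01; rewrite /ramp_power unit_clamp_id. Qed.

Lemma ramp_power01 a t : 0 < a -> 0 <= ramp_power a t <= 1.
Proof.
move=> a0; rewrite powR_ge0/=; have := unit_clamp01 t => /andP[c0 c1].
have := @ge0_ler_powR R a (ltW a0) (unit_clamp t) 1; rewrite !nnegrE powR1.
by apply.
Qed.

Lemma ramp_power_eq1 a t : 1 <= t -> ramp_power a t = 1.
Proof. by move=> t1; rewrite /ramp_power unit_clamp_eq1// powR1. Qed.

(** Concavity, rescaled to base point [t]. The correction is linear in [b], so the bounds for [b]
    and [- b] cancel when added. *)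
Lemma ramp_power_tangent a t b : 0 < a < 1 -> 0 < t <= 1 -> b <= t ->
  ramp_power a (t - b) <= t `^ a * (1 - a * (b / t)).
Proof.
move=> a01 /andP[t0 t1] bt; have /andP[a0 a1] := a01.
apply: (@le_trans _ _ ((t - b) `^ a)); first by rewrite ramp_power_le// subr_ge0.
rewrite (_ : t - b = t * (1 - b / t)); last by field; rewrite gt_eqF.
have y0 : 0 <= 1 - b / t by rewrite subr_ge0 ler_pdivrMr// mul1r.
rewrite powRM ?(ltW t0)// ler_wpM2l ?powR_ge0//.
by apply: (le_trans (powR_le_affine a01 y0)); lra.
Qed.

(** Writing the exponent as [s * b] and using concavity only for the power [b] makes the excess over
    t^(s b) proportional to [b]. The price is a growth of order [s], which the kernel of order 2 s
    still integrates at infinity. *)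
Lemma ramp_power_growth s b t x : 0 < s < 1 -> 0 < b < 1 -> 0 < t -> t <= x ->
  ramp_power (s * b) (t + x) <= t `^ (s * b) * (1 + 2 * b * (x / t) `^ s).
Proof.
move=> s01 b01 t0 tx; have /andP[s0 s1] := s01; have /andP[b0 b1] := b01.
have x0 := lt_le_trans t0 tx.
apply: (@le_trans _ _ ((t + x) `^ (s * b))).
  by rewrite ramp_power_le ?mulr_gt0// addr_ge0// ltW.
rewrite (_ : t + x = t * (1 + x / t)); last by field; rewrite gt_eqF.
have xt1 : 1 <= x / t by rewrite ler_pdivlMr// mul1r.
rewrite powRM ?(ltW t0)//; last by lra.
rewrite ler_wpM2l ?powR_ge0// powRrM.
apply: (le_trans (powR_le_affine b01 (powR_ge0 _ _))).
have : (1 + x / t) `^ s <= (2 * (x / t)) `^ s.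
  by apply: ge0_ler_powR; rewrite ?nnegrE; lra.
have : (2 : R) `^ s <= 2 by rewrite -[leRHS]powRr1// ler_powR ?ler1n// ltW.
rewrite [(2 * _) `^ s]powRM//; last by lra.
have := powR_ge0 (x / t) s; move: ((1 + x / t) `^ s) ((x / t) `^ s) (2 `^ s) => w u v u0 v2 wvu.
have : w <= 2 * u by apply: (le_trans wvu); rewrite ler_wpM2r.
nra.
Qed.

End powers.

Section half_space_barrier.
Context {R : realType} (d : nat) (s : R) (hs : 0 < s < 1).
Local Notation RT := (measurableTypeR R).
Local Notation mu := (lebesgue_tuple d).
Local Notation row := (@row_of_tuple R d).
Local Notation L := (frac_laplacian_truncated s).
Local Notation K := (kernel (2 * s)).

Definition half_space_power (a rho : R) (e x : 'rV[R]_d) := ramp_power a (rho - edot e x).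

Lemma admissible_half_space_power a rho e : 0 < a ->
  admissible (half_space_power a rho e).
Proof.
move=> a0; split.
  by exists 1 => x; have /andP[g0 g1] := ramp_power01 (rho - edot e x) a0; rewrite ger0_norm.
move=> x; apply: (@measurableT_comp _ _ _ _ _ _ (fun y : R => y `^ a)).
  exact: measurable_powR.
apply: (@measurable_fun_rowT R d (fun z => unit_clamp (rho - edot e (x + z)))).
apply: unif_cont_continuous; apply: (@unif_cont_lipschitz _ _ _ (enorm e)) => y z.
apply: (le_trans (unit_clamp_lip _ _)); rewrite !edotDr.
rewrite (_ : _ - _ - _ = edot e (z - y)); last by rewrite edotDr edotNr; ring.
by rewrite enormBC normr_edot_le.
Qed.

(** A cube centred at 2 t e and contained in the ball of radius t/2 around that point. For a unit
    vector [e] it lies beyond the hyperplane at distance [t], yet within distance 3 t of the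
    origin. *)
Definition offset_box (e : 'rV[R]_d) (t : R) : set (d.-tuple RT) :=
  [set z | forall i, `[2 * t * e 0 i - t / (2 * d.+1%:R),
    2 * t * e 0 i + t / (2 * d.+1%:R)]%classic (tnth z i)].

Lemma measurable_offset_box e t : measurable (offset_box e t).
Proof.
apply: (@measurable_box R d (fun i =>
  `[2 * t * e 0 i - t / (2 * d.+1%:R), 2 * t * e 0 i + t / (2 * d.+1%:R)]%classic)).
by move=> i; exact: measurable_itv.
Qed.

Lemma measure_offset_box e t : 0 < t ->
  mu (offset_box e t) = ((t / d.+1%:R) ^+ d)%:E.
Proof.
move=> t0; rewrite (@lebesgue_tuple_box R d (fun i =>
  `[2 * t * e 0 i - t / (2 * d.+1%:R), 2 * t * e 0 i + t / (2 * d.+1%:R)]%classic)); last first.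
  by move=> i; exact: measurable_itv.
rewrite (eq_bigr (fun=> (t / d.+1%:R)%:E)).
  by rewrite prodEFin prodr_const card_ord.
move=> i _; have d0 : 0 < t / (2 * d.+1%:R) by rewrite divr_gt0// mulr_gt0.
rewrite lebesgue_measure_itv/= lte_fin ifT; last by rewrite ltrBlDr -addrA ltrDl addr_gt0.
by rewrite -EFinD; congr EFin; field.
Qed.

Lemma offset_box_near e t z : 0 < t -> offset_box e t z ->
  enorm (row z - (2 * t) *: e) <= t / 2.
Proof.
move=> t0 zb; apply: (@le_trans _ _ (d%:R * (t / (2 * d.+1%:R)))).
  apply: enorm_le_coord; last by rewrite divr_ge0 ?mulr_ge0// ltW.
  move=> i; have := zb i; rewrite !mxE /= in_itv/= ler_norml.
  by move: (t / _) (2 * t * _) => D E; lra.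
rewrite mulrA ler_pdivrMr ?mulr_gt0// mulrAC.
have : d%:R <= d.+1%:R :> R by rewrite ler_nat.
nra.
Qed.

Lemma offset_boxP e t z : enorm e = 1 -> 0 < t -> offset_box e t z ->
  t < edot e (row z) /\ enorm (row z) <= 3 * t.
Proof.
move=> e1 t0 zb; have h := offset_box_near t0 zb.
have ez : edot e (row z) = 2 * t + edot e (row z - (2 * t) *: e).
  by rewrite edotDr edotNr edotZr -enorm_sqr e1; ring.
have := normr_edot_le e (row z - (2 * t) *: e); rewrite e1 mul1r ler_norml => hh.
split; first by lra.
have := enormD (row z - (2 * t) *: e) ((2 * t) *: e); rewrite subrK enormZ e1 mulr1.
by rewrite gtr0_norm; lra.
Qed.

(** By scaling, gain and loss at distance t are multiples of t^(a - 2 s), which is at least 1 as t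
    <= 1 and a < 2 s; hence [k] depends on neither t nor the truncation. The gain comes from a cube
    beyond the hyperplane, where the power vanishes; the loss, from the growth on the other side,
    carries the factor [b]. *)
Lemma half_space_barrier : exists a k : R, [/\ 0 < a, 0 < k &
  forall rho e x r, enorm e = 1 -> 0 < r -> r <= rho - edot e x <= 1 ->
    L (half_space_power a rho e) x r <= - k].
Proof.
have /andP[s0 s1] := hs.
have [cn cn0 cnP] := near_constant_exists d hs.
have [cs cs0 csP] := @kernel_far_bound R d s s0.
(* At scale t = 1: half the kernel at distance 3, times the volume of the cube. The choice of [b]
   below keeps the loss [b * cs] under half of this gain. *)
pose k0 : R := 2^-1 * (3 `^ (d%:R + 2 * s))^-1 * (d.+1%:R^-1) ^+ d.
have k00 : 0 < k0 by rewrite !mulr_gt0 ?invr_gt0 ?powR_gt0// exprn_gt0// invr_gt0.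
pose b := Num.min (2^-1) (k0 / (2 * cs)).
have b01 : 0 < b < 1.
  by rewrite lt_min gt_min divr_gt0 ?mulr_gt0//= invr_gt0 ltr0Sn /= invf_lt1// ltr1n.
have bk : b * cs <= k0 / 2.
  have : b <= k0 / (2 * cs) by rewrite ge_min lexx orbT.
  by move=> /(ler_wpM2r (ltW cs0))/le_trans; apply; rewrite le_eqVlt; apply/orP; left; apply/eqP;
    field; rewrite gt_eqF.
have /andP[b0 b1] := b01.
pose a := s * b; have a0 : 0 < a by rewrite mulr_gt0.
have a01 : 0 < a < 1 by rewrite a0/= (lt_trans _ s1)// gtr_pMr.
exists a, (k0 / 2); split=> //; first by rewrite divr_gt0.
move=> rho e x r e1 r0 /andP[]; set t := rho - edot e x => rt t1.
have t0 : 0 < t := lt_le_trans r0 rt.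
set psi := half_space_power a rho e.
have au : admissible psi by exact: admissible_half_space_power.
have psix : psi x = t `^ a by rewrite /psi /half_space_power ramp_powerE// ltW.
have psiD z : psi (x + z) = ramp_power a (t - edot e z).
  by rewrite /psi /half_space_power edotDr /t; congr ramp_power; ring.
have t01 : 0 < t <= 1 by rewrite t0.
have ed z : `|edot e z| <= enorm z by rewrite (le_trans (normr_edot_le _ _))// e1 mul1r.
(* For |z| < t the profile lies below its tangent, a paraboloid with no quadratic term, so the
   integral over r <= |z| < t is not positive. *)
have step1 : L psi x r <= L psi x t.
  have := @truncated_touched_above R d s hs cn cnP psi x (- (a * t `^ a / t) *: e)
    0 0 r t au r0 rt (lexx 0) (lexx 0).
  rewrite !mul0r !addr0; apply=> z zt; rewrite psiD psix mul0r !addr0.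
  have bt : edot e z <= t by have := ed z; rewrite ler_norml; lra.
  have := ramp_power_tangent a01 t01 bt.
  rewrite edotZl; suff -> : - (a * t `^ a / t) * edot e z = t `^ a * (1 - a * (edot e z / t))
    - t `^ a by lra.
  by field; rewrite gt_eqF.
apply: (le_trans step1).
(* The majorant [f] of half the symmetrized integrand: the [c1] term absorbs the growth of the
   power, the [c2] term records the zero values on the cube, where the kernel is at least (3 t)^(- d
   - 2 s). The 1/2 in [c2] is that of the symmetrization. *)
pose c1 : R := b * (t `^ a / t `^ s).
pose c2 : R := 2^-1 * t `^ a * ((3 * t) `^ (d%:R + 2 * s))^-1.
have c20 : 0 <= c2 by rewrite !mulr_ge0 ?invr_ge0 ?powR_ge0.
pose f z := c1 * kernel s z + (- c2) * \1_(offset_box e t) z.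
have mt := @measurable_far R d t.
have mQ := measurable_offset_box e t.
have Qfar : offset_box e t `<=` far t.
  move=> z /(offset_boxP e1 t0)[h _]; rewrite /far/=.
  by have := ed (row z); rewrite ler_norml; lra.
have ik : mu.-integrable (far t) (EFin \o (fun z => c1 * kernel s z)).
  by apply: integrable_scaleR => //; exact: kernel_integrable.
have iQ0 : mu.-integrable (far t) (EFin \o \1_(offset_box e t)).
  apply/integrableP; split.
    by apply/measurable_EFinP; exact: measurable_indic.
  rewrite (eq_integral (EFin \o \1_(offset_box e t))); last first.
    by move=> z _ /=; rewrite ger0_norm.
  rewrite /= integral_indic// (setIidl Qfar).
  exact: (eq_ind_r (fun z => z < +oo)%E (ltry _) (measure_offset_box e t0)).
have intQ : \int[mu]_(z in far t) \1_(offset_box e t) z = (t / d.+1%:R) ^+ d.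
  rewrite /Rintegral integral_indic// (setIidl Qfar).
  exact: (congr1 fine (measure_offset_box e t0)).
have iQ : mu.-integrable (far t) (EFin \o (fun z => (- c2) * \1_(offset_box e t) z)).
  exact: integrable_scaleR.
have step2 : L psi x t <= \int[mu]_(z in far t) f z.
  rewrite truncatedE; apply: symmetrized_integral_le => //.
  - exact: far_opp.
  - exact: measurable_increment.
  - exact: truncated_integrable.
  - exact: integrable_addR.
  move=> z zt; rewrite row_opp_tuple !psiD psix edotNr opprK.
  have zt0 : 0 < enorm (row z) := lt_le_trans t0 zt.
  have Kz : K z * enorm (row z) `^ s = kernel s z.
    rewrite /kernel (_ : d%:R + 2 * s = (d%:R + s) + s); last by ring.
    rewrite [X in X^-1 * _]powRD; last by rewrite (gt_eqF zt0) implybT.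
    have e0 : enorm (row z) `^ s != 0 by rewrite gt_eqF// powR_gt0.
    have e2 : enorm (row z) `^ (d%:R + s) != 0 by rewrite gt_eqF// powR_gt0.
    by field; rewrite e0 e2.
  have K0 := kernel_ge0 (2 * s) z.
  set y := edot e (row z).
  have fE : 2 * f z = t `^ a * (2 * b * (enorm (row z) / t) `^ s * K z)
    - 2 * c2 * \1_(offset_box e t) z.
    rewrite /f /c1 -Kz powRM ?invr_ge0 ?(ltW t0) ?enorm_ge0//.
    rewrite -[t^-1]powR_inv1 ?(ltW t0)// powRAC powR_inv1 ?powR_ge0//.
    have ts : t `^ s != 0 by rewrite gt_eqF// powR_gt0.
    by field.
  rewrite fE.
  have ta := powR_ge0 t a.
  have yz : `|y| <= enorm (row z) := ed _.
  (* In the slab |y| <= t the two tangent bounds cancel and the cube is absent. Beyond it one of the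
     two values is 0, and this spare - t^a K(z) pays for the cube term. *)
  have [yt|ty] := leP `|y| t.
    have nQ : \1_(offset_box e t) z = 0 :> R.
      rewrite indicE memNset// => /(offset_boxP e1 t0)[h _].
      by have := lt_le_trans h (ler_norm _); rewrite ltNge yt.
    rewrite nQ mulr0 subr0.
    move: yt; rewrite ler_norml => /andP[yt1 yt2].
    have h1 := ramp_power_tangent a01 t01 yt2.
    have h2 : ramp_power a (t + y) <= t `^ a * (1 - a * (- y / t)).
      by have := @ramp_power_tangent R a t (- y) a01 t01; rewrite opprK; apply; lra.
    apply: (@le_trans _ _ 0).
      rewrite mulr_le0_ge0//; move: h1 h2; rewrite mulNr.
      by move: (ramp_power _ _) (ramp_power _ _) (y / t) (t `^ a) => g1 g2 w T; clear; lra.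
    by rewrite mulr_ge0// !mulr_ge0// ?powR_ge0// ltW.
  have h1 : ramp_power a (t + `|y|) <= t `^ a * (1 + 2 * b * (`|y| / t) `^ s).
    by apply: ramp_power_growth => //; exact: ltW.
  have h0 : ramp_power a (t - `|y|) = 0 by apply: ramp_power_eq0 => //; lra.
  have h2 : ramp_power a (t - y) + ramp_power a (t + y) <= t `^ a * (1 + 2 * b * (`|y| / t) `^ s).
    have [y0|y0] := leP 0 y; first by rewrite ger0_norm// in h0 h1 *; rewrite h0 add0r.
    by rewrite ltr0_norm// opprK in h0 h1 *; rewrite h0 addr0.
  have h3 : (`|y| / t) `^ s <= (enorm (row z) / t) `^ s.
    apply: ge0_ler_powR; rewrite ?nnegrE ?divr_ge0 ?enorm_ge0 ?(ltW s0) ?(ltW t0)//.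
    by rewrite ler_pM2r ?invr_gt0.
  have h4 : 2 * c2 * \1_(offset_box e t) z <= t `^ a * K z.
    have [zQ|zQ] := pselect (offset_box e t z); last first.
      by rewrite indicE memNset// mulr0 mulr_ge0.
    rewrite indicE mem_set// mulr1 /c2 !mulrA divff// mul1r ler_wpM2l// /kernel lef_pV2 ?posrE
      ?powR_gt0 ?mulr_gt0//.
    have [_ z3] := offset_boxP e1 t0 zQ.
    have d2s : 0 <= d%:R + 2 * s by rewrite addr_ge0 ?ler0n// mulr_ge0// ltW.
    have t3 : 0 <= 3 * t by rewrite mulr_ge0// ltW.
    by apply: ge0_ler_powR; rewrite ?nnegrE ?enorm_ge0.
  move: h2 h3 h4; move: (ramp_power a (t - y)) (ramp_power a (t + y)) => g1 g2.
  move: (2 * c2 * _) ((`|y| / t) `^ s) ((enorm (row z) / t) `^ s) (t `^ a) ta (K z) K0 =>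
    v u1 u2 T T0 k k00' h2 h3 h4.
  have h5 : (g1 - T + (g2 - T)) * k <= (T * (1 + 2 * b * u1) - T - T) * k.
    by rewrite ler_wpM2r//; move: h2; clear; lra.
  have h6 : T * (2 * b * u1) * k <= T * (2 * b * u2) * k.
    by rewrite ler_wpM2r// ler_wpM2l// ler_wpM2l// mulr_ge0// ltW.
  by move: h4 h5 h6; clear; lra.
apply: (le_trans step2).
have -> : \int[mu]_(z in far t) f z = c1 * \int[mu]_(z in far t) kernel s z
  - c2 * (t / d.+1%:R) ^+ d.
  have ea := @RintegralZl _ _ _ mu (far t) _ c1 mt (kernel_integrable d s0 t0).
  have eb := @RintegralZl _ _ _ mu (far t) _ (- c2) mt iQ0.
  apply: (etrans (RintegralD mt ik iQ)).
  by apply: (etrans (f_equal2 +%R ea eb)); rewrite intQ mulNr.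
have h1 : \int[mu]_(z in far t) kernel s z <= cs * (t `^ s)^-1.
  rewrite -lee_fin fineK; first exact: csP.
  by apply: integrable_fin_num => //; exact: kernel_integrable.
have c10 : 0 <= c1 by rewrite mulr_ge0 ?(ltW b0)// divr_ge0 ?powR_ge0.
have /(ler_wpM2l c10) h2 := h1.
have E1 : c1 * (cs * (t `^ s)^-1) = b * cs * t `^ (a - 2 * s).
  rewrite powRB; last by rewrite (gt_eqF t0) implybT.
  rewrite [2 * s]mulr_natl mulr2n powRD; last by rewrite (gt_eqF t0) implybT.
  have ts : t `^ s != 0 by rewrite gt_eqF// powR_gt0.
  by rewrite /c1; field.
have E2 : c2 * (t / d.+1%:R) ^+ d = k0 * t `^ (a - 2 * s).
  rewrite powRB; last by rewrite (gt_eqF t0) implybT.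
  rewrite /c2 powRM ?(ltW t0)// [t `^ (d%:R + _)]powRD; last by rewrite (gt_eqF t0) implybT.
  rewrite powR_mulrn ?(ltW t0)// [(t / _) ^+ d]exprMn /k0.
  have td : t ^+ d != 0 by rewrite expf_neq0// gt_eqF.
  have ts : t `^ (2 * s) != 0 by rewrite gt_eqF// powR_gt0.
  have t3 : 3 `^ (d%:R + 2 * s) != 0 :> R by rewrite gt_eqF// powR_gt0.
  move: td ts t3; move: (t ^+ d) (t `^ (2 * s)) (3 `^ _) (_ ^+ d) (t `^ a) => p q u v w p0 q0 u0.
  by field; rewrite p0 q0 u0.
have T1 : 1 <= t `^ (a - 2 * s).
  rewrite -[leLHS](powRr0 t) ger_powR//.
  by rewrite subr_le0 /a mulrC ler_wpM2r ?(ltW s0)//; move: b1; clear; lra.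
rewrite E1 in h2; rewrite E2; move: h2; move: (c1 * _) => I h2.
move: (t `^ _) T1 h2 => T T1 h2; clear - bk k00 T1 h2 b0 cs0.
have : b * cs * T <= k0 / 2 * T by rewrite ler_wpM2r//; lra.
have : k0 / 2 * 1 <= k0 / 2 * T by rewrite ler_pM2l// divr_gt0.
lra.
Qed.

End half_space_barrier.

Lemma exists_near_max {R : realType} (T : Type) (F : T -> R) (M c : R) (t0 : T) :
  (forall t, F t <= M) -> 0 < c -> exists t, forall t', F t' <= F t + c.
Proof.
move=> FM c0; have hs : has_sup (range F).
  by split; [exists (F t0); exists t0|exists M => _ [t _ <-]].
have [_ [t _ <-] ht] := sup_adherent c0 hs.
exists t => t'; rewrite -lerBlDr; apply/ltW/(le_lt_trans _ ht).
by rewrite lerD2r; apply: sup_upper_bound => //; exists t'.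
Qed.

(** * Boundary behaviour of the approximate solutions *)

Section boundary.
Context {R : realType} (d : nat) (s C rho m lip : R).
Hypotheses (hs : 0 < s < 1) (C0 : 0 < C) (m0 : 0 < m) (rho0 : 0 < rho).
Implicit Types (u v phi : 'rV[R]_d -> R) (x y : 'rV[R]_d) (G : 'rV[R]_d -> R -> R).
Local Notation L := (frac_laplacian_truncated s).
Local Notation row := (@row_of_tuple R d).

(** The problem is invariant under u -> - u with nonlinearity - G(x, - a), so bounds from above
    imply bounds from below. *)
Lemma approx_solutionN phi G r u : 0 < r -> approx_solution s C rho m phi G r u ->
  approx_solution s C rho m (\- phi) (fun x a => - G x (- a)) r (\- u).
Proof.
move=> r0 [uu um usub usup ures].
have au : admissible u by exact: admissible_cont (unif_cont_continuous uu) um.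
have rN x : residual s C (fun x a => - G x (- a)) r (\- u) x = - residual s C G r u x.
  by rewrite /residual (truncatedN hs)// opprK; ring.
split.
- exact: unif_contN.
- by move=> x; rewrite normrN.
- by move=> x; rewrite rN; case: (usup x) => [h|[h1 h2]]; [left|right; split] => //=; lra.
- by move=> x; rewrite rN; case: (usub x) => [h|[h1 h2]]; [left|right; split] => //=; lra.
- by move=> x xr; rewrite rN normrN ures.
Qed.

(** A bounded, hence admissible, stand-in for |x|^2, which still has a touching paraboloid from
    above at every point, with quadratic coefficient 1. *)
Definition capped_sqr x : R := Num.min 1 (enorm x ^+ 2).

Lemma capped_sqr01 x : 0 <= capped_sqr x <= 1.
Proof. by rewrite le_min ler01 sqr_ge0 ge_min lexx. Qed.

Lemma capped_sqr_le x : capped_sqr x <= enorm x ^+ 2.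
Proof. by rewrite ge_min lexx orbT. Qed.

Lemma capped_sqr_touched x : exists p, forall z : 'rV[R]_d,
  capped_sqr (x + z) - capped_sqr x <= edot p z + enorm z ^+ 2.
Proof.
have [h|h] := leP 1 (enorm x ^+ 2).
  exists 0 => z; rewrite edotC edot0r add0r /capped_sqr (min_l h).
  by have := sqr_ge0 (enorm z); have /andP[_] := capped_sqr01 (x + z); rewrite /capped_sqr; lra.
exists (2 *: x) => z; have := capped_sqr_le (x + z); rewrite enormD_sqr edotZl.
have -> : capped_sqr x = enorm x ^+ 2 by rewrite /capped_sqr min_r// ltW.
lra.
Qed.

Lemma admissible_capped_sqr x1 : admissible (fun x => capped_sqr (x - x1)).
Proof.
apply: (@admissible_cont _ _ _ 1) => [x|x]; last first.
  by have /andP[q0 q1] := capped_sqr01 (x - x1); rewrite ger0_norm.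
refine (@continuous_min R 'rV[R]_d (fun=> 1) (fun z : 'rV[R]_d => enorm (z - x1) ^+ 2) x _ _).
  exact: cst_continuous.
apply: (@continuous_comp _ _ _ (fun z : 'rV[R]_d => enorm (z - x1)) (fun a : R => a ^+ 2));
  last exact: exprn_continuous.
apply: (@continuous_comp _ _ _ (fun z : 'rV[R]_d => z - x1) (@enorm R d));
  last exact: enorm_continuous.
exact: (cvgB cvg_id (cvg_cst _)).
Qed.

Lemma capped_sqr_truncated : exists2 c : R, 0 < c & forall x1 x r, 0 < r <= 1 ->
  L (fun x => capped_sqr (x - x1)) x r <= c.
Proof.
have [cn cn0 cnP] := near_constant_exists d hs.
exists (cn + Lam d s 1) => [|x1 x r /andP[r0 r1]]; first by rewrite ltr_wpDr// Lam_ge0.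
have aq := admissible_capped_sqr x1.
have [p pP] := capped_sqr_touched (x - x1).
have h1 : L (fun x => capped_sqr (x - x1)) x r <= L (fun x => capped_sqr (x - x1)) x 1 + cn.
  have := @truncated_touched_above R d s hs cn cnP
    (fun x => capped_sqr (x - x1)) x p 1 0 r 1 aq r0 r1 ler01 (lexx 0).
  rewrite mul1r mul0r addr0 powR1 mulr1; apply=> z _.
  by rewrite mul1r addr0 addrAC; exact: pP.
have a0 : @admissible R d (fun=> 0).
  apply: (@admissible_cont R d (fun=> 0) 0); last by move=> z; rewrite normr0.
  exact: cst_continuous.
have h2 : L (fun x => capped_sqr (x - x1)) x 1 <= L (fun=> 0) x 1 + 1 * Lam d s 1.
  apply: truncated_le => // t _; rewrite subrr add0r.
  have /andP[_ q1] := capped_sqr01 (x + row t - x1).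
  by have /andP[q0 _] := capped_sqr01 (x - x1); lra.
have h3 : L (fun=> 0 : R) x 1 = 0.
  rewrite truncatedE; under eq_Rintegral do rewrite subr0 mul0r.
  by rewrite /Rintegral integral0.
by move: h1 h2; rewrite h3; move: (L _ _ _) (L _ _ _) (Lam _ _ _) => ? ? ?; lra.
Qed.

(** For each point x1 of the sphere, [u] stays below phi(x1) + 2 k1 + A h + B q, with h the
    half-space power at x1 and q the capped square centred there. The term B q dominates the
    variation of [phi] away from x1; A h makes the sum a strict supersolution at distance less than
    1 from the hyperplane and exceeds 2 m farther away. The constants do not depend on x1 or [r]. *)
Lemma boundary_upper_bound phi G k : 0 < lip ->
  (forall x, `|phi x| <= m) -> (forall x y, `|phi x - phi y| <= lip * enorm (x - y)) ->
  (forall x a, enorm x < rho -> `|G x a| <= m) -> 0 < k ->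
  exists sg r1 : R, [/\ 0 < sg, 0 < r1 & forall r u, 0 < r <= r1 ->
    approx_solution s C rho m phi G r u ->
    forall x, rho - sg <= enorm x -> u x <= phi x + k].
Proof.
move=> lip0 phim phil Gm k0.
have [a [kb [a0 kb0 barrier]]] := @half_space_barrier R d s hs.
have [cq cq0 cqP] := capped_sqr_truncated.
(* The four quarters: two in the barrier (one for the oscillation of [phi] near x1, one for [r]),
   one for the power term and one for the terms in [B] and [lip]. *)
pose k1 := k / 4; have k10 : 0 < k1 by rewrite divr_gt0.
(* Up to distance k1 / lip the oscillation of [phi] is at most [k1]; farther away the capped square
   is at least [tau], and [B * tau] is the full oscillation 2 m. *)
pose tau := Num.min 1 ((k1 / lip) ^+ 2).
have tau0 : 0 < tau by rewrite lt_min ltr01 exprn_gt0// divr_gt0.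
pose B := 2 * m / tau; have B0 : 0 < B by rewrite divr_gt0// mulr_gt0.
(* The summand 1 absorbs the near-maximum error [c * La']; the last one forces C L u <= - 2 - 2 m,
   against G - u <= 2 m and a residual at least - r >= - 1. *)
pose A := Num.max (2 * m) ((B * cq + 1 + (2 + 2 * m) / C) / kb).
have A2m : 2 * m <= A by rewrite le_max lexx.
have A0 : 0 < A by apply: lt_le_trans A2m; rewrite mulr_gt0.
have Akb : B * cq + 1 + (2 + 2 * m) / C <= A * kb.
  by rewrite -ler_pdivrMr// le_max lexx orbT.
have phiB x1 x : phi x <= phi x1 + k1 + B * capped_sqr (x - x1).
  have := phil x x1; rewrite ler_norml => /andP[_ h].
  have [h1|h1] := leP (enorm (x - x1)) (k1 / lip).
    have : lip * enorm (x - x1) <= k1 by rewrite mulrC -ler_pdivlMr.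
    have : 0 <= B * capped_sqr (x - x1) by rewrite mulr_ge0 ?(ltW B0)//;
      case/andP: (capped_sqr01 (x - x1)).
    lra.
  have : tau <= capped_sqr (x - x1).
    rewrite le_min; apply/andP; split; first by rewrite ge_min lexx.
    rewrite ge_min; apply/orP; right.
    by rewrite ler_sqr ?nnegrE ?enorm_ge0 ?divr_ge0// ltW.
  move=> /(ler_wpM2l (ltW B0)); rewrite {1}/B divfK ?gt_eqF//.
  by have := phim x; have := phim x1; rewrite !ler_norml; lra.
pose sg1 : R := (k1 / (A + 1)) `^ a^-1.
have sg10 : 0 < sg1 by rewrite powR_gt0// divr_gt0// ltr_wpDr// ltW.
have sg1a : A * sg1 `^ a <= k1.
  have A1 : 0 < A + 1 by rewrite addr_gt0.
  rewrite /sg1 -powRrM mulVf ?gt_eqF// powRr1; last by rewrite divr_ge0// ltW.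
  by rewrite mulrA ler_pdivrMr//; nra.
pose sg := Num.min (Num.min 1 (rho / 2)) (Num.min sg1 (k1 / (B + lip))).
have Bl : 0 < B + lip by rewrite addr_gt0.
have sg0 : 0 < sg by rewrite !lt_min ltr01 sg10 !divr_gt0.
have [sgE1 sgE2 sgE3 sgE4] : [/\ sg <= 1, sg <= rho / 2, sg <= sg1 & sg <= k1 / (B + lip)].
  by split; rewrite !ge_min lexx ?orbT.
exists sg, (Num.min 1 k1); split=> //; first by rewrite lt_min ltr01.
move=> r u /andP[r0]; rewrite le_min => /andP[r1 rk] [uu um usub _ _].
have au : admissible u by exact: admissible_cont (unif_cont_continuous uu) um.
have key e : enorm e = 1 -> forall y,
    u y <= phi (rho *: e) + 2 * k1 + A * half_space_power a rho e y + B * capped_sqr (y - rho *: e).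
  move=> e1; set x1 := rho *: e.
  have ah := admissible_half_space_power rho e a0.
  have aq := admissible_capped_sqr x1.
  pose psi y := phi x1 + 2 * k1 + A * half_space_power a rho e y + B * capped_sqr (y - x1).
  have h01 y := @ramp_power01 R a (rho - edot e y) a0.
  move=> y; rewrite -/(psi y) leNgt; apply/negP => uy.
  have La := Lam_ge0 d s r; set La' := Lam d s r in La.
  pose c := Num.min ((u y - psi y) / 2) ((La' + 1)^-1).
  have c0 : 0 < c by rewrite lt_min divr_gt0 ?subr_gt0// invr_gt0 ltr_wpDl.
  have c1 : c <= (u y - psi y) / 2 by rewrite ge_min lexx.
  have c2 : c * La' <= 1.
    have : c <= (La' + 1)^-1 by rewrite ge_min lexx orbT.
    move=> /(ler_wpM2r La)/le_trans; apply.
    by rewrite mulrC ler_pdivrMr ?ltr_wpDl//; lra.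
  have psi_ge z : - m <= psi z.
    rewrite /psi; have /andP[g0 _] := h01 z; have /andP[q0 _] := capped_sqr01 (z - x1).
    have : 0 <= A * half_space_power a rho e z by rewrite mulr_ge0// ltW.
    have : 0 <= B * capped_sqr (z - x1) by rewrite mulr_ge0// ltW.
    by have := phim x1; rewrite ler_norml; lra.
  have F_le z : u z - psi z <= 2 * m.
    by have := psi_ge z; have := um z; rewrite ler_norml; lra.
  have [x xP] := @exists_near_max R _ (fun z => u z - psi z) _ c y F_le c0.
  have ux : psi x < u x by have := xP y; lra.
  have q0 : 0 <= B * capped_sqr (x - x1).
    by rewrite mulr_ge0 ?(ltW B0)//; case/andP: (capped_sqr01 (x - x1)).
  have g0 : 0 <= A * half_space_power a rho e x.
    by rewrite mulr_ge0 ?(ltW A0)//; case/andP: (h01 x).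
  have uxm : u x <= m by have := um x; rewrite ler_norml; lra.
  have uxm' : - m <= u x by have := um x; rewrite ler_norml; lra.
  case: (usub x) => [hx|[xr hx]].
    by have := phiB x1 x; move: hx ux; rewrite /psi; move: q0 g0 rk; lra.
  have edx : edot e x <= enorm x by rewrite -[leRHS]mul1r -e1 edot_le.
  have [t1|t1] := leP 1 (rho - edot e x).
    have g1 : half_space_power a rho e x = 1 by rewrite /half_space_power ramp_power_eq1.
    move: ux; rewrite /psi g1 mulr1; have := phim x1; rewrite ler_norml => /andP[p1 p2].
    by move: p1 uxm q0 k10 A2m; lra.
  (* The alternative that remains gives |x| < rho - r, so the hyperplane is at distance at least
     [r], as the barrier estimate requires. *)
  have Lg : L (half_space_power a rho e) x r <= - kb.
    by apply: barrier => //; apply/andP; split; lra.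
  have Lq : L (fun y => capped_sqr (y - x1)) x r <= cq by apply: cqP; rewrite r0.
  have apsi : admissible psi.
    split.
      exists (m + 2 * k1 + A + B) => z; have /andP[g2 g3] := h01 z; have 
        /andP[q2 q3] := capped_sqr01 (z - x1).
      rewrite ler_norml; have := psi_ge z; rewrite /psi.
      have := phim x1; rewrite ler_norml => /andP[p1 p2].
      have : A * half_space_power a rho e z <= A * 1 by rewrite ler_wpM2l// ltW.
      have : B * capped_sqr (z - x1) <= B * 1 by rewrite ler_wpM2l// ltW.
      by move: p1 p2 k10 A0 B0; lra.
    move=> z; apply: measurable_funD.
      apply: measurable_funD; first exact: measurable_cst.
      by apply: measurable_funM; [exact: measurable_cst|exact: ah.2].
    by apply: measurable_funM; [exact: measurable_cst|exact: aq.2].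
  have Lpsi : L psi x r = A * L (half_space_power a rho e) x r
      + B * L (fun y => capped_sqr (y - x1)) x r.
    exact: (truncated_affine hs x A B (phi x1 + 2 * k1) ah aq r0).
  have Lu : L u x r <= L psi x r + c * La'.
    by apply: truncated_le => // t _; have := xP (x + row t); lra.
  have Gx : `|G x (u x)| <= m by apply: Gm; lra.
  move: hx Lu; rewrite Lpsi /residual; move: Gx; rewrite ler_norml => /andP[_].
  move: (G x (u x)) (L u x r) (L _ x r) (L _ x r) Lg Lq => g lu lq lg Lg Lq g1 h1 h2.
  have b1 : A * lg <= - (A * kb) by rewrite -mulrN ler_pM2l.
  have b2 : B * lq <= B * cq by rewrite ler_pM2l.
  have b3 : lu <= - ((2 + 2 * m) / C) by lra.
  have : C * lu <= - (2 + 2 * m).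
    by rewrite mulrC -ler_pdivlMr// mulNr.
  lra.
move=> x xsg.
have [xin|xout] := ltP (enorm x) rho; last first.
  case: (usub x) => [hx|[h _]]; first by move: hx rk k10; rewrite /k1; lra.
  lra.
have x0 : 0 < enorm x by lra.
have [e [e1 xe]] : exists e, enorm e = 1 /\ x = enorm x *: e.
  exists ((enorm x)^-1 *: x); rewrite enormZ ger0_norm ?invr_ge0 ?enorm_ge0//.
  by rewrite mulVf ?gt_eqF// scalerA divff ?gt_eqF// scale1r.
have := key e e1 x.
have edx : edot e x = enorm x by rewrite {1}xe edotZr -enorm_sqr e1 expr1n mulr1.
have dx : enorm (x - rho *: e) = rho - enorm x.
  by rewrite {1}xe -scalerBl enormZ e1 mulr1 ltr0_norm ?opprB//; lra.
have h1 : half_space_power a rho e x <= sg1 `^ a.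
  rewrite /half_space_power edx.
  have t0 : 0 <= rho - enorm x by lra.
  apply: (le_trans (ramp_power_le a0 t0)).
  by apply: ge0_ler_powR; rewrite ?nnegrE ?(ltW a0)//; lra.
have h2 : A * half_space_power a rho e x <= k1.
  by apply: le_trans sg1a; rewrite ler_pM2l.
have h3 : capped_sqr (x - rho *: e) <= sg.
  apply: (le_trans (capped_sqr_le _)); rewrite dx expr2.
  have t0 : 0 <= rho - enorm x <= sg by lra.
  move: (rho - enorm x) t0 sgE1 => t; nra.
have h4 := phil (rho *: e) x; rewrite enormBC dx ler_norml in h4.
have h5 : (B + lip) * sg <= k1 by rewrite mulrC -ler_pdivlMr.
have h6 : B * capped_sqr (x - rho *: e) <= B * sg by rewrite ler_pM2l.
have h7 : lip * (rho - enorm x) <= lip * sg by rewrite ler_pM2l//; lra.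
case/andP: h4 => _ h4.
move: h2 h4 h5 h6 h7; rewrite /k1.
by move: (A * _) (B * _) (lip * _) (phi _) (phi _) (u x) => ? ? ? ? ? ?; lra.
Qed.

Lemma boundary_bound phi G k : 0 < lip ->
  (forall x, `|phi x| <= m) -> (forall x y, `|phi x - phi y| <= lip * enorm (x - y)) ->
  (forall x a, enorm x < rho -> `|G x a| <= m) -> 0 < k ->
  exists sg r1 : R, [/\ 0 < sg, 0 < r1 & forall r u, 0 < r <= r1 ->
    approx_solution s C rho m phi G r u ->
    forall x, rho - sg <= enorm x -> `|u x - phi x| <= k].
Proof.
move=> lip0 phim phil Gm k0.
have [sg [r1 [sg0 r10 h]]] := boundary_upper_bound lip0 phim phil Gm k0.
have phim' x : `|(\- phi) x| <= m by rewrite normrN.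
have phil' x y : `|(\- phi) x - (\- phi) y| <= lip * enorm (x - y).
  by rewrite /= -opprD normrN.
have Gm' x a : enorm x < rho -> `|- G x (- a)| <= m by rewrite normrN; exact: Gm.
have [sg' [r1' [sg0' r10' h']]] := boundary_upper_bound lip0 phim' phil' Gm' k0.
exists (Num.min sg sg'), (Num.min r1 r1'); split; rewrite ?lt_min ?sg0 ?r10 ?sg0' ?r10'//.
move=> r u; rewrite le_min => /and3P[r0 rr1 rr1'] ua x.
have [a1 a2] : Num.min sg sg' <= sg /\ Num.min sg sg' <= sg'.
  by split; rewrite ge_min lexx ?orbT.
move=> xs; have hx : u x <= phi x + k by apply: (h r) => //; [rewrite r0|lra].
have hx' : - u x <= - phi x + k.
  apply: (h' r (\- u)); [by rewrite r0|exact: approx_solutionN|lra].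
by rewrite ler_norml; lra.
Qed.

End boundary.

(** * Passage to the limit *)

Lemma exists_powR_le {R : realType} (p k : R) : 0 < p -> 0 < k ->
  exists2 r0, 0 < r0 & forall r, 0 < r <= r0 -> r `^ p <= k.
Proof.
move=> p0 k0; exists (k `^ p^-1) => [|r /andP[r0 rk]]; first exact: powR_gt0.
have := @ge0_ler_powR R p (ltW p0) r (k `^ p^-1).
rewrite !nnegrE powR_ge0 (ltW r0) => /(_ isT isT rk).
by rewrite -powRrM mulVf ?gt_eqF// powRr1// ltW.
Qed.

Section limit.
Context {R : realType} (d : nat) (s C rho m lip : R).
Hypotheses (hs : 0 < s < 1) (C0 : 0 < C) (m0 : 0 < m) (rho0 : 0 < rho) (lip0 : 0 < lip).
Variables (phi : 'rV[R]_d -> R) (G : 'rV[R]_d -> R -> R).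
Hypotheses (phim : forall x, `|phi x| <= m)
  (phil : forall x y, `|phi x - phi y| <= lip * enorm (x - y)).
Hypothesis Gm : forall x a, enorm x < rho -> `|G x a| <= m.
Hypothesis Glip : forall x a b, enorm x < rho -> `|G x a - G x b| <= 2^-1 * `|a - b|.
Hypothesis Guc : interior_unif_cont rho G.
Implicit Types (u v : 'rV[R]_d -> R) (x y z : 'rV[R]_d).
Local Notation L := (frac_laplacian_truncated s).
Local Notation row := (@row_of_tuple R d).
Local Notation approx := (approx_solution s C rho m phi G).

Let phiuc : unif_cont phi.
Proof. exact: unif_cont_lipschitz phil. Qed.

Let approx_adm r u : approx r u -> admissible u.
Proof. by case=> uu um _ _ _; exact: admissible_cont (unif_cont_continuous uu) um. Qed.

(* Since [|x + z - y|^2 - |x - y|^2] is a paraboloid in [z], doubling variables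
   touches [u] from above at [x] and [v] from below at [y]; translating both
   variables compares the remaining parts of the operators. *)
Lemma truncated_doubling cn r r' D N c u v x y :
  near_constant d s cn ->
  admissible u -> admissible v -> 0 < r <= D -> 0 < r' <= D -> 0 <= N -> 0 <= c ->
  (forall x' y', u x' - v y' - N * enorm (x' - y') ^+ 2 <=
    u x - v y - N * enorm (x - y) ^+ 2 + c) ->
  L u x r - L v y r' <= 2 * (N * (cn * D `^ (2 - 2 * s)))
    + c * (Lam d s r + Lam d s r' + Lam d s D).
Proof.
move=> cnP au av /andP[r0 rD] /andP[r'0 r'D] N0 c0 uv.
have D0 : 0 < D := lt_le_trans r0 rD.
have h1 : L u x r <= L u x D + N * (cn * D `^ (2 - 2 * s)) + c * Lam d s r.
  apply: (truncated_touched_above hs cnP (p := (2 * N) *: (x - y))) => // z _.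
  have := uv (x + z) y; rewrite (addrAC x z (- y)) (enormD_sqr (x - y)) edotZl; lra.
have h2 : L (\- v) y r' <= L (\- v) y D + N * (cn * D `^ (2 - 2 * s)) + c * Lam d s r'.
  apply: (truncated_touched_above hs cnP (p := (- (2 * N)) *: (x - y))) => //;
    first exact: admissibleN.
  move=> z _ /=.
  have := uv x (y + z); rewrite opprD addrA (enormD_sqr (x - y)) edotZl edotNr enormN; lra.
have h3 : L u x D <= L v y D + c * Lam d s D.
  apply: truncated_le => // t _; have := uv (x + row t) (y + row t).
  rewrite (_ : x + row t - (y + row t) = x - y); last by rewrite opprD addrACA subrr addr0.
  lra.
move: h1 h2 h3; rewrite !truncatedN//.
by move: (L u x r) (L v y r') (L u x D) (L v y D) (Lam d s r) (Lam d s r') (Lam d s D) (N * _) =>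
  *; lra.
Qed.

(** At a near-maximum of u(x) - v(y) - N |x - y|^2 the points are within [th]. Near the sphere both
    functions are close to [phi], which is Lipschitz; inside, both equations hold, and their
    difference bounds half of u(x) - v(y) by small errors. Either way u(x) - v(y) > k/2 is
    impossible. *)
Lemma approx_modulus (k : R) : 0 < k -> exists N r0 : R, [/\ 0 < N, 0 < r0 &
  forall r r' u v, 0 < r <= r0 -> 0 < r' <= r0 -> approx r u -> approx r' v ->
  forall x y, u x - v y <= k + N * enorm (x - y) ^+ 2].
Proof.
move=> k0; have [cn cn0 cnP] := near_constant_exists d hs.
have k8 : 0 < k / 8 by rewrite divr_gt0.
have k16 : 0 < k / 16 by rewrite divr_gt0.
have [sg [r1 [sg0 r10 bdry]]] := boundary_bound hs C0 m0 rho0 lip0 phim phil Gm k8.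
have sg20 : 0 < sg / 2 by rewrite divr_gt0.
have [de de0 hde] := Guc sg20 k16.
pose th := Num.min (de / 2) (Num.min (sg / 2) (k / 8 / lip)).
have th0 : 0 < th by rewrite !lt_min !divr_gt0.
have [th1 th2 th3] : [/\ th <= de / 2, th <= sg / 2 & th <= k / 8 / lip].
  by split; rewrite /th !ge_min lexx ?orbT.
have lth : lip * th <= k / 8 by rewrite mulrC -ler_pdivlMr.
have ar1 a : rho - sg / 2 <= a -> rho - sg <= a by lra.
have ar2 a b : rho - sg / 2 <= a -> a - b <= th -> rho - sg <= b by lra.
have ar3 a : a < rho - sg / 2 -> a < rho by lra.
have ar4 (a b e f : R) : `|a - e| <= k / 8 -> `|b - f| <= k / 8 -> `|e - f| <= k / 8 ->
  k / 2 < a - b -> False by rewrite !ler_norml; lra.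
(* The difference of the two equations: half of a - b, more than k/4, would be at most 3 k/16, one
   k/16 each for the residuals, the operators and the variation of [G] in its first argument. *)
have ar5 (r r' a b a1 a2 a3 a4 a5 : R) : r <= k / 32 -> r' <= k / 32 ->
  `|a1 + a3 - a| <= r -> `|a2 + a5 - b| <= r' -> `|a4 - a5| <= k / 16 ->
  `|a3 - a4| <= 2^-1 * (a - b) -> a1 - a2 <= k / 32 + k / 32 -> k / 2 < a - b -> False.
  by rewrite !ler_norml; lra.
have ar6 a r : a < rho - sg / 2 -> r <= sg / 4 -> a <= rho - 2 * r by lra.
have ar7 a : a <= de / 2 -> a < de by lra.
(* As u - v never exceeds 2 m, this penalization keeps the points of a near-maximum within [th]. *)
pose N := 2 * m / th ^+ 2.
have N0 : 0 < N by rewrite divr_gt0 ?mulr_gt0// exprn_gt0.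
have p0 : 0 < 2 - 2 * s by case/andP: hs => _ s1; lra.
have CNc : 0 < C * (2 * (N * cn)) by rewrite mulr_gt0// mulr_gt0// mulr_gt0.
have kk : 0 < k / 32 / (C * (2 * (N * cn))) by rewrite !divr_gt0.
have [r2 r20 hr2] := exists_powR_le p0 kk.
pose r0 := Num.min (Num.min r1 r2) (Num.min (sg / 4) (k / 32)).
have r00 : 0 < r0 by rewrite !lt_min r10 r20 !divr_gt0.
have [q1 q2 q3 q4] : [/\ r0 <= r1, r0 <= r2, r0 <= sg / 4 & r0 <= k / 32].
  by split; rewrite /r0 !ge_min lexx ?orbT.
exists N, r0; split=> // r r' u v /andP[rp rr0] /andP[r'p r'r0] ua va x0 y0.
rewrite leNgt; apply/negP => contra.
have au := approx_adm ua; have av := approx_adm va.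
case: (ua) (va) => uu um _ _ ures [vv vm _ _ vres].
(* Beyond the larger radius the two operators are compared directly; below it the paraboloid costs N
   cn D^(2 - 2 s), small by the choice of [r0]. *)
pose D := Num.max r r'.
have rD : r <= D by rewrite le_max lexx.
have r'D : r' <= D by rewrite le_max lexx orbT.
have Dr0 : D <= r0 by rewrite ge_max rr0.
have D0 : 0 < D := lt_le_trans rp rD.
set La := Lam d s r + Lam d s r' + Lam d s D.
have La0 : 0 <= La by rewrite !addr_ge0// Lam_ge0.
have CLa0 : 0 <= C * La by rewrite mulr_ge0// ltW.
(* [La] depends on the radii, and so does [c]; [N] and [r0] were fixed before. *)
pose c := Num.min (k / 2) (k / 32 / (C * La + 1)).
have CL1 : 0 < C * La + 1 by rewrite ltr_wpDl.
have c0 : 0 < c by rewrite lt_min !divr_gt0.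
have [ck cL] : c <= k / 2 /\ C * (c * La) <= k / 32.
  split; first by rewrite /c ge_min lexx.
  have : c <= k / 32 / (C * La + 1) by rewrite /c ge_min lexx orbT.
  rewrite ler_pdivlMr// mulrDr mulr1 (mulrCA c); lra.
pose F (xy : 'rV[R]_d * 'rV[R]_d) := u xy.1 - v xy.2 - N * enorm (xy.1 - xy.2) ^+ 2.
have F_le xy : F xy <= 2 * m.
  have : 0 <= N * enorm (xy.1 - xy.2) ^+ 2 by rewrite mulr_ge0 ?sqr_ge0// ltW.
  have := um xy.1; have := vm xy.2; rewrite /F !ler_norml => /andP[a1 a2] /andP[b1 b2] h.
  by move: a1 b2 h; move: (u _) (v _) (N * _) => *; lra.
have [[x y] xyP] := exists_near_max (x0, y0) F_le c0.
have Fxy : k / 2 < F (x, y).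
  by have := xyP (x0, y0); move: contra; rewrite {1}/F /=; move: (N * _) (F _) => *; lra.
have N1 : 0 <= N * enorm (x - y) ^+ 2 by rewrite mulr_ge0 ?sqr_ge0// ltW.
have uvk : k / 2 < u x - v y by move: Fxy; rewrite /F/=; lra.
have um' := um x; have vm' := vm y.
have xyth : enorm (x - y) <= th.
  rewrite -ler_sqr ?nnegrE ?enorm_ge0 ?(ltW th0)// -(ler_pM2l N0).
  rewrite {2}/N divfK ?expf_neq0 ?gt_eqF//.
  by move: um' vm' Fxy; rewrite /F/= !ler_norml; lra.
have exy := le_trans (enorm_sub x y) xyth.
have exy2 : enorm x - enorm y <= th := le_trans (ler_norm _) exy.
have exy1 : enorm y - enorm x <= th by apply: le_trans exy; rewrite distrC ler_norm.
have near_bdry : rho - sg <= enorm x -> rho - sg <= enorm y -> False.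
  move=> xout yout.
  have h1 : `|u x - phi x| <= k / 8 by apply: (bdry r); rewrite ?rp ?(le_trans rr0).
  have h2 : `|v y - phi y| <= k / 8 by apply: (bdry r'); rewrite ?r'p ?(le_trans r'r0).
  apply: (ar4 _ _ _ _ h1 h2 _ uvk); apply: (le_trans (phil x y)).
  by apply: le_trans lth; rewrite ler_pM2l.
have [xout|xin] := leP (rho - sg / 2) (enorm x).
  exact: (near_bdry (ar1 _ xout) (ar2 _ _ xout exy2)).
have [yout|yin] := leP (rho - sg / 2) (enorm y).
  exact: (near_bdry (ar2 _ _ yout exy1) (ar1 _ yout)).
have h1 : `|residual s C G r u x| <= r by apply/ures/(ar6 _ _ xin)/(le_trans rr0).
have h2 : `|residual s C G r' v y| <= r' by apply/vres/(ar6 _ _ yin)/(le_trans r'r0).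
have h3 : `|G x (v y) - G y (v y)| <= k / 16.
  by apply: hde; [exact: ltW|exact: ltW|apply/ar7/(le_trans xyth)].
have xB : enorm x < rho := ar3 _ xin.
have h4 := Glip (u x) (v y) xB.
rewrite [`|u x - v y|]gtr0_norm in h4; last by apply: lt_trans uvk; rewrite divr_gt0.
have uvN x' y' : u x' - v y' - N * enorm (x' - y') ^+ 2 <= u x - v y - N * enorm (x - y) ^+ 2 + c.
  exact: (xyP (x', y')).
have rD' : 0 < r <= D by rewrite rp.
have r'D' : 0 < r' <= D by rewrite r'p.
have h5 := truncated_doubling cnP au av rD' r'D' (ltW N0) (ltW c0) uvN.
rewrite -/La in h5.
have h6 : C * (2 * (N * (cn * D `^ (2 - 2 * s)))) <= k / 32.
  rewrite (_ : C * _ = D `^ (2 - 2 * s) * (C * (2 * (N * cn)))); last by ring.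
  by rewrite -ler_pdivlMr//; apply: hr2; rewrite D0 (le_trans Dr0).
have h7 : C * (L u x r - L v y r') <= k / 32 + k / 32.
  apply: (@le_trans _ _ (C * (2 * (N * (cn * D `^ (2 - 2 * s))) + c * La))).
    by rewrite ler_pM2l.
  by rewrite mulrDr lerD.
rewrite mulrBr in h7; rewrite /residual in h1 h2.
exact: (ar5 _ _ _ _ _ _ _ _ _ (le_trans rr0 q4) (le_trans r'r0 q4) h1 h2 h3 h4 h7 uvk).
Qed.

Lemma limit_exists : exists u, [/\ unif_cont u, forall x, `|u x| <= m,
  forall x, rho <= enorm x -> u x = phi x &
  forall k r0 : R, 0 < k -> 0 < r0 -> exists r w, [/\ 0 < r <= r0, approx r w &
    forall x, `|w x - u x| <= k]].
Proof.
pose e n : R := n.+1%:R^-1.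
have e0 n : 0 < e n by rewrite invr_gt0.
have small r0 : 0 < r0 -> exists n0, forall n, (n0 <= n)%N -> 0 < e n <= r0.
  move=> r00; exists (Num.truncn r0^-1) => n nn; rewrite e0/= invf_ple ?posrE//.
  rewrite (le_trans (ltW (truncnS_gt _)))// ler_nat//.
have [w wP] : exists w : nat -> 'rV[R]_d -> R, forall n, approx (e n) (w n).
  have h n : {u | approx (e n) u}.
    by apply/cid/approx_solution_exists.
  by exists (fun n => sval (h n)) => n; exact: svalP (h n).
have cauchyw k : 0 < k -> exists n0, forall n n' x, (n0 <= n)%N ->
  (n0 <= n')%N -> `|w n x - w n' x| <= k.
  move=> /approx_modulus[N [r0 [N0 r00 h]]]; have [n0 hn0] := small _ r00.
  exists n0 => n n' x nn nn'.
  have h1 := h _ _ _ _ (hn0 _ nn) (hn0 _ nn') (wP n) (wP n') x x.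
  have h2 := h _ _ _ _ (hn0 _ nn') (hn0 _ nn) (wP n') (wP n) x x.
  by rewrite subrr enorm0 expr0n mulr0 addr0 in h1 h2; rewrite ler_norml; lra.
have cw x : cvgn (fun n => w n x).
  apply: cauchy_cvg; apply: cauchy_exP => k k0.
  have [n0 hn0] := cauchyw _ (divr_gt0 k0 (ltr0Sn _ 1)).
  exists (w n0 x); exists n0 => // n /= nn; rewrite /ball/=.
  by apply: (le_lt_trans (hn0 n0 n x (leqnn _) nn)); lra.
pose u x := limn (fun n => w n x).
have uw k : 0 < k -> exists n0, forall n x, (n0 <= n)%N -> `|w n x - u x| <= k.
  move=> k0; have k20 : 0 < k / 2 by rewrite divr_gt0.
  have [n0 hn0] := cauchyw _ k20; exists n0 => n x nn.
  have /cvgrPdist_le /(_ _ k20)[n1 _ hn1] := cw x.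
  have := hn1 (maxn n0 n1) (leq_maxr _ _); have := hn0 n (maxn n0 n1) x nn (leq_maxl _ _).
  by rewrite /= -/(u x) !ler_norml; lra.
exists u; split.
- apply: unif_contP => k k0; have k4 : 0 < k / 4 by rewrite divr_gt0.
  have [N [r0 [N0 r00 h]]] := approx_modulus k4.
  have [n0 hn0] := small _ r00; have [n1 hn1] := uw _ k4.
  pose n := maxn n0 n1; have en := hn0 n (leq_maxl _ _).
  exists (Num.min 1 (k / 4 / N)) => [|x y]; first by rewrite lt_min ltr01 !divr_gt0.
  rewrite lt_min => /andP[xy1 xy2].
  have h1 := h _ _ _ _ en en (wP n) (wP n) x y.
  have h2 := hn1 n x (leq_maxr _ _); have h3 := hn1 n y (leq_maxr _ _).
  have h4 : N * enorm (x - y) ^+ 2 <= k / 4.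
    rewrite -(mulrC (_ ^+ 2)) -ler_pdivlMr//; apply: le_trans (ltW xy2).
    by rewrite expr2 ler_piMr ?enorm_ge0// ltW.
  by move: h2 h3; rewrite !ler_norml; lra.
- move=> x; apply/ler_addgt0Pr => k k0; have [n0 hn0] := uw _ k0.
  have [_ wm _ _ _] := wP n0; have := wm x; have := hn0 n0 x (leqnn _).
  by rewrite !ler_norml; lra.
- move=> x xout; apply/eqP; rewrite -subr_eq0 -normr_le0.
  apply/ler_addgt0Pr => k k0; rewrite add0r.
  have k20 : 0 < k / 2 by rewrite divr_gt0.
  have [n0 hn0] := uw _ k20; have [n1 hn1] := small _ k20.
  pose n := maxn n0 n1; have /andP[en1 en2] := hn1 n (leq_maxr _ _).
  have h := hn0 n x (leq_maxl _ _).
  have [_ _ wsub wsup _] := wP n.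
  (* Outside the ball the second alternative is void, so the approximate solution is within its
     radius of [phi]. *)
  have h1 : w n x <= phi x + e n by case: (wsub x) => // -[xin _]; lra.
  have h2 : phi x - e n <= w n x by case: (wsup x) => // -[xin _]; lra.
  by move: h; rewrite !ler_norml; lra.
- move=> k r0 k0 r00; have [n0 hn0] := uw _ k0; have [n1 hn1] := small _ r00.
  exists (e (maxn n0 n1)), (w (maxn n0 n1)); split=> //.
    exact: hn1 (leq_maxr _ _).
  by move=> x; apply: hn0; exact: leq_maxl.
Qed.

End limit.

(** * Paraboloids touching the limit from above *)

Section viscosity_core.
Context {R : realType} (d : nat) (s C rho m : R).
Hypotheses (hs : 0 < s < 1) (C0 : 0 < C).
Implicit Types (u v phi : 'rV[R]_d -> R) (x y z : 'rV[R]_d) (G : 'rV[R]_d -> R -> R).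
Local Notation L := (frac_laplacian_truncated s).
Local Notation row := (@row_of_tuple R d).

Definition limit_of_approx phi G u := forall k r0 : R, 0 < k -> 0 < r0 ->
  exists r w, [/\ 0 < r <= r0, approx_solution s C rho m phi G r w & forall x, `|w x - u x| <= k].

(** Steepening the paraboloid from [M] to [M + 1] makes the contact strict, so an approximate
    solution [w] has its near-contact point x within [th] of [x0]. There the paraboloid bounds the
    part of L w between [r] and [D] independently of [r], and beyond [D] uniform continuity replaces
    [w] at x by [u] at [x0]. Touching is assumed on the radius 2 D so that the ball of radius [D]
    around x is covered. *)
Lemma touched_above_ineq phi G u cn x0 p M D :
  near_constant d s cn ->
  (forall x a b, enorm x < rho -> `|G x a - G x b| <= 2^-1 * `|a - b|) ->
  interior_unif_cont rho G ->
  limit_of_approx phi G u -> unif_cont u -> (forall x, `|u x| <= m) ->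
  enorm x0 < rho -> 0 <= M -> 0 < D ->
  (forall z, enorm z < 2 * D -> u (x0 + z) <= u x0 + edot p z + M * enorm z ^+ 2) ->
  0 <= C * (L u x0 D + (M + 1) * (cn * D `^ (2 - 2 * s))) + G x0 (u x0) - u x0.
Proof.
move=> cnP Glip Guc ulim uu um x0B M0 D0 up.
have au : admissible u by exact: admissible_cont (unif_cont_continuous uu) um.
apply/ler_addgt0Pr => k k0.
have LD0 := Lam_ge0 d s D; set LD := Lam d s D in LD0.
have k8 : 0 < k / 8 by rewrite divr_gt0.
have [sg sg0 sgE] : exists2 sg, 0 < sg & sg = (rho - enorm x0) / 2.
  by exists ((rho - enorm x0) / 2) => //; rewrite divr_gt0// subr_gt0.
have CL2 : 0 < 4 * C * LD + 2 by rewrite ltr_wpDl// !mulr_ge0// ltW.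
pose k1 := k / 8 / (4 * C * LD + 2); have k10 : 0 < k1 by rewrite divr_gt0.
have k1E : 4 * (C * LD * k1) + 2 * k1 = k / 8 by rewrite /k1; field; rewrite gt_eqF.
have CLk : 0 <= C * LD * k1 by rewrite mulr_ge0 ?(ltW k10)// mulr_ge0// ltW.
have [e1 e10 he1] := uu _ k10.
have [e2 e20 he2] := Guc _ _ sg0 k8.
pose th := Num.min (Num.min D (sg / 2)) (Num.min (e1 / 2) (e2 / 2)).
have th0 : 0 < th by rewrite !lt_min D0 !divr_gt0.
have [th1 th2 th3 th4] : [/\ th <= D, th <= sg / 2, th <= e1 / 2 & th <= e2 / 2].
  by split; rewrite /th !ge_min lexx ?orbT.
have th20 : 0 < th ^+ 2 by rewrite exprn_gt0.
pose kw := Num.min k1 (th ^+ 2 / 4); have kw0 : 0 < kw by rewrite lt_min k10 divr_gt0.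
have [kw1 kw2] : kw <= k1 /\ kw <= th ^+ 2 / 4 by split; rewrite /kw ge_min lexx ?orbT.
pose r0 := Num.min D (Num.min (sg / 4) (k / 8)).
have r00 : 0 < r0 by rewrite !lt_min D0 !divr_gt0.
have [r0D r0s r0k] : [/\ r0 <= D, r0 <= sg / 4 & r0 <= k / 8].
  by split; rewrite /r0 !ge_min lexx ?orbT.
have arith (r Lrw LDw LDu P c La a b g g1 g0 : R) : r <= k / 8 ->
  - r <= C * Lrw + g - a -> Lrw <= LDw + P + c * La -> C * (c * La) <= k / 8 ->
  LDw <= LDu + (2 * k1 + 2 * kw) * LD -> `|a - b| <= k1 + kw -> `|g - g1| <= 2^-1 * `|a - b| ->
  `|g1 - g0| <= k / 8 -> 0 <= C * (LDu + P) + g0 - b + k.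
  move=> rk h1 h2 h3 h4 h5 h6 h7.
  have C1 : C * Lrw <= C * (LDu + P) + C * ((2 * k1 + 2 * kw) * LD) + C * (c * La).
    by rewrite -!mulrDr ler_pM2l//; lra.
  have C2 : C * ((2 * k1 + 2 * kw) * LD) <= 4 * (C * LD * k1).
    rewrite (_ : 4 * _ = C * (4 * k1 * LD)); last by ring.
    by rewrite ler_pM2l// ler_wpM2r//; lra.
  have := le_trans h6 (ler_wpM2l _ h5); rewrite invr_ge0 ler0n => /(_ isT) h6'.
  move: h5 h6' h7; rewrite !ler_norml => /andP[h5 h5'] /andP[h6l h6r] /andP[h7 h7'].
  move: (C * (LDu + P)) (C * Lrw) (C * (c * La)) (C * ((2 * k1 + 2 * kw) * LD)) C1 C2 h1 h3 =>
    T1 T2 T3 T4 C1 C2 h1 h3.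
  lra.
have ar2 (r a b : R) : r <= r0 -> a <= b + th -> b = enorm x0 -> a <= rho - 2 * r.
  by move: sgE; lra.
have ar3 (a b : R) : a <= b + th -> b = enorm x0 -> a <= rho - sg.
  by move: sgE; lra.
have ar4 (a : R) : a <= th -> a < e1 by lra.
have ar5 (a : R) : a <= th -> a < e2 by lra.
have ar6 (a : R) : a <= rho - sg -> a < rho by lra.
have x0s : enorm x0 <= rho - sg by rewrite sgE; lra.
(* Comparing the near-contact point with [x0]: the added square is at most 2 kw + c, and kw <= th^2
   / 4, c <= th^2 / 2. *)
have ar7 (wx wx0 ux ux0 P e c : R) : `|wx - ux| <= kw -> `|wx0 - ux0| <= kw ->
  c <= th ^+ 2 / 2 -> ux <= ux0 + P + M * e -> wx0 <= wx - (P + (M + 1) * e) + c -> e <= th ^+ 2.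
  by rewrite !ler_norml; lra.
have ar8 (wx wz Px Pz pz ez e c q : R) : wz - Pz <= wx - Px + c ->
  Pz = Px + pz + (M + 1) * (2 * ez + e) -> q = pz + 2 * (M + 1) * ez ->
  wz - wx <= q + (M + 1) * e + c.
  by move=> h1 h2 h3; move: h1; rewrite h2 h3; lra.
have [r [w [/andP[rp rr0] wa wu]]] := ulim _ _ kw0 r00.
have [uw wm _ _ wres] := wa.
have aw : admissible w by exact: admissible_cont (unif_cont_continuous uw) wm.
have La0 := Lam_ge0 d s r; set La := Lam d s r in La0.
have CL1 : 0 < C * La + 1 by rewrite ltr_wpDl// mulr_ge0// ltW.
pose c := Num.min (th ^+ 2 / 2) (k / 8 / (C * La + 1)).
have c0 : 0 < c by rewrite lt_min !divr_gt0.
have c1 : c <= th ^+ 2 / 2 by rewrite /c ge_min lexx.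
have c2 : C * (c * La) <= k / 8.
  have : c <= k / 8 / (C * La + 1) by rewrite /c ge_min lexx orbT.
  by rewrite ler_pdivlMr// mulrDr mulr1 (mulrCA c) => /(le_trans _); apply; rewrite lerDl ltW.
pose P x := edot p (x - x0) + (M + 1) * enorm (x - x0) ^+ 2.
(* The contact is only local, so the near-maximum is sought over a ball, encoded as a subtype. *)
pose B := {x : 'rV[R]_d | enorm (x - x0) < 2 * D}.
have x0in : enorm (x0 - x0) < 2 * D by rewrite subrr enorm0 mulr_gt0.
have [Fb FbP] : exists b, forall x : B, w (val x) - P (val x) <= b.
  exists (m + enorm p * (2 * D)) => -[x xD] /=.
  have h1 := normr_edot_le p (x - x0).
  have h2 : enorm p * enorm (x - x0) <= enorm p * (2 * D) by rewrite ler_wpM2l ?enorm_ge0// ltW.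
  have h3 : 0 <= (M + 1) * enorm (x - x0) ^+ 2 by rewrite mulr_ge0 ?sqr_ge0// addr_ge0.
  have := wm x; rewrite /P; move: h1; rewrite !ler_norml => /andP[h1 _] /andP[_ h4].
  by move: (w x) (edot _ _) (enorm p * _) (enorm p * _) ((M + 1) * _) h1 h2 h3 h4 => *; lra.
have [[x xD] xP] := exists_near_max (exist _ x0 x0in : B) FbP c0.
have {}xP y : enorm (y - x0) < 2 * D -> w y - P y <= w x - P x + c.
  by move=> yD; exact: (xP (exist _ y yD)).
have xth : enorm (x - x0) <= th.
  rewrite -ler_sqr ?nnegrE ?enorm_ge0 ?(ltW th0)//.
  have h1 := up _ xD; rewrite addrC subrK in h1.
  have h2 := xP x0 x0in; rewrite /P subrr edot0r enorm0 expr0n/= mulr0 addr0 subr0 in h2.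
  exact: (ar7 _ _ _ _ _ _ _ (wu x) (wu x0) c1 h1 h2).
have xx0 : enorm x <= enorm x0 + th.
  by rewrite -lerBlDl; apply: le_trans xth; apply: le_trans (enorm_sub x x0); rewrite ler_norm.
have h1 : - r <= C * L w x r + G x (w x) - w x.
  have := wres x (ar2 _ _ _ rr0 xx0 erefl).
  by rewrite ler_norml => /andP[].
have rD : r <= D := le_trans rr0 r0D.
have h2 : L w x r <= L w x D + (M + 1) * (cn * D `^ (2 - 2 * s)) + c * La.
  apply: (truncated_touched_above hs cnP (p := p + (2 * (M + 1)) *: (x - x0))) => //.
  - by rewrite addr_ge0.
  - exact: ltW.
  move=> z zD; have zD2 : enorm (x + z - x0) < 2 * D.
    rewrite addrAC mulr_natl mulr2n; apply: (le_lt_trans (enormD _ _)).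
    by rewrite ler_ltD// (le_trans xth).
  have PD : P (x + z) = P x + edot p z + (M + 1) * (2 * edot (x - x0) z + enorm z ^+ 2).
    by rewrite /P (addrAC x z (- x0)) (edotDr p (x - x0) z) (enormD_sqr (x - x0) z); ring.
  have pz : edot (p + (2 * (M + 1)) *: (x - x0)) z = edot p z + 2 * (M + 1) * edot (x - x0) z.
    by rewrite edotC edotDr edotZr !(edotC z).
  exact: (ar8 _ _ _ _ _ _ _ _ _ (xP _ zD2) PD pz).
have h4 : L w x D <= L u x0 D + (2 * k1 + 2 * kw) * LD.
  apply: truncated_le => // t _.
  have a1 := wu (x + row t); have a2 := wu x.
  have xt : enorm (x + row t - (x0 + row t)) < e1.
    by rewrite opprD addrACA subrr addr0; exact: ar4.
  have a3 := he1 _ _ xt; have a4 := he1 _ _ (ar4 _ xth).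
  move: a1 a2 a3 a4; rewrite !ler_norml => /andP[_ a1] /andP[a2 _] /andP[_ a3] /andP[a4 _].
  by move: (w _) (w _) (u _) (u _) (u _) (u _) a1 a2 a3 a4 => *; lra.
have h5 : `|w x - u x0| <= k1 + kw.
  rewrite (_ : w x - u x0 = (u x - u x0) + (w x - u x)); last by ring.
  by rewrite (le_trans (ler_normD _ _))// lerD// he1// ar4.
have xs := ar3 _ _ xx0 erefl.
have h6 := Glip x (w x) (u x0) (ar6 _ xs).
have h7 := he2 _ _ xs x0s (ar5 _ xth) (u x0).
apply: (arith _ _ _ _ _ _ _ _ _ _ _ _ (le_trans rr0 r0k) h1 h2 c2 h4 h5 h6 h7).
Qed.

End viscosity_core.

(** * Test functions *)

Section taylor.
Context {R : realType} (d : nat).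
Implicit Types (g xi : 'rV[R]_d -> R) (x y z : 'rV[R]_d).
Local Notation dl i := (delta_mx 0 i : 'rV[R]_d).

Lemma line_mvt g y (v : 'rV[R]_d) (h c b : R) :
  (forall t : R, `|t| <= `|h| -> derivable g (t *: v + y) v /\ `|'D_v g (t *: v + y) - c| <= b) ->
  `|g (h *: v + y) - g y - c * h| <= b * `|h|.
Proof.
move=> gd; pose f (t : R) := g (t *: v + y).
have fE t : (fun k : R => k^-1 *: ((f \o shift t) (k *: 1) - f t)) =
    (fun k : R => k^-1 *: ((g \o shift (t *: v + y)) (k *: v) - g (t *: v + y))).
  by apply/funext => k; rewrite /f/= [k *: 1]mulr1 scalerDl addrA.
have df (t : R) : `|t| <= `|h| -> is_derive t 1 f ('D_v g (t *: v + y)).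
  move=> th; have [gt _] := gd _ th.
  by apply: DeriveDef; [rewrite /derivable fE|rewrite /derive fE].
have mvt (a e : R) : a <= e -> (forall t : R, a <= t <= e -> `|t| <= `|h|) ->
    `|f e - f a - c * (e - a)| <= b * (e - a).
  move=> ae ht; have [||t] := @MVT_segment R f (fun t => 'D_v g (t *: v + y)) a e ae.
  - by move=> t; rewrite in_itv/= => /andP[t1 t2]; apply/df/ht; rewrite !ltW.
  - apply: derivable_within_continuous => t; rewrite in_itv/= => tae.
    by have [] := df t (ht _ tae).
  rewrite in_itv/= => tae ->; rewrite -mulrBl normrM [`|e - a|]ger0_norm ?subr_ge0//.
  by rewrite ler_wpM2r ?subr_ge0//; have [] := gd t (ht _ tae).
have f0 : f 0 = g y by rewrite /f scale0r add0r.
have [h0|h0] := leP 0 h.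
  have := mvt 0 h h0; rewrite f0 subr0 (ger0_norm h0); apply=> t /andP[t0 t1].
  by rewrite ger0_norm.
have := mvt h 0 (ltW h0); rewrite f0 sub0r (ltr0_norm h0) => H.
have -> : g (h *: v + y) - g y - c * h = - (g y - f h - c * - h) by rewrite /f; ring.
by rewrite normrN; apply: H => t /andP[t0 t1]; rewrite ler0_norm// lerN2.
Qed.

(* The increment of [g] is split along the coordinate axes. *)
Lemma coordinate_mvt g x0 z (p : 'rV[R]_d) (b : R) :
  (forall y, (forall i, `|y 0 i - x0 0 i| <= `|z 0 i|) ->
    forall j, derivable g y (dl j) /\ `|'D_(dl j) g y - p 0 j| <= b) ->
  `|g (x0 + z) - g x0 - edot p z| <= b * \sum_j `|z 0 j|.
Proof.
move=> gd; pose y k := x0 + \row_i (if (i < k)%N then z 0 i else 0).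
have y0 : y 0%N = x0 by apply/rowP => i; rewrite !mxE addr0.
have yd : y d = x0 + z by apply/rowP => i; rewrite !mxE ltn_ord.
have ys (i : 'I_d) : y i.+1 = z 0 i *: dl i + y i.
  apply/rowP => j; rewrite !mxE eqxx/=; have [->|ij] := eqVneq j i.
    by rewrite ltnS leqnn ltnn mulr1 addr0 addrC.
  have -> : (j < i.+1)%N = (j < i)%N by rewrite ltnS leq_eqVlt val_eqE (negbTE ij).
  by rewrite mulr0 add0r.
have E : g (x0 + z) - g x0 - edot p z = \sum_(i < d) (g (y i.+1) - g (y i) - p 0 i * z 0 i).
  rewrite sumrB; congr (_ - _).
  by rewrite -(big_mkord xpredT (fun i => g (y i.+1) - g (y i))) telescope_sumr// yd y0.
rewrite E mulr_sumr; apply: (le_trans (ler_norm_sum _ _ _)).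
apply: ler_sum => i _; rewrite ys; apply: line_mvt => t tz; apply: gd => j.
rewrite !mxE eqxx/=.
have [->|ij] := eqVneq j i.
  by rewrite ltnn addr0 mulr1 addrK.
rewrite mulr0 add0r; case: ifP => _; first by rewrite addrAC subrr add0r.
by rewrite addr0 subrr normr0.
Qed.

Lemma sum_coord_le z : \sum_j `|z 0 j| <= d%:R * enorm z.
Proof.
apply: (@le_trans _ _ (\sum_(j < d) enorm z)); first by apply: ler_sum => j _;
  exact: coord_le_enorm.
by rewrite sumr_const card_ord mulr_natl.
Qed.

Lemma enorm_le_of_coord (x z : 'rV[R]_d) : (forall i, `|x 0 i| <= `|z 0 i|) -> enorm x <= enorm z.
Proof.
move=> xz; apply: ler_wsqrtr; apply: ler_sum => i _.
by rewrite -[leLHS]real_normK ?num_real// -[leRHS]real_normK ?num_real// ler_sqr ?nnegrE.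
Qed.

Lemma within_closure_continuous (U : set 'rV[R]_d) g : open U ->
  {within closure U, continuous g} -> forall x, U x -> {for x, continuous g}.
Proof.
move=> oU /(continuous_subspaceW (@subset_closure _ U)) cg x Ux.
by move: cg; rewrite continuous_open_subspace// => /(_ x); apply; rewrite inE.
Qed.

(** Only a bound [B] on the second partial derivatives near [x0] is used: one mean value estimate
    makes the gradient Lipschitz at [x0], a second one makes the remainder of [xi] quadratic. The 1
    added in [B] leaves room for the continuity of these derivatives. *)
Lemma C2_paraboloid (U : set 'rV[R]_d) xi x0 : open U -> U x0 -> C2_closure U xi ->
  exists p M e, [/\ 0 <= M, 0 < e & forall z, enorm z < e ->
    U (x0 + z) /\ `|xi (x0 + z) - xi x0 - edot p z| <= M * enorm z ^+ 2].
Proof.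
move=> oU Ux0 [_ d1 d2].
pose h i j := partial j (partial i xi) x0.
pose B := \sum_(ij : 'I_d * 'I_d) (`|h ij.1 ij.2| + 1).
have B0 : 0 <= B by apply: sumr_ge0 => ij _; rewrite addr_ge0.
have hB i j : `|h i j| + 1 <= B.
  rewrite /B (bigD1 (i, j))//= lerDl; apply: sumr_ge0 => ij _.
  by rewrite addr_ge0.
have nB (ij : 'I_d * 'I_d) : \forall y \near x0, `|partial ij.2 (partial ij.1 xi) y| <= B.
  case: ij => i j /=.
  have [_ [g cg gE]] := d2 i j.
  have cgx := within_closure_continuous oU cg Ux0.
  have U0 : nbhs x0 U by exact: open_nbhs_nbhs.
  have /cvgrPdist_lt /(_ _ ltr01) gn : g y @[y --> x0] --> g x0 by exact: cgx.
  near=> y.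
  have Uy : U y by near: y.
  have gy : `|g x0 - g y| < 1 by near: y.
  rewrite gE//; apply: le_trans (hB i j); rewrite /h gE//.
  rewrite -[g y](subrK (g x0)) addrC (le_trans (ler_normD _ _))// lerD2l distrC.
  exact: ltW.
have near2 : \forall y \near x0, U y /\ forall ij : 'I_d * 'I_d,
    `|partial ij.2 (partial ij.1 xi) y| <= B.
  have nU : nbhs x0 U by exact: open_nbhs_nbhs.
  exact: filterI nU (filter_forall _ nB).
have /nbhs_enormP[e e0 he] := near2.
have dB (i : 'I_d) z : enorm z < e -> `|partial i xi (x0 + z) - partial i xi x0| <=
  B * (d%:R * enorm z).
  move=> ze; have := @coordinate_mvt (partial i xi) x0 z 0 B.
  rewrite edotC edot0r subr0 => H.
  apply: (le_trans (H _)) => [y yz j|]; last by rewrite ler_wpM2l// sum_coord_le.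
  have ye : enorm (y - x0) < e.
    by apply: le_lt_trans ze; apply: enorm_le_of_coord => k; have := yz k; rewrite !mxE.
  have [Uy hy] := he _ ye; have [pd _] := d2 i j.
  by split; [exact: pd|rewrite mxE subr0; exact: (hy (i, j))].
pose p : 'rV[R]_d := \row_i partial i xi x0.
exists p, (B * d%:R ^+ 2), e; split=> //; first by rewrite mulr_ge0// sqr_ge0.
move=> z ze; have xz : enorm (x0 + z - x0) < e by rewrite (addrC x0) addrK.
split; first by have [] := he _ xz.
have b0 : 0 <= B * (d%:R * enorm z) by rewrite mulr_ge0// mulr_ge0 ?enorm_ge0.
have := @coordinate_mvt xi x0 z p (B * (d%:R * enorm z)) => H.
apply: (le_trans (H _)) => [y yz j|].
  have ye : enorm (y - x0) <= enorm z.
    by apply: enorm_le_of_coord => k; have := yz k; rewrite !mxE.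
  have [Uy _] := he _ (le_lt_trans ye ze); have [pd _] := d1 j.
  split; first exact: pd.
  rewrite mxE; have := dB j (y - x0) (le_lt_trans ye ze).
  rewrite (addrC x0) subrK => /le_trans; apply.
  by rewrite ler_wpM2l// ler_wpM2l.
rewrite (_ : B * d%:R ^+ 2 * enorm z ^+ 2 = B * (d%:R * enorm z) * (d%:R * enorm z)); last by ring.
by rewrite ler_wpM2l// sum_coord_le.
Unshelve. all: by end_near.
Qed.

End taylor.

Section test_functions.
Context {R : realType} (d : nat) (s : R).
Hypothesis hs : 0 < s < 1.
Implicit Types (u v w : 'rV[R]_d -> R) (x y z : 'rV[R]_d).
Local Notation L := (frac_laplacian_truncated s).
Local Notation row := (@row_of_tuple R d).
Local Notation RT := (measurableTypeR R).

Lemma admissible_patch u (U : set 'rV[R]_d) (xi : 'rV[R]_d -> R) : admissible u ->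
  open U -> (exists M, forall x, U x -> `|xi x| <= M) ->
  (forall x, U x -> {for x, continuous xi}) -> admissible (patch u U xi).
Proof.
move=> [[M uM] mu'] oU [M' xiM] cxi; split.
  exists (Num.max M M') => x; rewrite /patch; case: ifPn => [/set_mem xU|_].
    by rewrite le_max xiM ?orbT.
  by rewrite le_max uM.
move=> x _ B mB; rewrite setTI.
pose V : set 'rV[R]_d := [set z | U (x + z)].
have cx z : {for z, continuous (fun z => x + z)} by exact: (cvgD (cvg_cst _) cvg_id).
have oV : open V by apply: (@open_comp _ _ (fun z => x + z) U) => // z _; exact: cx.
have m1 : measurable_fun (row @^-1` V) ((fun z => xi (x + z)) \o row : _ -> RT).
  apply: measurable_fun_row => // z Vz.
  apply: (@continuous_comp _ _ _ (fun z => x + z) xi z); first exact: cx.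
  exact: cxi.
have mV : measurable (row @^-1` V) by exact: measurable_row_open.
rewrite [X in measurable X](_ : _ = (row @^-1` V `&` ((fun z => xi (x + z)) \o row) @^-1` B) `|`
    (~` (row @^-1` V) `&` (fun t => u (x + row t)) @^-1` B)).
  apply: measurableU; first exact: m1.
  apply: measurableI; first exact: measurableC.
  by rewrite -[X in measurable X]setTI; exact: mu'.
apply/seteqP; split=> t /=; rewrite /patch /V/=.
  by case: ifPn => [/set_mem h|/negP h] Bt; [left|right; split=> // /mem_set].
by move=> [[h Bt]|[h Bt]]; [rewrite mem_set|rewrite memNset].
Qed.

(** Both [w] and its opposite are touched from above by paraboloids, so two truncations with radii
    at most D differ from each other by an amount of order D^(2 - 2 s): the Cauchy criterion, with a
    rate inherited by the limit. *)
Lemma paraboloid_limit cn w x0 p M e :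
  near_constant d s cn ->
  admissible w -> 0 <= M -> 0 < e -> 0 <= cn ->
  (forall z, enorm z < e -> `|w (x0 + z) - w x0 - edot p z| <= M * enorm z ^+ 2) ->
  cvg (L w x0 r @[r --> 0^'+]) /\
  (forall D, 0 < D < e -> `|lim (L w x0 r @[r --> 0^'+]) - L w x0 D| <=
    M * (cn * D `^ (2 - 2 * s))).
Proof.
move=> cnP aw M0 e0 cn0 wp.
have bound r D : 0 < r <= D -> D < e -> `|L w x0 r - L w x0 D| <= M * (cn * D `^ (2 - 2 * s)).
  move=> /andP[r0 rD] De.
  have h1 : L w x0 r <= L w x0 D + M * (cn * D `^ (2 - 2 * s)) + 0 * Lam d s r.
    apply: (truncated_touched_above hs cnP (p := p)) => // z zD.
    by have := wp z (lt_trans zD De); rewrite ler_norml; lra.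
  have h2 : L (\- w) x0 r <= L (\- w) x0 D + M * (cn * D `^ (2 - 2 * s)) + 0 * Lam d s r.
    apply: (truncated_touched_above hs cnP (p := - p)) => //; first exact: admissibleN.
    move=> z zD /=; have := wp z (lt_trans zD De); rewrite ler_norml.
    by rewrite -(scaleN1r p) edotZl; lra.
  have D0 := lt_le_trans r0 rD.
  move: h1 h2; rewrite !truncatedN// mul0r ler_norml.
  by move: (L w x0 r) (L w x0 D) (M * _) => *; lra.
have p0 : 0 < 2 - 2 * s by case/andP: hs => _ s1; lra.
have Mc0 : 0 < M * cn + 1 by rewrite ltr_wpDl// mulr_ge0.
have cL : cvg (L w x0 r @[r --> 0^'+]).
  apply: cauchy_cvg; apply: cauchy_exP => k k0.
  have kM : 0 < k / 2 / (M * cn + 1) by rewrite !divr_gt0.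
  have [r1 r10 hr1] := exists_powR_le p0 kM.
  pose D := Num.min r1 (e / 2); have D0 : 0 < D by rewrite lt_min r10 divr_gt0.
  have De : D < e by rewrite gt_min; apply/orP; right; lra.
  have Dk : M * (cn * D `^ (2 - 2 * s)) < k.
    have : D `^ (2 - 2 * s) <= k / 2 / (M * cn + 1) by apply: hr1; rewrite D0 ge_min lexx.
    rewrite ler_pdivlMr// mulrA; have := powR_ge0 D (2 - 2 * s).
    by move: (_ `^ _) (M * cn) => T c; lra.
  exists (L w x0 D); change (\forall r \near 0^'+, ball (L w x0 D) k (L w x0 r)); near=> r.
  have rD : 0 < r <= D.
    by apply/andP; split; near: r; [exact: nbhs_right_gt|exact: nbhs_right_le].
  by rewrite /ball/= distrC; exact: le_lt_trans (bound r D rD De) Dk.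
split=> // D /andP[D0 De].
have near1 : \forall r \near 0^'+, `|L w x0 r - L w x0 D| <= M * (cn * D `^ (2 - 2 * s)).
  near=> r; apply: bound => //.
  by apply/andP; split; near: r; [exact: nbhs_right_gt|exact: nbhs_right_le].
rewrite ler_norml; apply/andP; split.
  rewrite lerBrDr; apply: limr_ge => //; apply: filterS near1 => r.
  by rewrite ler_norml; move: (M * _) => T; lra.
rewrite lerBlDr; apply: limr_le => //; apply: filterS near1 => r.
by rewrite ler_norml; move: (M * _) => T; lra.
Unshelve. all: by end_near.
Qed.

End test_functions.

(** * The normalizing constant *)

Section gamma.
Context {R : realType}.
Local Notation RT := (measurableTypeR R).
Local Notation mu := (@lebesgue_measure R).

Definition gamma_integrand (x t : R) : R := t `^ (x - 1) * expR (- t).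

Lemma gamma_integrand_ge0 x t : 0 <= gamma_integrand x t.
Proof. by rewrite mulr_ge0 ?powR_ge0 ?expR_ge0. Qed.

Lemma measurable_gamma_integrand x : measurable_fun setT (gamma_integrand x : RT -> RT).
Proof.
apply: measurable_funM; first exact: measurable_powR.
apply: measurableT_comp; first exact: measurable_expR.
exact: oppr_measurable.
Qed.

Lemma powRB1 (x t : R) : 0 < t -> t `^ (x - 1) = t `^ x / t.
Proof.
move=> t0; rewrite powRB; last by rewrite (gt_eqF t0) implybT.
by rewrite powRr1// ltW.
Qed.

(** Dyadic pieces 2^(- k - 1) <= t <= 2^(- k). Splitting t^(x - 1) as t^x / t gives the bound 2^(- k
    x) 2^(k + 1) whatever the sign of x - 1. *)
Lemma gamma_integral_near (x : R) : 0 < x ->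
  (\int[mu]_(t in `]0%R, 1%R]%classic) (gamma_integrand x t)%:E < +oo)%E.
Proof.
move=> x0; pose q : R := (2 `^ x)^-1.
have q1 : 1 < 2 `^ x :> R by exact: powR2_gt1.
have q01 : 0 <= q < 1.
  by rewrite /q invr_ge0 powR_ge0/= invf_lt1// (lt_trans _ q1).
apply: le_lt_trans (ltry (2 / (1 - q))).
apply: (@integral_le_geometric R _ _ mu _ _ (fun k => `[0%R, (2 ^+ k)^-1]%classic)
   (fun k => q ^+ k * 2 ^+ k.+1) (fun k => (2 ^+ k)^-1)) => //.
- by apply: measurable_funTS; exact: measurable_gamma_integrand.
- by move=> t _; exact: gamma_integrand_ge0.
- by move=> k; rewrite mulr_ge0 ?exprn_ge0//; case/andP: q01.
- move=> k; rewrite /= lebesgue_measure_itv/= lte_fin invr_gt0 exprn_gt0//.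
  by rewrite -EFinD subr0.
- move=> t; rewrite /= in_itv/= => /andP[t0 t1].
  have /dyadic_bounds[k /andP[l h]] : 1 <= t^-1 by rewrite invf_ge1.
  have k0 j : 0 < 2 ^+ j :> R by rewrite exprn_gt0.
  have tk : t <= (2 ^+ k)^-1 by rewrite -[leLHS]invrK lef_pV2 ?posrE ?invr_gt0.
  exists k; first by rewrite /= in_itv/= (ltW t0).
  rewrite /gamma_integrand powRB1// -[leRHS]mulr1; apply: ler_pM.
  + by rewrite divr_ge0 ?powR_ge0// ltW.
  + exact: expR_ge0.
  + apply: ler_pM; rewrite ?powR_ge0 ?invr_ge0 ?(ltW t0)//.
    rewrite /q exprVn -powR2X -[leRHS]powR_inv1 ?powR_ge0// powRAC powR_inv1 ?(ltW (k0 _))//.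
    by apply: ge0_ler_powR; rewrite ?nnegrE ?invr_ge0 ?(ltW t0) ?(ltW x0) ?(ltW (k0 _)).
  + by rewrite -expR0 ler_expR oppr_le0 ltW.
move=> k; have k0 : (2 ^+ k : R) != 0 by rewrite expf_neq0.
rewrite exprS le_eqVlt; apply/orP; left; apply/eqP; move: k0; move: (2 ^+ k) (q ^+ k) => a b a0.
by field.
Qed.

Lemma expRN_le_powR (N : nat) (t : R) : (0 < N)%N -> 0 < t ->
  expR (- t) <= N%:R ^+ N * t ^- N.
Proof.
move=> N0 t0; have N0' : 0 < N%:R :> R by rewrite ltr0n.
have tN : 0 < t / N%:R by rewrite divr_gt0.
have -> : N%:R ^+ N * t ^- N = ((t / N%:R) ^+ N)^-1 by rewrite expr_div_n invf_div.
have E : expR t = expR (t / N%:R) ^+ N by rewrite -expRM_natr divfK// gt_eqF.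
rewrite expRN lef_pV2 ?posrE ?expR_gt0 ?exprn_gt0// E.
apply: lerXn2r; rewrite ?nnegrE ?expR_ge0 ?(ltW tN)//.
by apply: le_trans (expR_ge1Dx _); rewrite lerDr.
Qed.

Lemma gamma_integral_far x :
  (\int[mu]_(t in `]1%R, +oo[%classic) (gamma_integrand x t)%:E < +oo)%E.
Proof.
(* With N >= x + 1, the bound (N / t)^N on exp(- t) leaves at most N^N t^(-2) for t > 1. *)
pose N := (Num.truncn `|x + 1|).+1.
have xN : x + 1 <= N%:R by rewrite (le_trans (ler_norm _))// ltW// truncnS_gt.
have A0 : 0 <= N%:R ^+ N :> R by rewrite exprn_ge0.
have h2 : (2^-1 : R) < 1 by rewrite invf_lt1 ?ltr1n.
have q01 : 0 <= (2^-1 : R) < 1 by rewrite invr_ge0 ler0n h2.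
apply: le_lt_trans (ltry (N%:R ^+ N * 2 / (1 - 2^-1))).
apply: (@integral_le_geometric R _ _ mu _ _ (fun k => `[0%R, 2 ^+ k.+1]%classic)
   (fun k => N%:R ^+ N * (2 ^+ k) ^- 2) (fun k => 2 ^+ k.+1)) => //.
- by apply: measurable_funTS; exact: measurable_gamma_integrand.
- by move=> t _; exact: gamma_integrand_ge0.
- move=> k; rewrite /= lebesgue_measure_itv/= lte_fin exprn_gt0//.
  by rewrite -EFinD subr0.
- move=> t; rewrite /= in_itv/= andbT => t1; have t0 : 0 < t := lt_trans ltr01 t1.
  have /dyadic_bounds[k /andP[l h]] := ltW t1.
  exists k; first by rewrite /= in_itv/= (ltW t0).
  apply: (@le_trans _ _ (t `^ (x - 1) * (N%:R ^+ N * t ^- N))).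
    by rewrite ler_wpM2l ?powR_ge0// expRN_le_powR.
  rewrite mulrCA ler_wpM2l//.
  apply: (@le_trans _ _ (t ^- 2)); last first.
    by rewrite lef_pV2 ?posrE ?exprn_gt0// ler_sqr ?nnegrE ?exprn_ge0// ltW.
  rewrite -!powR_invn ?(ltW t0)// -powRD; last by rewrite (gt_eqF t0) implybT.
  by apply: ler_powR; [exact: ltW|lra].
move=> k; have k0 : (2 ^+ k : R) != 0 by rewrite expf_neq0.
rewrite [2 ^+ k.+1]exprS exprVn le_eqVlt; apply/orP; left; apply/eqP.
by move: k0; move: (2 ^+ k) (N%:R ^+ N) => a b a0; field.
Qed.

(** The real-valued integral would be 0 by default if it were infinite, so positivity includes
    finiteness. The lower bound comes from the interval [1, 2]. *)
Lemma gamma_integral_gt0 (x : R) : 0 < x ->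
  0 < \int[mu]_(t in `]0%R, +oo[%classic) gamma_integrand x t.
Proof.
move=> x0; have mf := measurable_gamma_integrand x.
have fin : (\int[mu]_(t in `]0%R, +oo[%classic) (gamma_integrand x t)%:E < +oo)%E.
  have -> : `]0%R, +oo[%classic = `]0%R, 1%R]%classic `|` `]1%R, +oo[%classic :> set R.
    apply/seteqP; split=> t /=; rewrite !in_itv/= !andbT.
      by move=> t0; have [t1|t1] := leP t 1; [left|right]; rewrite ?t0.
    by move=> [/andP[]//|]; exact: lt_trans.
  rewrite ge0_integral_setU//.
  - exact: lte_add_pinfty (gamma_integral_near x0) (gamma_integral_far x).
  - by apply/measurable_EFinP; exact: measurable_funTS.
  - by move=> t _; rewrite lee_fin gamma_integrand_ge0.
  - apply/disj_setPS => t /= []; rewrite !in_itv/= andbT => /andP[_ t1] t1'.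
    by move: t1'; rewrite ltNge t1.
apply: fine_gt0; rewrite fin andbT.
pose c : R := 2^-1 * expR (- 2); have c0 : 0 < c by rewrite mulr_gt0 ?expR_gt0// invr_gt0.
apply: (@lt_le_trans _ _ (\int[mu]_(t in `[1%R, 2%R]%classic) c%:E)%E).
  rewrite integral_cst//= lebesgue_measure_itv/= lte_fin ltr1n -EFinD -EFinM lte_fin.
  by rewrite mulr_gt0// subr_gt0 ltr1n.
apply: (@le_trans _ _ (\int[mu]_(t in `[1%R, 2%R]%classic) (gamma_integrand x t)%:E)%E).
  apply: ge0_le_integral => //.
  - by move=> t _; rewrite lee_fin ltW.
  - by apply/measurable_EFinP; exact: measurable_funTS.
  move=> t /=; rewrite in_itv/= => /andP[t1 t2]; rewrite lee_fin /c /gamma_integrand.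
  have t0 : 0 < t by exact: lt_le_trans t1.
  apply: ler_pM; rewrite ?expR_ge0//; last by rewrite ler_expR lerN2.
  rewrite powRB1// -[leLHS]mul1r; apply: ler_pM => //.
  - by rewrite -(powRr0 t) ler_powR// ltW.
  - by rewrite lef_pV2 ?posrE.
apply: ge0_subset_integral => //.
- by apply/measurable_EFinP; exact: measurable_funTS.
- by move=> t _; rewrite lee_fin gamma_integrand_ge0.
by move=> t /=; rewrite !in_itv/= andbT => /andP[t1 _]; exact: lt_le_trans t1.
Qed.

(** As - 1 < - s < 0, [Gamma (- s)] takes exactly one step of the continuation: Euler's integral at
    1 - s divided by - s. It has to be nonzero, since inverting 0 would make the constant 0. *)
Lemma frac_laplacian_const_gt0 (d : nat) (s : R) : 0 < s < 1 -> 0 < frac_laplacian_const d s.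
Proof.
move=> /andP[s0 s1]; have sd0 : 0 < s + d%:R / 2 by rewrite ltr_pwDl// divr_ge0.
rewrite /frac_laplacian_const divr_gt0//.
  rewrite mulr_gt0 ?powR_gt0// /Gamma sd0 big_ord0 divr1.
  have := gamma_integral_gt0 sd0.
  by congr (_ < _); apply: eq_Rintegral => t _; rewrite /gamma_integrand mulr0n addr0.
rewrite mulr_gt0 ?powR_gt0 ?pi_gt0// normr_gt0 /Gamma.
have -> : (0 < - s) = false by rewrite oppr_gt0 ltNge (ltW s0).
have -> : Num.truncn (- - s) = 0%N.
  by apply/eqP; rewrite opprK -leqn0 leqNgt truncn_gt0 -ltNge.
rewrite big_ord_recl big_ord0 mulr1 mulf_neq0 ?invr_eq0//; last first.
  by rewrite addr0 oppr_eq0 gt_eqF.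
have s10 : 0 < 1 - s by rewrite subr_gt0.
have := gamma_integral_gt0 s10; rewrite lt_def => /andP[+ _].
by congr (_ != _); apply: eq_Rintegral => t _; rewrite /gamma_integrand (addrC (- s)).
Qed.

End gamma.

(** * The nonlinearity *)

Section essential_bounds.
Context {R : realType} (d : nat).
Implicit Types (f : 'rV[R]_d -> R) (x y : 'rV[R]_d).
Local Notation row := (@row_of_tuple R d).
Local Notation mu := (lebesgue_tuple d).

Lemma Linfty_norm_ge0 (D : set 'rV[R]_d) f : (0 <= Linfty_norm D f)%E.
Proof. exact: Lnorm_ge0. Qed.

(** An essential supremum ignores single points, so [|f|] must be nearly as large as at [x] on a
    ball inside [D], which has positive measure. The ball may be centred elsewhere, because a point
    of the sphere is not interior to the complement of the open ball. *)
Lemma Linfty_norm_pointwise (D : set 'rV[R]_d) f x (b : R) :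
  (forall k, 0 < k -> exists y, exists2 e : R, 0 < e &
    forall y', enorm (y' - y) < e -> D y' /\ `|f x| - k <= `|f y'|) ->
  (Linfty_norm D f <= b%:E)%E -> `|f x| <= b.
Proof.
move=> fD; rewrite /Linfty_norm unlock => fb; rewrite leNgt; apply/negP => bf.
have k0 : 0 < (`|f x| - b) / 2 by rewrite divr_gt0// subr_gt0.
have [y [e e0 ye]] := fD _ k0.
(* The vector is scaled so that this cube of known measure is centred at [y]. *)
pose Q := offset_box ((2 * e)^-1 *: y) e.
have mQ : measurable Q by exact: measurable_offset_box.
have Q0 : (0 < mu Q)%E.
  apply: (eq_ind_r (fun z => 0 < z)%E _ (measure_offset_box ((2 * e)^-1 *: y) e0)).
  by rewrite lte_fin exprn_gt0// divr_gt0.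
have QD t : Q t -> D (row t) /\ b < `|f (row t)|.
  move=> /(offset_box_near e0); rewrite scalerA mulfV ?scale1r; last by rewrite gt_eqF// mulr_gt0.
  move=> h; have /ye [Dt ft] : enorm (row t - y) < e by lra.
  by split=> //; lra.
(* The norm with infinite exponent is an essential supremum only when the whole space has positive
   measure. *)
have muT : (0 < mu [set: d.-tuple (measurableTypeR R)])%E.
  by apply: (lt_le_trans Q0); apply: le_measure; rewrite ?inE.
rewrite muT in fb.
have /ess_supP[N [mN N0 NP]] := fb.
have QN : Q `<=` N.
  move=> t Qt; apply: NP => /=; apply/negP; rewrite -ltNge.
  have [Dt ft] := QD t Qt; rewrite /patch mem_set//= lte_fin.
have : (mu Q <= mu N)%E by apply: le_measure; rewrite ?inE.
by rewrite N0 leNgt Q0.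
Qed.

End essential_bounds.

Section compactness.
Context {R : realType} (d : nat).
Implicit Types (f : 'rV[R]_d -> R) (x y : 'rV[R]_d).

Lemma heine_cantor f (r k : R) : (forall x, enorm x <= r -> {for x, continuous f}) -> 0 < k ->
  exists2 e : R, 0 < e & forall x y, enorm x <= r -> enorm y <= r -> enorm (x - y) < e ->
    `|f x - f y| <= k.
Proof.
move=> cf k0; have /compact_near_coveringP nc := @compact_cball R d r.
have k20 : 0 < k / 2 by rewrite divr_gt0.
pose P (e : R) x := forall y, enorm (x - y) < e -> `|f x - f y| <= k.
have : \forall e \near 0^'+, [set x | enorm x <= r] `<=` P e.
  apply: nc => x /= xr.
  have /cvgrPdist_lt /(_ _ k20) cx : f y @[y --> x] --> f x by exact: cf.
  have /nbhs_enormP[e e0 he] := cx.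
  exists ([set y | enorm (y - x) < e / 2], [set a | a < e / 2]) => /=.
    split; first by apply/nbhs_enormP; exists (e / 2) => //; rewrite divr_gt0.
    by near=> a; near: a; apply: nbhs_right_lt; rewrite divr_gt0.
  move=> [y a] /= [yx ae] z yz.
  have zx : enorm (z - x) < e.
    by have := enormB_le z y x; rewrite (enormBC z y); lra.
  have h1 := he _ zx; have h2 : `|f x - f y| < k / 2 by apply: he; lra.
  by move: h1 h2; rewrite /= !ltr_norml ler_norml; lra.
move=> h; have [e [e0 he]] : exists e : R, 0 < e /\ [set x | enorm x <= r] `<=` P e.
  near (0 : R)^'+ => e; exists e; split; first by near: e; exact: nbhs_right_gt.
  by near: e.
by exists e => // x y xr _ xy; exact: he.
Unshelve. all: by end_near.
Qed.

End compactness.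

Section power_series.
Context {R : realType} (d : nat) (rho : R).
Implicit Types (x y : 'rV[R]_d).

(** Here the radius 1/4 enters: each induction step yields at most (|y| + |z|^(l + 1)) |y - z| <= |y
    - z| / 2. One Lipschitz constant serves all powers, so the sum of the coefficient bounds is one
    for the series. *)
Lemma power_lipschitz (y z : R) l : `|y| <= 4^-1 -> `|z| <= 4^-1 ->
  `|y ^+ l - z ^+ l| <= `|y - z|.
Proof.
move=> y4 z4; case: l => [|l]; first by rewrite subrr normr0.
elim: l => [|l IH]; first by rewrite !expr1.
rewrite exprS [z ^+ _]exprS (_ : _ - _ = y * (y ^+ l.+1 - z ^+ l.+1) + (y - z) * z ^+ l.+1);
  last by ring.
rewrite (le_trans (ler_normD _ _))// !normrM.
have z1 : `|z ^+ l.+1| <= 4^-1.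
  rewrite normrX exprS -[leRHS]mulr1; apply: ler_pM; rewrite ?exprn_ge0//.
  by rewrite exprn_ile1//; lra.
have h1 : `|y| * `|y ^+ l.+1 - z ^+ l.+1| <= 4^-1 * `|y - z| by apply: ler_pM.
have h2 : `|y - z| * `|z ^+ l.+1| <= `|y - z| * 4^-1 by apply: ler_wpM2l.
have := normr_ge0 (y - z); lra.
Qed.

Variables (L : set nat) (c : nat -> 'rV[R]_d -> R) (b : nat -> R) (B : R).
Hypotheses (cc : forall l x, L l -> enorm x < rho -> {for x, continuous (c l)})
  (b0 : forall l, 0 <= b l) (cb : forall l x, L l -> enorm x < rho -> `|c l x| <= b l)
  (bB : forall n, \sum_(0 <= l < n) b l <= B).

Let S x (a : R) n := nonlinearity_series L c x a n.

Let term x (a : R) l : R := if l \in L then c l x * a ^+ l else 0.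

Let SE x a n : S x a n = \sum_(0 <= l < n) term x a l.
Proof. by []. Qed.

Let term_le x a l : enorm x < rho -> `|a| <= 4^-1 -> `|term x a l| <= b l.
Proof.
move=> xr a4; rewrite /term; case: ifPn => [/set_mem Ll|_]; last by rewrite normr0.
rewrite normrM -[leRHS]mulr1; apply: ler_pM => //; first exact: cb.
by rewrite normrX exprn_ile1//; lra.
Qed.

Let b_cvg : cvgn (series b).
Proof.
apply: nondecreasing_is_cvgn.
  apply/nondecreasing_seqP => n; rewrite /series/= big_nat_recr//= lerDl//.
by exists B => _ [n _ <-]; exact: bB.
Qed.

Lemma nonlinearity_cvg x a : enorm x < rho -> `|a| <= 4^-1 -> cvgn (S x a).
Proof.
move=> xr a4; apply: normed_cvg; apply: (series_le_cvg _ _ _ b_cvg) => n //=.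
exact: term_le.
Qed.

(** Weierstrass test: the remainder is dominated by that of the numerical series [b]. *)
Lemma nonlinearity_tail k : 0 < k -> exists n, forall x a, enorm x < rho -> `|a| <= 4^-1 ->
  `|nonlinearity L c x a - S x a n| <= k.
Proof.
move=> k0; have /cvgrPdist_le /(_ _ (divr_gt0 k0 (ltr0Sn _ 1)))[n _ hn] := b_cvg.
exists n => x a xr a4.
have h p : (n <= p)%N -> `|S x a p - S x a n| <= k.
  move=> np; rewrite !SE (big_cat_nat (leq0n n) np)/= [X in X - _]addrC addrK.
  apply: (le_trans (ler_norm_sum _ _ _)).
  apply: (@le_trans _ _ (\sum_(n <= l < p) b l)); first by apply: ler_sum => l _; exact: term_le.
  have := hn p np; have := hn n (leqnn n); rewrite /series/= (big_cat_nat (leq0n n) np)/=.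
  by rewrite !ler_norml; lra.
have cS := nonlinearity_cvg xr a4.
have h' : \forall p \near \oo, `|S x a p - S x a n| <= k by exists n.
rewrite /nonlinearity ler_norml; apply/andP; split.
  rewrite lerBrDr; apply: limr_ge => //; apply: filterS h' => p.
  by rewrite /S ler_norml; lra.
rewrite lerBlDr; apply: limr_le => //; apply: filterS h' => p.
by rewrite /S ler_norml; lra.
Qed.

Lemma nonlinearity_bound x a : enorm x < rho -> `|a| <= 4^-1 -> `|nonlinearity L c x a| <= B.
Proof.
move=> xr a4; have cS := nonlinearity_cvg xr a4.
have h n : `|S x a n| <= B.
  rewrite SE; apply: (le_trans (ler_norm_sum _ _ _)); apply: le_trans (bB n).
  by apply: ler_sum => l _; exact: term_le.
rewrite /nonlinearity ler_norml; apply/andP; split.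
  by apply: limr_ge => //; apply: nearW => n; have := h n; rewrite ler_norml => /andP[].
by apply: limr_le => //; apply: nearW => n; have := h n; rewrite ler_norml => /andP[].
Qed.

Lemma nonlinearity_lipschitz x a a' : enorm x < rho -> `|a| <= 4^-1 -> `|a'| <= 4^-1 ->
  `|nonlinearity L c x a - nonlinearity L c x a'| <= B * `|a - a'|.
Proof.
move=> xr a4 a4'; apply/ler_addgt0Pr => k k0.
have k20 : 0 < k / 2 by rewrite divr_gt0.
have [n hn] := nonlinearity_tail k20.
have h : `|S x a n - S x a' n| <= B * `|a - a'|.
  rewrite !SE -sumrB; apply: (le_trans (ler_norm_sum _ _ _)).
  apply: (@le_trans _ _ (\sum_(0 <= l < n) b l * `|a - a'|)); last first.
    by rewrite -mulr_suml ler_wpM2r.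
  apply: ler_sum => l _; rewrite /term; case: ifPn => [/set_mem Ll|_]; last first.
    by rewrite subrr normr0 mulr_ge0.
  by rewrite -mulrBr normrM; apply: ler_pM => //; [exact: cb|exact: power_lipschitz].
by have := hn x a xr a4; have := hn x a' xr a4'; move: h; rewrite !ler_norml; move: (B * _) => T;
  lra.
Qed.

(** Infinitely many coefficients need share no modulus of continuity. The tail is discarded
    uniformly, and the finitely many remaining terms are handled one by one with Heine-Cantor. *)
Lemma nonlinearity_unif_cont (sg k : R) : 0 < sg -> 0 < k -> exists2 e : R, 0 < e &
  forall x y, enorm x <= rho - sg -> enorm y <= rho - sg -> enorm (x - y) < e ->
  forall a, `|a| <= 4^-1 -> `|nonlinearity L c x a - nonlinearity L c y a| <= k.
Proof.
move=> sg0 k0.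
have part n (k' : R) : 0 < k' -> exists2 e : R, 0 < e &
    forall x y, enorm x <= rho - sg -> enorm y <= rho - sg -> enorm (x - y) < e ->
    forall a, `|a| <= 4^-1 -> `|S x a n - S y a n| <= k'.
  elim: n k' => [|n IH] k' k'0.
    by exists 1 => // x y _ _ _ a _; rewrite !SE !big_geq// subrr normr0 ltW.
  have k20 : 0 < k' / 2 by rewrite divr_gt0.
  have [e e0 he] := IH _ k20.
  have [f f0 hf] : exists2 f : R, 0 < f & forall x y, enorm x <= rho - sg -> enorm y <= rho - sg ->
      enorm (x - y) < f -> forall a, `|a| <= 4^-1 -> `|term x a n - term y a n| <= k' / 2.
    have [Ln|Ln] := boolP (n \in L); last first.
      by exists 1 => // x y _ _ _ a _; rewrite /term (negbTE Ln) subrr normr0 ltW.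
    have cn x : enorm x <= rho - sg -> {for x, continuous (c n)}.
      by move=> xr; apply: cc; [exact: set_mem|lra].
    have [f f0 hf] := heine_cantor cn k20; exists f => // x y xr yr xy a a4.
    rewrite /term Ln -mulrBl normrM -[leRHS]mulr1; apply: ler_pM => //; first exact: hf.
    by rewrite normrX exprn_ile1//; lra.
  exists (Num.min e f) => [|x y xr yr]; first by rewrite lt_min e0.
  rewrite lt_min => /andP[xy1 xy2] a a4.
  have := he _ _ xr yr xy1 a a4; have := hf _ _ xr yr xy2 a a4.
  rewrite !SE !big_nat_recr//= !ler_norml.
  by move: (\sum_(_ <= _ < _) _) (\sum_(_ <= _ < _) _) (term _ _ _) (term _ _ _) => *; lra.
have k30 : 0 < k / 3 by rewrite divr_gt0.
have [n hn] := nonlinearity_tail k30.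
have [e e0 he] := part n _ k30; exists e => // x y xr yr xy a a4.
have xB : enorm x < rho by lra.
have yB : enorm y < rho by lra.
have := he _ _ xr yr xy a a4; have := hn _ _ xB a4; have := hn _ _ yB a4.
by rewrite !ler_norml; lra.
Qed.

End power_series.

(** * Viscosity solutions *)

Section viscosity_solution.
Context {R : realType} (d : nat) (s rho m : R).
Hypothesis hs : 0 < s < 1.
Implicit Types (u v w phi xi : 'rV[R]_d -> R) (x y z : 'rV[R]_d) (G : 'rV[R]_d -> R -> R).
Local Notation L := (frac_laplacian_truncated s).
Local Notation row := (@row_of_tuple R d).
Local Notation C := (frac_laplacian_const d s).

Let C0 : 0 < C. Proof. exact: frac_laplacian_const_gt0. Qed.

Variable cn : R.
Hypotheses (cn0 : 0 < cn) (cnP : near_constant d s cn).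

(** The closure of [U] lies in the ball, hence is compact, and [xi] is continuous on it; this gives
    the boundedness needed for admissibility. *)
Lemma test_function_patch u x0 (U : set 'rV[R]_d) xi :
  admissible u -> test_function rho u x0 U xi ->
  [/\ admissible (patch u U xi), patch u U xi x0 = u x0 &
  exists p M e, [/\ 0 <= M, 0 < e & forall z, enorm z < e ->
    `|patch u U xi (x0 + z) - patch u U xi x0 - edot p z| <= M * enorm z ^+ 2]].
Proof.
move=> au [oU Ux0 UB c2 xix0]; have [cxi _ _] := c2.
have cU : compact (closure U).
  apply: bounded_closed_compact; last exact: closed_closure.
  have [M [Mr MP]] := compact_bounded (@compact_cball R d rho).
  exists M; split=> // N MN x /UB; rewrite /eball/= subr0 => /ltW; exact: MP.
have xib : exists M, forall x, U x -> `|xi x| <= M.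
  have [M [Mr MP]] := compact_bounded (continuous_compact cxi cU).
  exists (M + 1) => x Ux; apply: MP; first by rewrite ltrDl.
  by exists x => //; exact: subset_closure.
have [p [M [e [M0 e0 xiP]]]] := C2_paraboloid oU Ux0 c2.
split.
- by apply: admissible_patch => // x Ux; exact: within_closure_continuous cxi x Ux.
- by rewrite /patch mem_set.
exists p, M, e; split=> // z ze; have [Uz zP] := xiP z ze.
by rewrite /patch !mem_set.
Qed.

Lemma admissible_frac_laplacian_defined w x0 : admissible w ->
  cvg (L w x0 r @[r --> 0^'+]) -> frac_laplacian_defined s w x0.
Proof.
move=> aw cw; split=> // r r0; rewrite outside_ballE.
exact: (truncated_integrable hs x0 aw r0).
Qed.

(** [l] stands for the limit of the truncations. It is kept abstract so that for the opposite
    function the opposite of the limit can be inserted directly. *)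
Lemma viscosity_inequality phi G u w x0 p M e l :
  (forall x a b, enorm x < rho -> `|G x a - G x b| <= 2^-1 * `|a - b|) ->
  interior_unif_cont rho G ->
  limit_of_approx s C rho m phi G u -> unif_cont u -> (forall x, `|u x| <= m) ->
  enorm x0 < rho -> admissible w -> w x0 = u x0 -> (forall x, u x <= w x) ->
  0 <= M -> 0 < e ->
  (forall z, enorm z < e -> `|w (x0 + z) - w x0 - edot p z| <= M * enorm z ^+ 2) ->
  (forall D, 0 < D < e -> `|l - L w x0 D| <= M * (cn * D `^ (2 - 2 * s))) ->
  0 <= C * l + G x0 (u x0) - u x0.
Proof.
move=> Glip Guc ulim uu um x0B aw wx0 uw M0 e0 wP lP.
have au : admissible u by exact: admissible_cont (unif_cont_continuous uu) um.
apply/ler_addgt0Pr => k k0.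
have p0 : 0 < 2 - 2 * s by case/andP: hs => _ s1; lra.
(* 2 M + 1 collects the steepened coefficient M + 1 of [touched_above_ineq] and the [M] in the
   distance from [l] to the truncation at [D]. *)
have CM0 : 0 < C * ((2 * M + 1) * cn) by rewrite mulr_gt0// mulr_gt0// ltr_wpDl// mulr_ge0.
have [r1 r10 hr1] := exists_powR_le p0 (divr_gt0 k0 CM0).
pose D := Num.min r1 (e / 2); have D0 : 0 < D by rewrite lt_min r10 divr_gt0.
have D2 : D <= e / 2 by rewrite ge_min lexx orbT.
have De2 : 2 * D <= e by lra.
have De : 0 < D < e by rewrite D0/=; lra.
have Dk : C * ((2 * M + 1) * (cn * D `^ (2 - 2 * s))) <= k.
  have : D `^ (2 - 2 * s) <= k / (C * ((2 * M + 1) * cn)) by apply: hr1; rewrite D0 ge_min lexx.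
  by rewrite ler_pdivlMr// mulrC !mulrA.
have up z : enorm z < 2 * D -> u (x0 + z) <= u x0 + edot p z + M * enorm z ^+ 2.
  move=> zD; have := wP z (lt_le_trans zD De2); have := uw (x0 + z).
  by rewrite wx0 ler_norml; lra.
have h1 := touched_above_ineq hs C0 cnP Glip Guc ulim uu um x0B M0 D0 up.
have h2 : L u x0 D <= L w x0 D + 0 * Lam d s D.
  by apply: truncated_le => // t _; rewrite wx0 addr0 lerD2r.
have := lP D De; rewrite mul0r addr0 in h2; rewrite ler_norml => /andP[h3 _].
move: h1 h2 h3 Dk; move: (cn * _) (L u x0 D) (L w x0 D) (u x0) (G _ _) => T l1 l2 v g h1 h2 h3 Dk.
have h4 : l1 + (M + 1) * T <= l + (2 * M + 1) * T by lra.
have /(ler_wpM2l (ltW C0)) := h4; rewrite [C * (l + _)]mulrDr.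
lra.
Qed.

Lemma viscosity_solution_of_limit phi G (f : 'rV[R]_d -> R -> R) u :
  (forall x a b, enorm x < rho -> `|G x a - G x b| <= 2^-1 * `|a - b|) ->
  interior_unif_cont rho G ->
  limit_of_approx s C rho m phi G u -> unif_cont u -> (forall x, `|u x| <= m) ->
  (forall x, enorm x < rho -> f x (u x) = G x (u x)) ->
  viscosity_subsolution s rho f u /\ viscosity_supersolution s rho f u.
Proof.
move=> Glip Guc ulim uu um fG.
have au : admissible u by exact: admissible_cont (unif_cont_continuous uu) um.
split=> x0 U xi; rewrite /eball/= subr0 => x0B tf uxi;
  have [aw wx0 [p [M [e [M0 e0 wP]]]]] := test_function_patch au tf;
  have [cL lP] := paraboloid_limit hs cnP aw M0 e0 (ltW cn0) wP;
  (split; first exact: admissible_frac_laplacian_defined); rewrite fG// /frac_laplacian.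
  apply: (viscosity_inequality Glip Guc ulim uu um x0B aw wx0 _ M0 e0 wP lP).
  by move=> x; rewrite /patch; case: ifPn => // /set_mem /uxi.
(* The supersolution half: the opposite of [u] is a limit of approximate solutions of the reflected
   problem, and the opposite of the patch touches it from above. *)
have GlipN x a b : enorm x < rho -> `|- G x (- a) - - G x (- b)| <= 2^-1 * `|a - b|.
  move=> xB; rewrite -opprD normrN -[`|a - b|]normrN opprD.
  by have := Glip x (- a) (- b) xB.
have GucN : interior_unif_cont rho (fun x a => - G x (- a)).
  move=> sg k sg0 k0; have [e' e'0 he'] := Guc sg k sg0 k0; exists e' => // x y xs ys xy a.
  by rewrite -opprD normrN; exact: he'.
have ulimN : limit_of_approx s C rho m (\- phi) (fun x a => - G x (- a)) (\- u).
  move=> k r0 k0 r00; have [r [v [/andP[rp rr0] va vu]]] := ulim k r0 k0 r00.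
  exists r, (\- v); split; first by rewrite rp.
    exact: approx_solutionN.
  by move=> x /=; rewrite -opprD normrN.
have umN x : `|(\- u) x| <= m by rewrite normrN.
set w := patch u U xi in aw wx0 wP cL lP *.
have wPN z : enorm z < e -> `|(\- w) (x0 + z) - (\- w) x0 - edot (- p) z| <= M * enorm z ^+ 2.
  move=> /wP; rewrite -(scaleN1r p) edotZl mulN1r /=.
  by rewrite -normrN; congr (`|_| <= _); ring.
have lPN D : 0 < D < e -> `|- lim (L w x0 r @[r --> 0^'+]) - L (\- w) x0 D| <=
  M * (cn * D `^ (2 - 2 * s)).
  move=> De; rewrite truncatedN//; last by case/andP: De.
  by rewrite -opprD normrN; exact: lP.
have wx0N : (\- w) x0 = (\- u) x0 by rewrite /= wx0.
have uwN x : (\- u) x <= (\- w) x.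
  rewrite /= lerN2 /w /patch; case: ifPn => // /set_mem; exact: uxi.
have := viscosity_inequality GlipN GucN ulimN (unif_contN uu) umN x0B (admissibleN aw)
  wx0N uwN M0 e0 wPN lPN.
by rewrite /= opprK mulrN; move: (C * _) (u x0) (G _ _) => *; lra.
Qed.

End viscosity_solution.

(** * Clamped data and conclusion *)

Section clamp.
Context {R : realType}.

(** The projection onto [-1/4, 1/4], written as an affine conjugate of [unit_clamp]. *)
Definition quarter_clamp (a : R) := 2^-1 * unit_clamp (2 * a + 2^-1) - 4^-1.

Lemma quarter_clamp_bound a : `|quarter_clamp a| <= 4^-1.
Proof.
by have /andP[c0 c1] := unit_clamp01 (2 * a + 2^-1); rewrite /quarter_clamp ler_norml; lra.
Qed.

Lemma quarter_clamp_lip a b : `|quarter_clamp a - quarter_clamp b| <= `|a - b|.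
Proof.
have := unit_clamp_lip (2 * a + 2^-1) (2 * b + 2^-1).
rewrite (_ : 2 * a + 2^-1 - _ = 2 * (a - b)); last by ring.
rewrite (_ : quarter_clamp a - _ = 2^-1 * (unit_clamp (2 * a + 2^-1)
  - unit_clamp (2 * b + 2^-1))); last first.
  by rewrite /quarter_clamp; ring.
by rewrite !normrM [`|2|]gtr0_norm// [`|2^-1|]gtr0_norm ?invr_gt0//; lra.
Qed.

Lemma quarter_clamp_id a : `|a| <= 4^-1 -> quarter_clamp a = a.
Proof.
rewrite ler_norml => /andP[a1 a2]; rewrite /quarter_clamp unit_clamp_id; first by field.
by apply/andP; split; lra.
Qed.

End clamp.

Theorem theorem1p1 (R : realType) (d : nat) (s rho : R) (L : set nat) :
  (1 <= d)%N -> 0 < s < 1 -> 0 < rho ->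
  exists2 eps : R, 0 < eps &
  forall (phi : 'rV[R]_d -> R) (c : nat -> 'rV[R]_d -> R),
    (exists K : R, forall x y, `|phi x - phi y| <= K * enorm (x - y)) ->
    [bounded phi x | x in ~` eball 0 rho] ->
    (forall l, L l -> {within eball 0 rho, continuous (c l)} /\
                      [bounded c l x | x in eball 0 rho]) ->
    (Linfty_norm (~` eball 0 rho) phi <= eps%:E)%E ->
    (\esum_(l in L) Linfty_norm (eball 0 rho) (c l) <= eps%:E)%E ->
    exists u : 'rV[R]_d -> R,
      continuous_viscosity_solution s rho (nonlinearity L c) phi u /\
      forall x, eball 0 rho x -> cvgn (nonlinearity_series L c x (u x)).
Proof.
move=> d1 hs rho0; exists 4^-1 => [|phi c [K phiK] _ cH phi4 c4]; first by rewrite invr_gt0.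
have inB (x : 'rV[R]_d) : eball 0 rho x = (enorm x < rho) by rewrite /eball/= subr0.
pose lip := `|K| + 1; have lip0 : 0 < lip by rewrite ltr_wpDl.
have phil x y : `|phi x - phi y| <= lip * enorm (x - y).
  apply: (le_trans (phiK x y)); rewrite ler_wpM2r ?enorm_ge0//.
  by have := ler_norm K; rewrite /lip; lra.
have phiout x : rho <= enorm x -> `|phi x| <= 4^-1.
  move=> xr; apply: Linfty_norm_pointwise phi4 => k k0.
  have x0 : 0 < enorm x := lt_le_trans rho0 xr.
  (* Pushing [x] outwards to (1 + a) x makes room for a ball of radius a rho outside the open ball,
     even if [x] is on the sphere. Its points are within a (rho + |x|) of [x], where [phi] varies by
     at most [k]. *)
  pose a := k / lip / (rho + enorm x).
  have a0 : 0 < a by rewrite !divr_gt0// addr_gt0.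
  have aE : lip * (a * rho + a * enorm x) = k.
    by rewrite /a; field; rewrite !gt_eqF// addr_gt0.
  exists ((1 + a) *: x), (a * rho) => [|y yx]; first by rewrite mulr_gt0.
  have nx : enorm ((1 + a) *: x) = (1 + a) * enorm x.
    by rewrite enormZ gtr0_norm// addr_gt0.
  have h1 := enorm_sub y ((1 + a) *: x); rewrite nx in h1.
  have h2 : enorm (y - x) <= a * rho + a * enorm x.
    apply: (le_trans (enormB_le y ((1 + a) *: x) x)); apply: lerD; first exact: ltW.
    by rewrite scalerDl scale1r addrC addKr enormZ gtr0_norm.
  split.
    rewrite /= inB => yr; have := le_lt_trans h1 yx; rewrite ltr_norml => /andP[h3 _].
    have : a * rho <= a * enorm x by rewrite ler_pM2l.
    lra.
  have h3 : lip * enorm (y - x) <= k by rewrite -aE ler_pM2l.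
  have h4 := phil x y; rewrite enormBC in h4.
  have := ler_normD (phi x - phi y) (phi y); rewrite subrK; lra.
(* The smallness of [phi] is assumed outside the ball only; clamping makes it global, keeps the
   Lipschitz bound and changes nothing outside. *)
pose phic x := quarter_clamp (phi x).
have phim x : `|phic x| <= 4^-1 by exact: quarter_clamp_bound.
have phicl x y : `|phic x - phic y| <= lip * enorm (x - y).
  exact: le_trans (quarter_clamp_lip _ _) (phil x y).
have cc l x : L l -> enorm x < rho -> {for x, continuous (c l)}.
  move=> Ll xr; have [cl _] := cH l Ll.
  by move: cl; rewrite continuous_open_subspace; [apply; rewrite inE inB|exact: eball_open].
pose nc l := Linfty_norm (eball 0 rho) (c l).
have nc0 l : (0 <= nc l)%E by exact: Linfty_norm_ge0.
have ncE : (\sum_(l <oo | l \in L) nc l = \esum_(l in L) nc l)%E.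
  by rewrite nneseries_esum//; congr esum; apply/seteqP; split=> l /=; rewrite inE.
have nc_sum n : (\sum_(0 <= l < n | l \in L) nc l <= (4^-1)%:E)%E.
  apply: le_trans c4; apply: (@le_trans _ _ (\sum_(l <oo | l \in L) nc l)%E).
    exact: nneseries_lim_ge.
  by rewrite ncE.
have nc_fin l : L l -> nc l \is a fin_num.
  move=> Ll; rewrite ge0_fin_numE//; apply: le_lt_trans (ltry (4^-1)).
  apply: le_trans (nc_sum l.+1); rewrite big_mkcond big_nat_recr//= mem_set//.
  by rewrite leeDr// sume_ge0// => i _; case: ifP.
(* Real majorants of the coefficients; taking the real part loses nothing, as each norm is finite by
   [nc_fin]. *)
pose b l := if l \in L then fine (nc l) else 0.
have b0 l : 0 <= b l by rewrite /b; case: ifP => // _; exact: fine_ge0.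
have bB n : \sum_(0 <= l < n) b l <= 4^-1.
  rewrite -lee_fin -sumEFin; apply: le_trans (nc_sum n); rewrite [leRHS]big_mkcond/=.
  apply: lee_sum => l _; rewrite /b; case: ifPn => // /set_mem Ll.
  by rewrite fineK// nc_fin.
have cb l x : L l -> enorm x < rho -> `|c l x| <= b l.
  move=> Ll xr; rewrite /b mem_set//.
  have : (Linfty_norm (eball 0 rho) (c l) <= (fine (nc l))%:E)%E by rewrite fineK// nc_fin.
  apply: Linfty_norm_pointwise => k k0; exists x.
  have cx : c l y @[y --> x] --> c l x by exact: cc.
  have /cvgrPdist_lt /(_ _ k0) near1 := cx.
  have near2 : nbhs x (eball 0 rho) by apply: open_nbhs_nbhs; split;
    [exact: eball_open|rewrite inB].
  have near12 : nbhs x (fun y =>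
    `|c l x - c l y| < k /\ eball 0 rho y) by exact: filterI near1 near2.
  have [e e0 he] := (nbhs_enormP x _).1 near12.
  exists e => // y /he [h1 h2]; split=> //.
  have := ler_normD (c l x - c l y) (c l y); rewrite subrK; lra.
(* The series is controlled only for |a| <= 1/4. With the clamp the bounds hold for all [a], and the
   values at [u] are unchanged since |u| <= 1/4. *)
pose G x a := nonlinearity L c x (quarter_clamp a).
have q4 := @quarter_clamp_bound R.
have Gm x a : enorm x < rho -> `|G x a| <= 4^-1.
  by move=> xr; exact: (nonlinearity_bound b0 cb bB xr (q4 a)).
have Glip x a a' : enorm x < rho -> `|G x a - G x a'| <= 2^-1 * `|a - a'|.
  move=> xr; apply: (le_trans (nonlinearity_lipschitz b0 cb bB xr (q4 a) (q4 a'))).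
  have := quarter_clamp_lip a a'; have := normr_ge0 (a - a'); lra.
have Guc : interior_unif_cont rho G.
  move=> sg k sg0 k0; have [e e0 he] := nonlinearity_unif_cont cc b0 cb bB sg0 k0.
  by exists e => // x y xs ys xy a; exact: he.
have C0 := frac_laplacian_const_gt0 d hs.
have m0 : 0 < 4^-1 :> R by rewrite invr_gt0.
have [u [uu um uout ulim]] := limit_exists hs C0 m0 rho0 lip0 phim phicl Gm Glip Guc.
have [cn cn0 cnP] := near_constant_exists d hs.
exists u; split; last first.
  by move=> x; rewrite inB => xr; exact: (nonlinearity_cvg b0 cb bB).
have fG x : enorm x < rho -> nonlinearity L c x (u x) = G x (u x).
  by move=> _; rewrite /G quarter_clamp_id.
have [usub usup] := viscosity_solution_of_limit hs cn0 cnP Glip Guc ulim uu um fG.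
split=> //.
- by apply: continuous_subspaceT; exact: unif_cont_continuous.
- move=> x; rewrite inB => /negP; rewrite -leNgt => xr.
  by rewrite uout// /phic quarter_clamp_id// phiout.
Qed.
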